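(* Assume the setup described in the context (finite chain of slabs with a common coarse length $\ell>0$), and let $z_0=(x_0,t_0)$ be such that the quantities $\Psi,\Psi^\ell,\Omega^\ell$ at $(z_0,r_k)$ are defined and finite for the scales under consideration. Let $\varepsilon_0>0$, $0<\eta<1/4$, $c_0=\frac14-\eta$, and $a_0>0$. Suppose that the coarse package belongs to a class on which, for every scale $r_k$ under consideration, the implication $$\Psi^\ell(z_0,r_k)\ge c_0\varepsilon_0\quad\Longrightarrow\quad\mathfrak A_k(G)\ge a_0$$ holds. Let $\beta_k\in\{0,\dots,m_k\}$ $(0\le k\le N-1)$ be the selected indices, i.e. indices with $|\mathcal W_k[\phi_{k,\beta_k}]|\ge c_k\mathfrak A_k(G)$ (such indices exist), and set $\widehat\phi_k=\phi_{k,\beta_k}$, $\mathcal W_k=\mathcal W_k[\widehat\phi_k]$, $\mathcal D_k=\mathcal D_k[\widehat\phi_k]$, $\mathcal L_k=\mathcal L_k[\widehat\phi_k]$, $\mathcal W_k^\pm=\max\{\pm\mathcal W_k,0\}$, $w_k=r_k/r_0$. If for a scale $r_k$ under consideration $\Psi(z_0,r_k)\ge\varepsilon_0$ and $\Omega^\ell(z_0,r_k)\le\eta\varepsilon_0$, then $$|\mathcal W_k[\widehat\phi_k]|\ge c_ka_0.$$ Equivalently, for every such $k$, either $\mathcal W_k^+\ge c_ka_0$ or $\mathcal W_k^-\ge c_ka_0$. Moreover, $$\sum_{k=0}^{N-1}w_k(\mathcal W_k^++\mathcal D_k)\le\mathcal E_0^-+\sum_{k=0}^{N-1}w_k|\mathcal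 L_k|+\sum_{k=0}^{N-1}w_k\mathcal W_k^-.$$
   Context: Solution. $(u,p)$ is a suitable weak solution of $\partial_tu-\Delta u+\nabla\cdot(u\otimes u)+\nabla p=0$, $\nabla\cdot u=0$ in $\mathcal Q=B_{2r_0}(x_0)\times(T_0,T_1)\subset\mathbb R^3\times\mathbb R$, $r_0>0$: that is, $u\in L^\infty_tL^2_x(\mathcal Q)\cap L^2_tH^1_x(\mathcal Q)$, $p\in L^{3/2}(\mathcal Q)$, the equations hold in distributions, and for every nonnegative $\phi\in C_c^\infty(\mathcal Q)$ and a.e. $t$, $\int|u(x,t)|^2\phi(x,t)\,dx+2\int_{-\infty}^t\int|\nabla u|^2\phi\,dx\,ds\le\int_{-\infty}^t\int|u|^2(\partial_s\phi+\Delta\phi)\,dx\,ds+\int_{-\infty}^t\int(|u|^2+2p)u\cdot\nabla\phi\,dx\,ds$. The (locally) weakly $L^2$-continuous-in-time representative of $u$ is used. Coarse fields (the coarse package). $\rho\in C_c^\infty(B_1)$ is nonnegative, radial, $\int\rho=1$; $\rho_\ell(x)=\ell^{-3}\rho(x/\ell)$; $S_\ell f=\rho_\ell*_xf$ (space only). One length $\ell>0$ is fixed, small enough that every spatial convolution used stays inside $B_{2r_0}(x_0)$. $U=U^\ell=S_\ell u$, $P=P^\ell=S_\ell p$, $R=S_\ell(u\otimes u)-U\otimes U$, $\Pi=-R:\nabla U$. $U$ is continuous in time with values in $L^2$ of compact interior spatial sets. $G=G^\ell=\Pi+\nabla\cdot(PU)$ is the distribution with $\langle G,\phi\rangle=\int\phi\Pi\,dx\,dt-\int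 PU\cdot\nabla\phi\,dx\,dt$. CKN quantities. $B_r(x_0)$ is the open ball, $Q_r(z_0)=B_r(x_0)\times(t_0-r^2,t_0)$, $\mathsf P_{r,z_0}f(x,t)=f(x,t)-|B_r|^{-1}\int_{B_r(x_0)}f(y,t)\,dy$; $\Psi(z_0,r)=r^{-2}\int_{Q_r(z_0)}(|u|^3+|\mathsf P_{r,z_0}p|^{3/2})\,dx\,dt$, $\Psi^\ell(z_0,r)=r^{-2}\int_{Q_r(z_0)}(|U^\ell|^3+|\mathsf P_{r,z_0}P^\ell|^{3/2})\,dx\,dt$, $\Omega^\ell(z_0,r)=r^{-2}\int_{Q_r(z_0)}(|u-U^\ell|^3+|\mathsf P_{r,z_0}(p-P^\ell)|^{3/2})\,dx\,dt$. Chain. $N\in\mathbb N$, $0<\theta<1$, $r_k=\theta^kr_0$ $(0\le k\le N)$; times $\tau_0<\dots<\tau_N$ with $\tau_{k+1}-\tau_k=r_k^2$; $I_k=(\tau_k,\tau_{k+1})$, $Q_k=B_{r_k}(x_0)\times I_k$; each $\overline{B_{r_k}(x_0)}\times[\tau_k,\tau_{k+1}]$ is compactly contained in the region where the coarse fields are defined. $\chi\in C_c^\infty(B_1)$ is radial, nonincreasing in $|x|$, $0\le\chi\le1$, $\chi\equiv1$ on $B_\vartheta$ for some $0<\vartheta<1$; $\chi_k(x)=\chi((x-x_0)/r_k)$. The scales under consideration are some of the $r_k$, $0\le k\le N-1$. Functionals. For nonnegative $\phi\in C^\infty([\tau_k,\tau_{k+1}];C_c^\infty(B_{r_k}(x_0)))$: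 $\mathcal W_k[\phi]=r_k^{-1}\int_{I_k}\int(\phi\Pi-PU\cdot\nabla\phi)\,dx\,dt$, $\mathcal D_k[\phi]=r_k^{-1}\int_{I_k}\int\phi|\nabla U|^2\,dx\,dt$, $\mathcal L_k[\phi]=r_k^{-1}\int_{I_k}\int[\frac12|U|^2(\partial_t\phi+\Delta\phi)+\frac12|U|^2U\cdot\nabla\phi+(RU)\cdot\nabla\phi]\,dx\,dt$. $\mathcal E_0^-=r_0^{-1}\int\frac12|U(x,\tau_0)|^2\chi_0(x)\,dx$. Active coefficients. For each $k\in\{0,\dots,N-1\}$ fix $m_k\ge1$ and $\psi_{k,1},\dots,\psi_{k,m_k}\in C_c^\infty(B_1\times(0,1))$; $\psi_{k,j}^\sharp(x,t)=\psi_{k,j}((x-x_0)/r_k,(t-\tau_k)/r_k^2)$; $g_{k,j}=r_k^{-1}\langle G,\chi_k\psi_{k,j}^\sharp\rangle=r_k^{-1}\int_{Q_k}[\chi_k\psi_{k,j}^\sharp\Pi-PU\cdot\nabla(\chi_k\psi_{k,j}^\sharp)]\,dx\,dt$; $\mathfrak A_k(G)=|(g_{k,j})_j|_{\ell^2}$. Choose an invertible $B_k=(b^k_{\alpha j})\in\mathbb R^{m_k\times m_k}$, set $\eta_{k,\alpha}=\sum_jb^k_{\alpha j}\psi_{k,j}$, and choose $\varepsilon_k>0$ with $\varepsilon_k\max_\alpha\|\eta_{k,\alpha}\|_{L^\infty}\le\frac12$. Weights: $\phi_{k,0}(x,t)=\chi_k(x)$, and for $1\le\alpha\le m_k$, $\phi_{k,\alpha}(x,t)=\chi_k(x)[1+\varepsilon_k\eta_{k,\alpha}((x-x_0)/r_k,(t-\tau_k)/r_k^2)]$.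 $c_k=\frac{\varepsilon_k}{2\sqrt{m_k}}\sigma_{\min}(B_k)$, with $\sigma_{\min}$ the smallest singular value. *)

(* Defs.v *)
From HB Require Import structures.
From mathcomp Require Import all_boot all_order all_algebra.
From mathcomp Require Import all_classical all_reals all_analysis.

Set Implicit Arguments.
Unset Strict Implicit.
Unset Printing Implicit Defensive.

Import Order.TTheory GRing.Theory Num.Theory.
Import numFieldNormedType.Exports.

Local Open Scope classical_set_scope.
Local Open Scope ring_scope.

(* The library has no Lebesgue measure on row vectors, so R^3 is (R * R) * R
   with the iterated product measure, and space-time is R^3 * R. The topology
   and the derivatives are those of the normed product; its norm (and hence the
   library's [ball]) is the max norm, so Euclidean balls are defined below. *)
Notation E3 R :=
  (measurableTypeR R * measurableTypeR R * measurableTypeR R)%type.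
Notation spacetime R := (E3 R * measurableTypeR R)%type.

Definition leb3 (R : realType) : {measure set (E3 R) -> \bar R} :=
  ((@lebesgue_measure R \x @lebesgue_measure R) \x @lebesgue_measure R)%E.

Definition leb4 (R : realType) : {measure set (spacetime R) -> \bar R} :=
  (leb3 R \x @lebesgue_measure R)%E.

Section Smooth.
Context (R : realType) (V : normedModType R).
Implicit Types (f : V -> R) (A D : set V).

Fixpoint iterD (vs : seq V) f : V -> R :=
  if vs is v :: vs' then 'D_v (iterD vs' f) else f.

Definition smooth f := forall vs : seq V,
  continuous (iterD vs f) /\ forall v x, derivable (iterD vs f) x v.

Definition compactly_contained A D :=
  compact (closure A) /\ closure A `<=` D°.

Definition Cc_infty D f :=
  smooth f /\ compactly_contained [set x | f x != 0] D.

End Smooth.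

Section Space.
Context (R : realType).
Implicit Types (x : E3 R) (z : spacetime R).

Definition enorm x : R := Num.sqrt (x.1.1 ^+ 2 + x.1.2 ^+ 2 + x.2 ^+ 2).

Definition eball (x0 : E3 R) (r : R) : set (E3 R) :=
  [set x | enorm (x - x0) < r].

Definition ebasis (j : 'I_3) : E3 R :=
  ((j == 0 :> nat)%:R, (j == 1 :> nat)%:R, (j == 2 :> nat)%:R).

Definition dspace (j : 'I_3) (f : spacetime R -> R) : spacetime R -> R :=
  'D_((ebasis j, 0) : spacetime R) f.

Definition dtime (f : spacetime R -> R) : spacetime R -> R :=
  'D_((0, 1) : spacetime R) f.

Definition laplacian (f : spacetime R -> R) (z : spacetime R) : R :=
  \sum_j dspace j (dspace j f) z.

Definition vfield := 'I_3 -> spacetime R -> R.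
Definition tfield := 'I_3 -> 'I_3 -> spacetime R -> R.

Definition sqnorm (v : vfield) z : R := \sum_i v i z ^+ 2.

Definition transport (v : vfield) (f : spacetime R -> R) z : R :=
  \sum_j v j z * dspace j f z.

Definition radial (f : E3 R -> R) :=
  forall x y, enorm x = enorm y -> f x = f y.

End Space.

Section NavierStokes.
Context (R : realType) (B : set (E3 R)) (T0 T1 : R).
Context (u : vfield R) (p : spacetime R -> R).
Let Q : set (spacetime R) := B `*` `]T0, T1[%classic.

Definition in_LinftyL2 := exists C : R, {ae @lebesgue_measure R,
  forall t, T0 < t < T1 ->
    (\int[leb3 R]_(x in B) (sqnorm u (x, t))%:E <= C%:E)%E}.

(* L^2 in time with values in H^1: u and its weak spatial gradient on Q, with
   Du i j = d_j u_i, are square integrable on Q *)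
Definition in_L2H1 (Du : tfield R) :=
  [/\ forall i, measurable_fun Q (u i),
      (\int[leb4 R]_(z in Q) (sqnorm u z)%:E < +oo)%E,
      forall i j, measurable_fun Q (Du i j),
      (\int[leb4 R]_(z in Q) (\sum_i sqnorm (Du i) z)%:E < +oo)%E &
      forall i j phi, Cc_infty Q phi ->
        \int[leb4 R]_(z in Q) (u i z * dspace j phi z) =
        - \int[leb4 R]_(z in Q) (Du i j z * phi z)].

Definition in_L32 := measurable_fun Q p /\
  (\int[leb4 R]_(z in Q) (`|p z| `^ (3 / 2))%:E < +oo)%E.

Definition NS_distributional :=
  (forall i phi, Cc_infty Q phi ->
     \int[leb4 R]_(z in Q)
       (u i z * (dtime phi z + laplacian phi z)
        + (\sum_j u i z * u j z * dspace j phi z)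
        + p z * dspace i phi z) = 0) /\
  (forall phi, Cc_infty Q phi ->
     \int[leb4 R]_(z in Q) transport u phi z = 0).

Definition local_energy_inequality (Du : tfield R) :=
  forall phi, Cc_infty Q phi -> (forall z, 0 <= phi z) ->
  {ae @lebesgue_measure R, forall t,
    let past := [set: E3 R] `*` `]-oo, t]%classic in
    \int[leb3 R]_x (sqnorm u (x, t) * phi (x, t))
    + 2 * \int[leb4 R]_(z in past) ((\sum_i sqnorm (Du i) z) * phi z)
    <= \int[leb4 R]_(z in past) (sqnorm u z * (dtime phi z + laplacian phi z))
       + \int[leb4 R]_(z in past) ((sqnorm u z + 2 * p z) * transport u phi z)}.

Definition suitable_weak_solution := exists Du : tfield R,
  [/\ in_LinftyL2, in_L2H1 Du, in_L32, NS_distributional &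
      local_energy_inequality Du].

(* u(., t) is a genuine element of L^2(K) for every t, not just almost every t:
   this selects the representative whose time slices are used below *)
Definition weakly_continuous := forall K : set (E3 R), compact K -> K `<=` B ->
  (forall i t, T0 < t < T1 ->
     (\int[leb3 R]_(x in K) (u i (x, t) ^+ 2)%:E < +oo)%E) /\
  (forall i (w : E3 R -> R), measurable_fun K w ->
     (\int[leb3 R]_(x in K) (w x ^+ 2)%:E < +oo)%E ->
     forall t, T0 < t < T1 ->
       {for t, continuous (fun s : R => \int[leb3 R]_(x in K) (u i (x, s) * w x))}).

End NavierStokes.

Section Coarse.
Context (R : realType).

Definition mollifier (rho : E3 R -> R) :=
  [/\ Cc_infty (eball 0 1) rho, forall x, 0 <= rho x, radial rho &
      \int[leb3 R]_x rho x = 1].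

Definition cutoff (chi : E3 R -> R) :=
  [/\ Cc_infty (eball 0 1) chi,
      radial chi /\ (forall x y, enorm x <= enorm y -> chi y <= chi x),
      forall x, 0 <= chi x <= 1 &
      exists vt : R, 0 < vt < 1 /\ forall x, eball 0 vt x -> chi x = 1].

(* S_l f = rho_l * f in the space variable *)
Definition smoothing (rho : E3 R -> R) (l : R) (f : spacetime R -> R)
    (z : spacetime R) : R :=
  \int[leb3 R]_y (l ^- 3 * rho (l^-1 *: (z.1 - y)) * f (y, z.2)).

Record package := Package {
  pkU : vfield R;
  pkP : spacetime R -> R;
  pkR : tfield R }.

Definition coarse_package rho l (u : vfield R) (p : spacetime R -> R) :=
  let U : vfield R := fun i => smoothing rho l (u i) in
  Package U (smoothing rho l p)
    (fun i j z => smoothing rho l (fun y => u i y * u j y) z - U i z * U j z).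

(* where the spatial convolutions only see values inside the domain *)
Definition coarse_region (x0 : E3 R) (r0 T0 T1 l : R) : set (spacetime R) :=
  [set z | eball z.1 l `<=` eball x0 (2 * r0) /\ T0 < z.2 < T1].

Definition pkPi (pk : package) (z : spacetime R) : R :=
  - \sum_i \sum_j pkR pk i j z * dspace j (pkU pk i) z.

(* <G, phi>, meant for phi supported in [coarse_region]; both integrands vanish
   outside the support of phi *)
Definition pairing_G (pk : package) (phi : spacetime R -> R) : R :=
  \int[leb4 R]_z (phi z * pkPi pk z)
  - \int[leb4 R]_z (pkP pk z * transport (pkU pk) phi z).

End Coarse.

Section CKN.
Context {R : realType}.

Definition cyl (x0 : E3 R) (t0 r : R) : set (spacetime R) :=
  eball x0 r `*` `]t0 - r ^+ 2, t0[%classic.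

Definition unit_cyl : set (spacetime R) := eball 0 1 `*` `]0, 1[%classic.

Definition subtract_mean (x0 : E3 R) (r : R) (f : spacetime R -> R)
    (z : spacetime R) : R :=
  f z - (fine (leb3 R (eball x0 r)))^-1
        * \int[leb3 R]_(y in eball x0 r) f (y, z.2).

(* the common shape of Psi (v = u, q = p), Psi^l and Omega^l; extended-real
   valued, so that finiteness is a meaningful hypothesis *)
Definition ckn (v : vfield R) (q : spacetime R -> R) (x0 : E3 R) (t0 r : R)
    : \bar R :=
  ((r ^- 2)%:E * \int[leb4 R]_(z in cyl x0 t0 r)
     (Num.sqrt (sqnorm v z) ^+ 3 + `|subtract_mean x0 r q z| `^ (3 / 2))%:E)%E.

Definition Psi_coarse (pk : package R) := ckn (pkU pk) (pkP pk).

Definition Omega (u : vfield R) (p : spacetime R -> R) (pk : package R) :=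
  ckn (fun i z => u i z - pkU pk i z) (fun z => p z - pkP pk z).

End CKN.

Section Functionals.
Context (R : realType).
Variables (pk : package R) (r a b : R) (phi : spacetime R -> R).
Let U := pkU pk.
Let slab : set (spacetime R) := [set: E3 R] `*` `]a, b[%classic.

Definition calW : R := r^-1 * \int[leb4 R]_(z in slab)
  (phi z * pkPi pk z - pkP pk z * transport U phi z).

Definition calD : R := r^-1 * \int[leb4 R]_(z in slab)
  (phi z * \sum_i \sum_j dspace j (U i) z ^+ 2).

Definition calL : R := r^-1 * \int[leb4 R]_(z in slab)
  (2^-1 * sqnorm U z * (dtime phi z + laplacian phi z)
   + 2^-1 * sqnorm U z * transport U phi z
   + transport (fun i y => \sum_j pkR pk i j y * U j y) phi z).

End Functionals.

Section Active.
Context (R : realType) (x0 : E3 R) (chi : E3 R -> R) (r t : R).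

Definition chi_at (x : E3 R) : R := chi (r^-1 *: (x - x0)).

Definition initial_energy (pk : package R) : R :=
  r^-1 * \int[leb3 R]_x (2^-1 * sqnorm (pkU pk) (x, t) * chi_at x).

Definition rescale (f : spacetime R -> R) (z : spacetime R) : R :=
  f (r^-1 *: (z.1 - x0), (z.2 - t) / r ^+ 2).

Definition active_norm (pk : package R) m (psi : 'I_m -> spacetime R -> R) : R :=
  Num.sqrt (\sum_j
    (r^-1 * pairing_G pk (fun z => chi_at z.1 * rescale (psi j) z)) ^+ 2).

Definition mix m (B : 'M[R]_m) (psi : 'I_m -> spacetime R -> R) (al : 'I_m)
    (z : spacetime R) : R :=
  \sum_j B al j * psi j z.

(* index 0 is the unperturbed weight; [lift ord0 al] carries the perturbation
   by [eta al] *)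
Definition weight m (eps : R) (eta : 'I_m -> spacetime R -> R) (k : 'I_m.+1)
    (z : spacetime R) : R :=
  if unlift ord0 k is Some al then chi_at z.1 * (1 + eps * rescale (eta al) z)
  else chi_at z.1.

End Active.

Definition singular_values (R : realType) m (B : 'M[R]_m) : set R :=
  [set s | 0 <= s /\ eigenvalue (B^T *m B) (s ^+ 2)].

Definition sigma_min (R : realType) m (B : 'M[R]_m) : R :=
  inf (singular_values B).

Definition Linfty (R : realType) (f : spacetime R -> R) : \bar R :=
  'N[leb4 R]_+oo[EFin \o f]%E.

(* Main.v *)
Require Import Defs.
From HB Require Import structures.
From mathcomp Require Import all_boot all_order all_algebra.
From mathcomp Require Import all_classical all_reals all_analysis.
From mathcomp Require Import measurable_realfun.
From mathcomp Require Import ring lra.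
Set Implicit Arguments.
Unset Strict Implicit.
Unset Printing Implicit Defensive.
Import Order.TTheory GRing.Theory Num.Theory.
Import numFieldNormedType.Exports.
Local Open Scope classical_set_scope.
Local Open Scope ring_scope.

(** Testing the equations with [k (x - y) * th s], [k] the mollifier at scale [l] or
    one of its derivatives, shows that each coarse velocity component is, for
    fixed [x], the primitive of an integrable density in time. Hence the energy
    balance of the coarse field against a weight is an equality,
      W_k + D_k = L_k + r_k^-1 (E_k(tau_k) - E_k(tau_{k+1})),
    and the boundary energies are those of the unperturbed weight [chi_k], since
    the perturbations vanish near both ends of the slab. Multiplied by [r_k / r_0]
    and summed over [k], they telescope up to terms of the right sign, because
    [chi_{k+1} <= chi_k]; no energy inequality for [u] is needed.
    An index [beta_k] exists because W_k is linear in the weight: were all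
    W_k[phi_{k,al}] small, so would be the vector [B g], of norm at least
    [sigma_min B * |g|]. For the threshold, convexity gives
    Psi <= 4 (Psi^l + Omega^l), so Psi >= eps0 and Omega^l <= eta eps0 force
    Psi^l >= (1/4 - eta) eps0. *)

(** The a priori bounds hold at almost every time, whereas the coarse package is defined at every
    time by a real integral that silently takes the value 0 on a non-integrable slice. Two versions
    of the coarse fields are therefore carried along. The truncated one, with the fields set to 0 at
    bad times, has controlled slices everywhere; it carries the estimates, the density [cF] and the
    slab integrals. The original velocity is continuous in time, by weak continuity of [u], and
    gives a meaning to the energies at the chain times. Both agree at almost every time, which
    suffices inside slab integrals.

    Mollification acts in space only, so for fixed [x] the coarse velocity is treated as a primitive
    in time: the energy equality rests on a product rule for primitives, proved by Fubini, and the
    energy flux is integrated away slice by slice.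

    The threshold constant [1/4] is the inverse of [2^{3-1}], the convexity constant of the cube;
    the exponent [3/2] of the pressure has a smaller one. The cutoff [chi] also supplies the smooth
    time steps used as test functions. *)

Section SigmaFiniteProduct.
Context d1 d2 (T1 : measurableType d1) (T2 : measurableType d2) (R : realType).
Context (m1 : {sigma_finite_measure set T1 -> \bar R}).
Context (m2 : {sigma_finite_measure set T2 -> \bar R}).

Definition sfprod : set (T1 * T2)%type -> \bar R := (m1 \x m2)%E.

HB.instance Definition _ := Measure.copy sfprod (m1 \x m2)%E.

(** Products of the two exhausting sequences, enumerated through [pickle], exhaust the product. This
    allows the product construction to be iterated up to space-time. *)
Lemma sfprod_sigma_finite : sigma_finite setT sfprod.
Proof.
have [F TF Foo] := sigma_finiteT m1.
have [G TG Goo] := sigma_finiteT m2.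
pose dec n := odflt (0, 0)%N (unpickle n : option (nat * nat)).
exists (fun n => F (dec n).1 `*` G (dec n).2).
  rewrite predeqE => -[x y]; split=> // _.
  have [i _ Fx] : (\bigcup_k F k) x by rewrite -TF.
  have [j _ Gy] : (\bigcup_k G k) y by rewrite -TG.
  by exists (pickle (i, j)) => //; rewrite /dec pickleK.
move=> k; have [mF Fk] := Foo (dec k).1; have [mG Gk] := Goo (dec k).2.
split; first exact: measurableX.
by rewrite /sfprod product_measure1E// lte_mul_pinfty// ge0_fin_numE.
Qed.

HB.instance Definition _ := Measure_isSigmaFinite.Build _ _ _ sfprod
  sfprod_sigma_finite.

End SigmaFiniteProduct.

Section Space.
Context (R : realType).
Local Notation leb1 := (@lebesgue_measure R).
(** [sleb3] and [sleb4] are convertible to [leb3] and [leb4]; the bundled type adds the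
    sigma-finiteness that Fubini asks for. *)
Definition sleb1 : {sigma_finite_measure set (measurableTypeR R) -> \bar R} := leb1.
Definition sleb2 : {sigma_finite_measure set (measurableTypeR R * measurableTypeR R)%type -> \bar R} := sfprod sleb1 sleb1.
Definition sleb3 : {sigma_finite_measure set (E3 R) -> \bar R} := sfprod sleb2 sleb1.
Definition sleb4 : {sigma_finite_measure set (spacetime R) -> \bar R} := sfprod sleb3 sleb1.
End Space.

(** * Almost everywhere equality and integrals of real functions *)

Lemma ae_imply d (T : measurableType d) (R : realType)
    (mu : {measure set T -> \bar R}) (P Q : T -> Prop) :
  (forall x, P x -> Q x) -> {ae mu, forall x, P x} -> {ae mu, forall x, Q x}.
Proof. by move=> PQ aeP; apply: filterS aeP. Qed.

Lemma ae_and d (T : measurableType d) (R : realType)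
    (mu : {measure set T -> \bar R}) (P Q : T -> Prop) :
  {ae mu, forall x, P x} -> {ae mu, forall x, Q x} -> {ae mu, forall x, P x /\ Q x}.
Proof. by move=> aeP aeQ; apply: filterS2 aeP aeQ. Qed.

Section IntegralAlmostEverywhere.
Context d (T : measurableType d) (R : realType) (mu : {measure set T -> \bar R}).
Local Open Scope ereal_scope.
Import HBNNSimple.

(** The integral of a nonnegative function is a supremum over simple functions below it. Setting
    such a simple function to 0 on the null set [N] keeps its integral and puts it below [g], which
    is why no measurability enters. *)
Let ae_le_ge0_integral (f g : T -> \bar R) :
    (forall x, 0 <= f x) -> (forall x, 0 <= g x) ->
    {ae mu, forall x, f x = g x} ->
  \int[mu]_x f x <= \int[mu]_x g x.
Proof.
move=> f0 g0 [N [mN N0 fgN]].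
have fgE x : ~ N x -> f x = g x.
  by move=> Nx; apply: contrapT => fg; apply: Nx; exact: fgN.
rewrite [leLHS]ge0_integralTE//; apply: ge_ereal_sup => _ [h /= hf <-].
rewrite -integralT_nnsfun.
rewrite (ge0_negligible_integral mN)//; last 2 first.
- exact/measurable_EFinP.
- by move=> x _; rewrite lee_fin.
have mN' : measurable (~` N) by exact: measurableC.
have -> : \int[mu]_(x in setT `\` N) (h x)%:E =
    \int[mu]_x (proj_nnsfun h mN' x)%:E.
  rewrite setTD integral_mkcond; apply: eq_integral => x _.
  by rewrite patchE /= mindicE; have [_|_] := boolP (x \in ~` N);
    rewrite ?mulr1 ?mulr0.
rewrite integralT_nnsfun ge0_integralTE//; apply: ereal_sup_ubound => /=.
exists (proj_nnsfun h mN') => // x /=; rewrite mindicE.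
have [xN|_] := boolP (x \in ~` N); last by rewrite mulr0.
by rewrite mulr1 -(fgE _ (set_mem xN)).
Qed.

Let ae_eq_ge0_integral (f g : T -> \bar R) :
    (forall x, 0 <= f x) -> (forall x, 0 <= g x) ->
    {ae mu, forall x, f x = g x} ->
  \int[mu]_x f x = \int[mu]_x g x.
Proof.
move=> f0 g0 fg; apply/eqP; rewrite eq_le !ae_le_ge0_integral//.
by apply: filterS fg.
Qed.

(* Unlike [ae_eq_integral], neither function has to be measurable. *)
Lemma ae_eq_integral_nomeas (D : set T) (f g : T -> \bar R) :
  {ae mu, forall x, D x -> f x = g x} ->
  \int[mu]_(x in D) f x = \int[mu]_(x in D) g x.
Proof.
move=> fg; rewrite integral_mkcond [RHS]integral_mkcond.
have {}fg : {ae mu, forall x, (f \_ D) x = (g \_ D) x}.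
  apply: filterS fg => x fgx; rewrite !patchE.
  by case: ifPn => // /set_mem; exact: fgx.
rewrite integralE [RHS]integralE; congr (_ - _); apply: ae_eq_ge0_integral => //.
- by apply: filterS fg => x; rewrite !funeposE => ->.
- by apply: filterS fg => x; rewrite !funenegE => ->.
Qed.

Lemma ae_eq_Rintegral (D : set T) (f g : T -> R) :
  {ae mu, forall x, D x -> f x = g x} ->
  (\int[mu]_(x in D) f x = \int[mu]_(x in D) g x)%R.
Proof.
move=> fg; congr fine; apply: ae_eq_integral_nomeas.
by apply: filterS fg => x /[apply] ->.
Qed.

End IntegralAlmostEverywhere.

Notation rintegrable mu f := (mu.-integrable setT (EFin \o f)).

Section RealIntegrable.
Context d (T : measurableType d) (R : realType) (mu : {measure set T -> \bar R}).
Implicit Types f g : T -> R.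

Lemma rintegrable_measurable f : rintegrable mu f -> measurable_fun setT f.
Proof. by case/integrableP => /measurable_EFinP. Qed.

Lemma rintegrable_le f g : measurable_fun setT f -> rintegrable mu g ->
  (forall x, `|f x| <= g x) -> rintegrable mu f.
Proof.
move=> mf ig fg; apply: le_integrable ig => //; first exact/measurable_EFinP.
by move=> x _ /=; rewrite lee_fin (le_trans (fg x))// ler_norm.
Qed.

Lemma rintegrableD f g : rintegrable mu f -> rintegrable mu g ->
  rintegrable mu (fun x => f x + g x).
Proof. by move=> fi gi; exact: (integrableD measurableT fi gi). Qed.

Lemma rintegrableB f g : rintegrable mu f -> rintegrable mu g ->
  rintegrable mu (fun x => f x - g x).
Proof. by move=> fi gi; exact: (integrableB measurableT fi gi). Qed.

Lemma rintegrableZl (k : R) f : rintegrable mu f ->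
  rintegrable mu (fun x => k * f x).
Proof. by move=> fi; exact: (integrableZl measurableT k fi). Qed.

Lemma rintegrable_norm f : rintegrable mu f -> rintegrable mu (fun x => `|f x|).
Proof. by move=> fi; exact: (integrable_abse fi). Qed.

Lemma rintegrable0 : rintegrable mu (fun=> 0).
Proof. exact: integrable0. Qed.

Lemma rintegrable_sum (I : Type) (s : seq I) (F : I -> T -> R) :
  (forall i, rintegrable mu (F i)) -> rintegrable mu (fun x => \sum_(i <- s) F i x).
Proof.
move=> Fi; elim: s => [|i s IH].
  by under eq_fun do rewrite big_nil; exact: rintegrable0.
by under eq_fun do rewrite big_cons; exact: rintegrableD.
Qed.

Lemma rintegrable_bdM (C : R) f g : measurable_fun setT f ->
  (forall x, `|f x| <= C) -> rintegrable mu g -> rintegrable mu (fun x => f x * g x).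
Proof.
move=> mf fC gi; apply: (@rintegrable_le _ (fun x => C * `|g x|)).
- by apply: measurable_funM => //; exact: rintegrable_measurable gi.
- exact/rintegrableZl/rintegrable_norm.
- by move=> x; rewrite normrM ler_wpM2r.
Qed.

Lemma rintegrable_indic (A : set T) : measurable A -> (mu A < +oo)%E ->
  rintegrable mu (\1_A : T -> R).
Proof.
move=> mA muA; apply/integrableP; split; first exact/measurable_EFinP.
under eq_integral do rewrite /= ger0_norm//.
by rewrite integral_indic// setIT.
Qed.

Lemma rintegralD f g : rintegrable mu f -> rintegrable mu g ->
  \int[mu]_x (f x + g x) = \int[mu]_x f x + \int[mu]_x g x.
Proof. by move=> fi gi; rewrite RintegralD. Qed.

Lemma rintegralB f g : rintegrable mu f -> rintegrable mu g ->
  \int[mu]_x (f x - g x) = \int[mu]_x f x - \int[mu]_x g x.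
Proof. by move=> fi gi; rewrite RintegralB. Qed.

Lemma rintegralZl (k : R) f : rintegrable mu f ->
  \int[mu]_x (k * f x) = k * \int[mu]_x f x.
Proof. by move=> fi; rewrite RintegralZl. Qed.

Lemma rintegralN f : rintegrable mu f ->
  \int[mu]_x (- f x) = - \int[mu]_x f x.
Proof.
move=> fi; rewrite -mulN1r -rintegralZl//.
by apply: eq_Rintegral => x _; rewrite mulN1r.
Qed.

Lemma rintegral0 : \int[mu]_x (0 : R) = 0.
Proof. by rewrite /Rintegral integral0. Qed.

Lemma rintegral_sum (I : Type) (s : seq I) (F : I -> T -> R) :
  (forall i, rintegrable mu (F i)) ->
  \int[mu]_x (\sum_(i <- s) F i x) = \sum_(i <- s) \int[mu]_x F i x.
Proof.
move=> Fi; elim: s => [|i s IH].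
  under eq_Rintegral do rewrite big_nil.
  by rewrite big_nil rintegral0.
under eq_Rintegral do rewrite big_cons.
by rewrite big_cons rintegralD ?IH//; exact: rintegrable_sum.
Qed.

Lemma ler_rintegral f g : rintegrable mu f -> rintegrable mu g ->
  (forall x, f x <= g x) -> \int[mu]_x f x <= \int[mu]_x g x.
Proof. by move=> fi gi fg; exact: le_Rintegral. Qed.

Lemma norm_rintegral_le f : rintegrable mu f ->
  `|\int[mu]_x f x| <= \int[mu]_x `|f x|.
Proof. by move=> fi; exact: le_normr_Rintegral. Qed.

Lemma rintegral_indicM (D : set T) f :
  \int[mu]_(x in D) f x = \int[mu]_x (\1_D x * f x).
Proof.
rewrite Rintegral_mkcond; apply: eq_Rintegral => x _.
by rewrite patchE indicE; case: ifP => _; rewrite ?mul1r ?mul0r.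
Qed.

Lemma rintegrable_indicM (D : set T) f : measurable D ->
  mu.-integrable D (EFin \o f) <-> rintegrable mu (fun x => \1_D x * f x).
Proof.
move=> mD; have -> : EFin \o (fun x => \1_D x * f x) = (EFin \o f) \_ D.
  apply/funext => x /=; rewrite patchE indicE.
  by case: ifP => _; rewrite ?mul1r ?mul0r.
exact: integrable_mkcond.
Qed.

End RealIntegrable.

Lemma measurable_indicM d (T : measurableType d) (R : realType) (D : set T) (f : T -> R) :
  measurable D -> measurable_fun D f -> measurable_fun setT (fun x => \1_D x * f x).
Proof.
move=> mD mf; have -> : (fun x => \1_D x * f x) = f \_ D.
  by apply/funext => x; rewrite patchE indicE; case: ifP => _; rewrite ?mul1r ?mul0r.
exact: (measurable_restrictT f mD).1.
Qed.

(** * Fubini and Tonelli for real integrals *)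

Section Fubini.
Context d1 d2 (T1 : measurableType d1) (T2 : measurableType d2) (R : realType).
Context (m1 : {sigma_finite_measure set T1 -> \bar R}).
Context (m2 : {sigma_finite_measure set T2 -> \bar R}).
Implicit Types f : T1 * T2 -> R.

(* A real integral is junk-valued (zero) where the integrand is not integrable, so
   no integrability is needed. *)
Lemma measurable_Rintegral2 f : measurable_fun setT f ->
  measurable_fun setT (fun x => \int[m2]_y f (x, y)).
Proof.
move=> mf; apply: measurableT_comp => //.
under eq_fun do rewrite integralE.
have mEf : measurable_fun setT (EFin \o f) by exact/measurable_EFinP.
apply: emeasurable_funB.
- have mf' : measurable_fun setT (fubini_F m2 ((EFin \o f)^\+)%E).
    by apply: measurable_fun_fubini_tonelli_F => //; exact: measurable_funepos.
  apply: eq_measurable_fun mf' => x _; apply: eq_integral => y _.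
  by rewrite !funeposE.
- have mf' : measurable_fun setT (fubini_F m2 ((EFin \o f)^\-)%E).
    by apply: measurable_fun_fubini_tonelli_F => //; exact: measurable_funeneg.
  apply: eq_measurable_fun mf' => x _; apply: eq_integral => y _.
  by rewrite !funenegE.
Qed.

Lemma measurable_Rintegral1 f : measurable_fun setT f ->
  measurable_fun setT (fun y => \int[m1]_x f (x, y)).
Proof.
move=> mf; apply: measurableT_comp => //.
under eq_fun do rewrite integralE.
have mEf : measurable_fun setT (EFin \o f) by exact/measurable_EFinP.
apply: emeasurable_funB.
- have mf' : measurable_fun setT (fubini_G m1 ((EFin \o f)^\+)%E).
    by apply: measurable_fun_fubini_tonelli_G => //; exact: measurable_funepos.
  apply: eq_measurable_fun mf' => x _; apply: eq_integral => y _.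
  by rewrite !funeposE.
- have mf' : measurable_fun setT (fubini_G m1 ((EFin \o f)^\-)%E).
    by apply: measurable_fun_fubini_tonelli_G => //; exact: measurable_funeneg.
  apply: eq_measurable_fun mf' => x _; apply: eq_integral => y _.
  by rewrite !funenegE.
Qed.

(** On the null set of slices that are not integrable the inner real integral is a default value, so
    it is compared with the extended one only almost everywhere. *)
Lemma Rintegral_prod12 f : rintegrable (m1 \x m2)%E f ->
  \int[(m1 \x m2)%E]_z f z = \int[m1]_x \int[m2]_y f (x, y).
Proof.
move=> fi; rewrite /Rintegral -(integral12_prod_meas1 fi); congr fine.
apply: ae_eq_integral_nomeas.
apply: filterS (ae_integrable1 fi) => x fxi _ /=.
by rewrite fineK// integrable_fin_num.
Qed.

Lemma Rintegral_prod21 f : rintegrable (m1 \x m2)%E f ->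
  \int[(m1 \x m2)%E]_z f z = \int[m2]_y \int[m1]_x f (x, y).
Proof.
move=> fi; rewrite /Rintegral -(integral21_prod_meas1 fi); congr fine.
apply: ae_eq_integral_nomeas.
apply: filterS (ae_integrable2 fi) => x fxi _ /=.
by rewrite fineK// integrable_fin_num.
Qed.

(** Tonelli, with the slice masses dominated by an integrable function. *)
Lemma rintegrable_prod12 f g : measurable_fun setT f ->
  (forall x, rintegrable m2 (fun y => f (x, y))) ->
  (forall x, \int[m2]_y `|f (x, y)| <= g x) -> rintegrable m1 g ->
  rintegrable (m1 \x m2)%E f.
Proof.
move=> mf fi fg /integrableP[/measurable_EFinP mg].
have mEf : measurable_fun setT (EFin \o f) by exact/measurable_EFinP.
move=> goo; apply/(integrable12ltyP _ _ mEf); apply: le_lt_trans goo.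
apply: ge0_le_integral => //.
- by move=> x _; exact: integral_ge0.
- apply: (measurable_fun_fubini_tonelli_F (m2 := m2) (abse \o (EFin \o f))).
    exact: measurableT_comp.
  by move=> z; exact: abse_ge0.
- by apply: measurableT_comp => //; exact/measurable_EFinP.
- move=> x _ /=; rewrite -[leLHS]fineK; last first.
    exact: integrable_fin_num (rintegrable_norm (fi x)).
  by rewrite lee_fin (le_trans (fg x))// ler_norm.
Qed.

Lemma rintegrable_prod21 f g : measurable_fun setT f ->
  (forall y, rintegrable m1 (fun x => f (x, y))) ->
  (forall y, \int[m1]_x `|f (x, y)| <= g y) -> rintegrable m2 g ->
  rintegrable (m1 \x m2)%E f.
Proof.
move=> mf fi fg /integrableP[/measurable_EFinP mg].
have mEf : measurable_fun setT (EFin \o f) by exact/measurable_EFinP.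
move=> goo; apply/(integrable21ltyP _ _ mEf); apply: le_lt_trans goo.
apply: ge0_le_integral => //.
- by move=> x _; exact: integral_ge0.
- apply: (measurable_fun_fubini_tonelli_G (m1 := m1) (abse \o (EFin \o f))).
    exact: measurableT_comp.
  by move=> z; exact: abse_ge0.
- by apply: measurableT_comp => //; exact/measurable_EFinP.
- move=> x _ /=; rewrite -[leLHS]fineK; last first.
    exact: integrable_fin_num (rintegrable_norm (fi x)).
  by rewrite lee_fin (le_trans (fg x))// ler_norm.
Qed.

Lemma ae_prod_snd (P : T2 -> Prop) :
  {ae m2, forall y, P y} -> {ae (m1 \x m2)%E, forall z, P z.2}.
Proof.
move=> [N [mN N0 PN]]; exists (setT `*` N); split.
- exact: measurableX.
- by rewrite product_measure1E// N0; exact: mule0.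
- by move=> z /= Pz; split => //; exact: PN.
Qed.

End Fubini.

(** * Open sets and continuous functions are measurable on the products *)

Section CountableBase.

(* The sigma-algebra of a product is generated by rectangles; a countable base of
   measurable neighbourhoods makes the open sets of the product measurable. *)
Definition measurable_base d (T : measurableType d) (nb : T -> set_system T) :=
  exists B : nat -> set T, (forall n, measurable (B n)) /\
    forall x A, nb x A -> exists n, B n x /\ B n `<=` A.

Lemma measurable_base_prod d1 d2 (T1 : measurableType d1) (T2 : measurableType d2)
    (nb1 : T1 -> set_system T1) (nb2 : T2 -> set_system T2) :
  measurable_base nb1 -> measurable_base nb2 ->
  measurable_base (fun z : T1 * T2 => filter_prod (nb1 z.1) (nb2 z.2)).
Proof.
move=> [B1 [mB1 B1P]] [B2 [mB2 B2P]].
pose dec n := odflt (0, 0)%N (unpickle n : option (nat * nat)).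
exists (fun n => B1 (dec n).1 `*` B2 (dec n).2); split.
  by move=> n; exact: measurableX.
move=> -[x y] A [[P Q] [/= /B1P[i [Bx BP]] /B2P[j [By BQ]]] PQ].
exists (pickle (i, j)); rewrite /dec pickleK /=; split => // -[u v] [/= Bu Bv].
by apply: PQ; split; [exact: BP|exact: BQ].
Qed.

Lemma measurable_base_R (R : realType) :
  measurable_base (nbhs : measurableTypeR R -> set_system (measurableTypeR R)).
Proof.
pose dec n := odflt (0, 0) (unpickle n : option (rat * rat)).
exists (fun n => `](ratr (dec n).1 : R), (ratr (dec n).2 : R)[%classic); split.
  by move=> n; exact: measurable_itv.
move=> x A /nbhs_ballP[e /= e0 xA].
have [q] : exists q : rat, ratr q \in `]x - e, x[ by apply: rat_in_itvoo; rewrite ltrBlDr ltrDl.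
rewrite in_itv /= => /andP[q1 q2].
have [r] : exists r : rat, ratr r \in `]x, x + e[ by apply: rat_in_itvoo; rewrite ltrDl.
rewrite in_itv /= => /andP[r1 r2].
exists (pickle (q, r)); rewrite /dec pickleK /=; split; first by rewrite in_itv /= q2 r1.
move=> y /=; rewrite in_itv /= => /andP[qy yr]; apply: xA.
rewrite /ball /= ltr_norml; apply/andP; split.
  by rewrite ltrBrDl -ltrBrDr opprK addrC (lt_trans yr)// addrC.
by rewrite ltrBlDl -ltrBlDr (lt_trans _ qy).
Qed.

Lemma open_measurable_base d (T : measurableType d) (nb : T -> set_system T) (A : set T) :
  measurable_base nb -> (forall x, A x -> nb x A) -> measurable A.
Proof.
move=> [B [mB BP]] oA.
rewrite (_ : A = \bigcup_(n in [set n | B n `<=` A]) B n).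
  by apply: bigcup_measurable => n _; exact: mB.
apply/seteqP; split => [x /= /[dup] /oA/BP[n [Bx BA]] _|x [n /= Bn /Bn]//].
by exists n.
Qed.

Context (R : realType).

Lemma open_measurable_E3 (A : set (E3 R)) : open A -> measurable A.
Proof.
move=> oA; have hR := measurable_base_R R.
apply: (open_measurable_base
  (measurable_base_prod (measurable_base_prod hR hR) hR)).
by move=> x Ax; have : nbhs x A by apply: open_nbhs_nbhs.
Qed.

Lemma open_measurable_spacetime (A : set (spacetime R)) : open A -> measurable A.
Proof.
move=> oA; have hR := measurable_base_R R.
apply: (open_measurable_base (measurable_base_prod
  (measurable_base_prod (measurable_base_prod hR hR) hR) hR)).
by move=> x Ax; have : nbhs x A by apply: open_nbhs_nbhs.
Qed.

Lemma open_preimage_measurable d (T : measurableType d) (f : T -> R) :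
  (forall A : set R, open A -> measurable (f @^-1` A)) -> measurable_fun setT f.
Proof.
move=> fA; apply: (measurability _ (RGenOInfty.measurableE R)) => //.
move=> _ [_ [a ->] <-]; rewrite setTI; apply: fA; exact: rray_open.
Qed.

Lemma continuous_measurable_E3 (f : E3 R -> R) :
  continuous f -> measurable_fun setT f.
Proof.
move=> cf; apply: open_preimage_measurable => A oA.
by apply: open_measurable_E3; move/continuousP : cf; exact.
Qed.

Lemma continuous_measurable_spacetime (f : spacetime R -> R) :
  continuous f -> measurable_fun setT f.
Proof.
move=> cf; apply: open_preimage_measurable => A oA.
by apply: open_measurable_spacetime; move/continuousP : cf; exact.
Qed.

End CountableBase.

(** * Smooth functions, supports and affine substitutions *)

Section SmoothCalculus.
Context (R : realType) (V : normedModType R).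
Implicit Types f g : V -> R.

(* [b] says whether the derivatives are required to be continuous. *)
Fixpoint Ck (b : bool) n f : Prop :=
  [/\ b -> continuous f, forall v x, derivable f x v &
      if n is n'.+1 then forall v, Ck b n' ('D_v f) else True].

Lemma iterD_rcons vs (v : V) f : Defs.iterD (rcons vs v) f = Defs.iterD vs ('D_v f).
Proof. by elim: vs => //= w vs ->. Qed.

Lemma smooth_derive f (v : V) : smooth f -> smooth ('D_v f).
Proof. by move=> sf vs; rewrite -iterD_rcons; exact: sf. Qed.

(** [smooth] speaks of lists of directions, which the product rule splits into many terms. [Ck] is
    the form on which closure properties follow by induction on the order, peeling off the innermost
    derivative. *)
Lemma smoothP f : smooth f <-> forall n, Ck true n f.
Proof.
split=> [sf n|Cf vs].
  by elim: n f sf => [|n IH] f sf; have [cf df] := sf [::]; split => // v;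
    apply: IH; exact: smooth_derive.
move: {Cf}(Cf (size vs)).
elim/last_ind: vs f => [|vs v IH] f; first by case=> /(_ isT).
by rewrite size_rcons => -[_ _ /(_ v)/IH]; rewrite iterD_rcons.
Qed.

Lemma CkW b n f : Ck b n.+1 f -> Ck b n f.
Proof.
elim: n f => [|n IH] f [cf df Df]; split => // v.
by apply: IH; exact: Df.
Qed.

Lemma Ck_cst b n (k : R) : Ck b n (fun=> k).
Proof.
elim: n k => [|n IH] k; split; try (by move=> _; exact: cst_continuous);
  try by (move=> v x; exact: derivable_cst).
- by [].
- move=> v; have -> : 'D_v (fun _ : V => k) = (fun _ : V => 0 : R).
    by apply/funext => x; exact: derive_cst.
  exact: IH.
Qed.

Lemma CkD b n f g : Ck b n f -> Ck b n g -> Ck b n (fun x => f x + g x).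
Proof.
elim: n f g => [|n IH] f g [cf df Df] [cg dg Dg]; split => //.
- by move=> bT x; apply: (@continuousD _ _ _ f g); [exact: cf|exact: cg].
- by move=> v x; apply: derivableD; [exact: df|exact: dg].
- by move=> bT x; apply: (@continuousD _ _ _ f g); [exact: cf|exact: cg].
- by move=> v x; apply: derivableD; [exact: df|exact: dg].
- move=> v; have -> : 'D_v (fun x => f x + g x) = (fun x => 'D_v f x + 'D_v g x).
    by apply/funext => x; exact: (deriveD (df v x) (dg v x)).
  by apply: IH; [exact: Df|exact: Dg].
Qed.

Lemma CkM b n f g : Ck b n f -> Ck b n g -> Ck b n (fun x => f x * g x).
Proof.
elim: n f g => [|n IH] f g; move=> Cf Cg.
  have [cf df _] := Cf; have [cg dg _] := Cg; split => //.
  - by move=> bT x; apply: (@continuousM _ _ f g); [exact: cf|exact: cg].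
  - by move=> v x; apply: derivableM; [exact: df|exact: dg].
have [cf df Df] := Cf; have [cg dg Dg] := Cg; split => //.
- by move=> bT x; apply: (@continuousM _ _ f g); [exact: cf|exact: cg].
- by move=> v x; apply: derivableM; [exact: df|exact: dg].
- move=> v; have -> : 'D_v (fun x => f x * g x) =
      (fun x => f x * 'D_v g x + g x * 'D_v f x).
    by apply/funext => x; exact: (deriveM (df v x) (dg v x)).
  by apply: CkD; apply: IH; [exact: CkW|exact: Dg|exact: CkW|exact: Df].
Qed.

Lemma smooth_Ck b n f : smooth f -> Ck b n f.
Proof.
case: b => [/smoothP//|]; elim: n f => [|n IH] f sf; have [cf df] := sf [::];
  by split => // v; apply: IH; exact: smooth_derive.
Qed.

Lemma CkN b n f : Ck b n f -> Ck b n (fun x => - f x).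
Proof.
move=> Cf; have := CkM (Ck_cst b n (-1)) Cf.
by under eq_fun do rewrite mulN1r.
Qed.

Lemma Ck_sum b n (I : Type) (s : seq I) (F : I -> V -> R) :
  (forall i, Ck b n (F i)) -> Ck b n (fun x => \sum_(i <- s) F i x).
Proof.
move=> sF; elim: s => [|i s IH].
  by under eq_fun do rewrite big_nil; exact: Ck_cst.
by under eq_fun do rewrite big_cons; exact: CkD.
Qed.

Lemma Ck_derivable b n f x v : Ck b n f -> derivable f x v.
Proof. by case: n => [|n] []. Qed.

Lemma smooth_continuous f : smooth f -> continuous f.
Proof. by move=> /(_ [::])[]. Qed.

Lemma smooth_derivable f v x : smooth f -> derivable f x v.
Proof. by move=> /(_ [::])[_]; exact. Qed.

Lemma smooth_cst (k : R) : smooth (fun _ : V => k).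
Proof. by apply/smoothP => n; exact: Ck_cst. Qed.

Lemma smoothD f g : smooth f -> smooth g -> smooth (fun x => f x + g x).
Proof.
by move=> /smoothP sf /smoothP sg; apply/smoothP => n; exact: CkD.
Qed.

Lemma smoothM f g : smooth f -> smooth g -> smooth (fun x => f x * g x).
Proof.
by move=> /smoothP sf /smoothP sg; apply/smoothP => n; exact: CkM.
Qed.

Lemma smoothZ (k : R) f : smooth f -> smooth (fun x => k * f x).
Proof. by move=> sf; exact: (smoothM (smooth_cst k) sf). Qed.

Lemma smoothB f g : smooth f -> smooth g -> smooth (fun x => f x - g x).
Proof.
move=> sf sg; have := smoothD sf (smoothZ (-1) sg).
by under eq_fun do rewrite mulN1r.
Qed.

Lemma smooth_sum (I : Type) (s : seq I) (F : I -> V -> R) :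
  (forall i, smooth (F i)) -> smooth (fun x => \sum_(i <- s) F i x).
Proof.
move=> sF; elim: s => [|i s IH].
  by under eq_fun do rewrite big_nil; exact: smooth_cst.
by under eq_fun do rewrite big_cons; exact: smoothD.
Qed.

Lemma smooth_primitive f : continuous f -> (forall v x, derivable f x v) ->
  (forall v, smooth ('D_v f)) -> smooth f.
Proof.
move=> cf df Df; apply/smoothP => -[|n]; split => // v.
by have /smoothP := Df v; exact.
Qed.

Lemma derive_off_closed f (K : set V) v x : closed K ->
  (forall y, ~ K y -> f y = 0) -> ~ K x -> 'D_v f x = 0.
Proof.
move=> cK fK Kx; rewrite (@near_eq_derive _ _ _ f (fun=> 0)) ?derive_cst//.
have : nbhs x (~` K) by apply: open_nbhs_nbhs; split => //; exact: closed_openC.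
by apply: filterS => y /fK.
Qed.

Lemma closure_supportP f (D : set V) x :
  ~ closure [set y | f y != 0] x -> f x = 0.
Proof.
by move=> fx; apply: contrapT => /eqP f0; apply: fx; exact: subset_closure.
Qed.

Lemma Cc_infty_derive (D : set V) f v : Cc_infty D f -> Cc_infty D ('D_v f).
Proof.
move=> [sf [cK KD]]; split; first exact: smooth_derive.
have sub : closure [set x | 'D_v f x != 0] `<=` closure [set x | f x != 0].
  rewrite closureE => x; apply; split; first exact: closed_closure.
  move=> y /eqP Dfy; apply: contrapT => /(derive_off_closed v) fy.
  apply: Dfy; apply: fy; first exact: closed_closure.
  by move=> z; exact: (closure_supportP D).
split; last exact: subset_trans KD.
by apply: (subclosed_compact _ cK sub); exact: closed_closure.
Qed.

Lemma compact_continuous_bounded (K : set V) f : compact K -> continuous f ->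
  exists C, forall x, K x -> `|f x| <= C.
Proof.
move=> cK cf; have := continuous_compact (continuous_subspaceT (A := K) cf) cK.
move=> /compact_bounded[M [_ fM]]; exists (M + 1) => x Kx.
by apply: fM; [rewrite ltrDl|exists x].
Qed.

Lemma Cc_infty_bounded (D : set V) f : Cc_infty D f ->
  exists C, forall x, `|f x| <= C.
Proof.
move=> [sf [cK KD]].
have [C fC] := compact_continuous_bounded cK (smooth_continuous sf).
exists (Num.max C 0) => x.
have [xK|xK] := pselect (closure [set y | f y != 0] x).
  by rewrite le_max fC.
by rewrite (closure_supportP D xK) normr0 le_max lexx orbT.
Qed.

End SmoothCalculus.

Lemma continuous_subl (R : realType) (V : normedModType R) (x : V) :
  continuous (fun y : V => x - y).
Proof.
move=> y; apply: (@continuousB R _ _ (fun=> x) id).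
  exact: cst_continuous.
exact: cvg_id.
Qed.

Lemma continuous_fun_pair (T U V : topologicalType) (f : T -> U) (g : T -> V) :
  continuous f -> continuous g -> continuous (fun x => (f x, g x)).
Proof. by move=> cf cg x; apply: cvg_pair; [exact: cf|exact: cg]. Qed.

Section AffineChange.
Context (R : realType) (V W : normedModType R) (A L : V -> W).
Hypothesis AL : forall (h : R) v x, A (h *: v + x) = h *: L v + A x.
Implicit Types f : W -> R.

(** The identity [AL] turns the difference quotient of [f \o A] along [v] into that of [f] along
    [L v], term by term. Slices, reflections and rescalings all go through it. *)
Lemma derivable_affine f v x : derivable f (A x) (L v) -> derivable (f \o A) x v.
Proof.
rewrite /derivable /=.
by have -> : (fun h => h^-1 *: (f (A (h *: v + x)) - f (A x))) =
  (fun h => h^-1 *: (f (h *: L v + A x) - f (A x))) by under eq_fun do rewrite AL.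
Qed.

Lemma derive_affine f v x : 'D_v (f \o A) x = 'D_(L v) f (A x).
Proof.
rewrite /derive /=.
by have -> : (fun h => h^-1 *: (f (A (h *: v + x)) - f (A x))) =
  (fun h => h^-1 *: (f (h *: L v + A x) - f (A x))) by under eq_fun do rewrite AL.
Qed.

Lemma Ck_affine (b : bool) n f : (b -> continuous A) -> Ck b n f -> Ck b n (f \o A).
Proof.
move=> cA; elim: n f => [|n IH] f [cf df Df]; split => //.
- move=> bT x; apply: continuous_comp; first exact: (cA bT).
  exact: (cf bT).
- by move=> v x; exact: derivable_affine.
- move=> bT x; apply: continuous_comp; first exact: (cA bT).
  exact: (cf bT).
- by move=> v x; exact: derivable_affine.
- move=> v; have -> : 'D_v (f \o A) = 'D_(L v) f \o A.
    by apply/funext => x; exact: derive_affine.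
  by apply: IH; exact: Df.
Qed.

Lemma smooth_affine f : continuous A -> smooth f -> smooth (f \o A).
Proof.
by move=> cA /smoothP sf; apply/smoothP => n; apply: Ck_affine.
Qed.

End AffineChange.

(** * Convolution in the space variable *)

Section Convolution.
Context (R : realType).
Implicit Types (k : E3 R -> R) (f : spacetime R -> R).
Local Notation leb3 := (sleb3 R).

(** The kernel is arbitrary because derivatives of coarse fields are convolutions with derivatives
    of the mollifier. *)
Definition sconv k f (z : spacetime R) : R :=
  \int[leb3]_y (k (z.1 - y) * f (y, z.2)).

Lemma measurable_subE3 :
  measurable_fun setT (fun w : E3 R * E3 R => w.1 - w.2 : E3 R).
Proof.
have m1 : measurable_fun setT (fst : E3 R * E3 R -> E3 R) := measurable_fst.
have m2 : measurable_fun setT (snd : E3 R * E3 R -> E3 R) := measurable_snd.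
apply: measurable_fun_pair.
  apply: measurable_fun_pair; apply: measurable_funB;
    by repeat (apply: measurableT_comp => //).
by apply: measurable_funB; repeat (apply: measurableT_comp => //).
Qed.

Lemma measurable_reflect k x : continuous k ->
  measurable_fun setT (fun y : E3 R => k (x - y)).
Proof.
move=> ck; apply: continuous_measurable_E3 => y.
exact: (continuous_comp (@continuous_subl R (E3 R) x y) (ck _)).
Qed.

Lemma measurable_conv k f : continuous k -> measurable_fun setT f ->
  measurable_fun setT (sconv k f).
Proof.
move=> ck mf.
apply: (@measurable_Rintegral2 _ _ (spacetime R) (E3 R) R leb3
  (fun w => k (w.1.1 - w.2) * f (w.2, w.1.2))).
have m11 : measurable_fun setT (fun w : spacetime R * E3 R => w.1.1).
  by apply: measurableT_comp => //; exact: measurable_fst.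
have m12 : measurable_fun setT (fun w : spacetime R * E3 R => w.1.2).
  by apply: measurableT_comp => //; exact: measurable_fst.
have m2 : measurable_fun setT (fun w : spacetime R * E3 R => w.2) := measurable_snd.
apply: measurable_funM.
  apply: (measurableT_comp (continuous_measurable_E3 ck)).
  exact: (measurableT_comp measurable_subE3 (measurable_fun_pair m11 m2)).
exact: (measurableT_comp mf (measurable_fun_pair m2 m12)).
Qed.

Variables (D : set (E3 R)) (k : E3 R -> R).
Hypothesis kD : Cc_infty D k.

Lemma rintegrable_kernel f t x : rintegrable leb3 (fun y => f (y, t)) ->
  rintegrable leb3 (fun y => k (x - y) * f (y, t)).
Proof.
have [C kC] := Cc_infty_bounded kD.
move=> fi; apply: (@rintegrable_bdM _ _ _ _ C) => //.
by apply: measurable_reflect; case: kD => sk _; exact: smooth_continuous.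
Qed.

Lemma conv_bound C f x t : (forall y, `|k y| <= C) ->
  rintegrable leb3 (fun y => f (y, t)) ->
  `|sconv k f (x, t)| <= C * \int[leb3]_y `|f (y, t)|.
Proof.
move=> kC fi; rewrite -rintegralZl; last exact: rintegrable_norm.
apply: le_trans (norm_rintegral_le _) _; first exact: rintegrable_kernel.
apply: ler_rintegral.
- exact/rintegrable_norm/rintegrable_kernel.
- exact/rintegrableZl/rintegrable_norm.
- by move=> y; rewrite normrM ler_wpM2r.
Qed.

End Convolution.

Section ConvolutionDerivative.
Context (R : realType) (D : set (E3 R)).
Implicit Types (k : E3 R -> R) (f : spacetime R -> R).
Local Notation leb3 := (sleb3 R).

(** Differentiation under the integral along the line [h *: v + x]: as [C] bounds ['D_v k], the
    integrable function [C * |f|] dominates uniformly in [h]. *)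
Let conv_der k f t (x v : E3 R) : Cc_infty D k -> rintegrable leb3 (fun y => f (y, t)) ->
  h^-1 *: (sconv k f (h *: v + x, t) - sconv k f (x, t)) @[h --> 0^'] -->
  sconv ('D_v k) f (x, t).
Proof.
move=> kD fi.
have DkD := Cc_infty_derive v kD.
have [C DkC] := Cc_infty_bounded DkD.
have C0 : 0 <= C by apply: le_trans (DkC 0).
have sk : smooth k by case: kD.
pose F (h : R) (y : E3 R) : R := k (h *: v + x - y) * f (y, t).
have AL y h w r : (h *: w + r) *: v + x - y = h *: (w *: v) + (r *: v + x - y).
  by rewrite scalerDl scalerA !addrA.
have dF y h : derivable (F ^~ y) h 1.
  apply: derivableM; last exact: derivable_cst.
  apply: (@derivable_affine R R^o (E3 R) (fun h => h *: v + x - y) (fun h => h *: v)).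
    by move=> r w r'; exact: AL.
  exact: smooth_derivable.
have DF y h : 'D_1 (F ^~ y) h = 'D_v k (h *: v + x - y) * f (y, t).
  have := @deriveM R R^o (fun h => k (h *: v + x - y)) (fun=> f (y, t)) h 1.
  move=> -> //; last first.
    apply: (@derivable_affine R R^o (E3 R) (fun h => h *: v + x - y) (fun h => h *: v)).
      by move=> r w r'; exact: AL.
    exact: smooth_derivable.
  rewrite derive_cst scaler0 add0r.
  rewrite (@derive_affine R R^o (E3 R) (fun h => h *: v + x - y) (fun h => h *: v)).
    by rewrite scale1r mulrC.
  by move=> r w r'; exact: AL.
have I0 : `](-1)%R, 1%R[%classic (0 : R) by rewrite /= in_itv /= ltrN10 ltr01.
have Fi h : `](-1)%R, 1%R[%classic h -> rintegrable leb3 (F h).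
  by move=> _; exact: (rintegrable_kernel kD).
have Gi : rintegrable leb3 (fun y => C * `|f (y, t)|).
  exact/rintegrableZl/rintegrable_norm.
have FG h y : `](-1)%R, 1%R[%classic h -> setT y ->
    `|partial1of2 F h y| <= C * `|f (y, t)|.
  by move=> _ _; rewrite partial1of2E DF normrM ler_wpM2r.
have G0 y : 0 <= C * `|f (y, t)| by rewrite mulr_ge0.
have := cvg_differentiation_under_integral measurableT I0 Fi
  (fun h y _ _ => dF y h) G0 Gi FG.
have -> : \int[leb3]_(y in setT) partial1of2 F 0 y = sconv ('D_v k) f (x, t).
  apply: eq_Rintegral => y _; rewrite partial1of2E DF /=.
  by rewrite scale0r add0r.
have -> // : (fun h => h^-1 *: (\int[leb3]_(y in setT) F (h + 0) y -
      \int[leb3]_(y in setT) F 0 y)) =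
    (fun h => h^-1 *: (sconv k f (h *: v + x, t) - sconv k f (x, t))).
apply/funext => h; rewrite addr0; congr (_ *: (_ - _)).
by apply: eq_Rintegral => y _; rewrite /F scale0r add0r.
Qed.

Lemma derivable_conv k f t (x v : E3 R) : Cc_infty D k ->
  rintegrable leb3 (fun y => f (y, t)) -> derivable (fun y => sconv k f (y, t)) x v.
Proof.
move=> kD fi; apply/cvg_ex; exists (sconv ('D_v k) f (x, t)).
have H := @conv_der k f t x v kD fi; exact: H.
Qed.

Lemma derive_conv k f t (x v : E3 R) : Cc_infty D k ->
  rintegrable leb3 (fun y => f (y, t)) ->
  'D_v (fun y => sconv k f (y, t)) x = sconv ('D_v k) f (x, t).
Proof.
by move=> kD fi; apply: cvg_lim; [exact: Rhausdorff|exact: conv_der].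
Qed.

(** The induction runs on the kernel: a derivative of the convolution is the convolution with a
    derivative of [k], which is again in [Cc_infty]. *)
Lemma Ck_conv n k f t : Cc_infty D k -> rintegrable leb3 (fun y => f (y, t)) ->
  Ck false n (fun y => sconv k f (y, t)).
Proof.
move=> kD fi; elim: n k kD => [|n IH] k kD; split => //.
- by move=> v x; exact: derivable_conv.
- by move=> v x; exact: derivable_conv.
- move=> v; have -> : 'D_v (fun y => sconv k f (y, t)) =
    (fun y => sconv ('D_v k) f (y, t)) by apply/funext => x; exact: derive_conv.
  by apply: IH; exact: Cc_infty_derive.
Qed.

End ConvolutionDerivative.

(** * Integrals of compactly supported derivatives *)

Section RealLine.
Context (R : realType).
Implicit Types g : R -> R.
Local Notation leb1 := (sleb1 R).

Lemma derivable_continuous g x : derivable g x 1 -> {for x, continuous g}.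
Proof. by move=> /derivable1_diffP; exact: differentiable_continuous. Qed.

Lemma Rintegral_derive g a b : a <= b -> (forall x, derivable g x 1) ->
  continuous ('D_1 g) -> \int[leb1]_(x in `[a, b]) 'D_1 g x = g b - g a.
Proof.
rewrite le_eqVlt => /predU1P[->|ab] dg cg.
  by rewrite set_itv1 Rintegral_set1 subrr.
rewrite /Rintegral (@continuous_FTC2 R ('D_1 g) g a b ab)//.
- exact: continuous_subspaceT.
- split.
  + by move=> x _; exact: dg.
  + by apply: cvg_at_right_filter; exact: derivable_continuous.
  + by apply: cvg_at_left_filter; exact: derivable_continuous.
- by move=> x _; rewrite derive1E.
Qed.

(** On the line derivability already implies continuity, so one further derivative suffices even
    when [b] is [false]. *)
Lemma Ck1_continuous_derive (b : bool) g : Ck b 1 g -> continuous ('D_1 g).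
Proof.
move=> [_ _ /(_ 1)[_ dDg _]] x; exact: derivable_continuous.
Qed.

Lemma Rintegral_derive_compact (b : bool) g (M : R) : Ck b 1 g ->
  (forall x, M <= `|x| -> g x = 0) -> \int[leb1]_x 'D_1 g x = 0.
Proof.
move=> Cg gM; have dg x : derivable g x 1 by exact: Ck_derivable Cg.
have [M0|M0] := leP 0 M; last first.
  have -> : g = fun=> 0 by apply/funext => x; apply: gM; rewrite (le_trans (ltW M0)).
  by under eq_Rintegral do rewrite derive_cst; exact: rintegral0.
transitivity (\int[leb1]_(x in `[- M, M]) 'D_1 g x); last first.
  rewrite Rintegral_derive ?ge0_cp//; last exact: Ck1_continuous_derive Cg.
  by rewrite !gM ?subrr// ?normrN ger0_norm.
rewrite [RHS]Rintegral_mkcond; apply: eq_Rintegral => x _.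
rewrite patchE; case: ifPn => //; rewrite notin_setE => xM.
apply: (derive_off_closed (K := `[- M, M]%classic)) xM => [|y yM].
  exact: interval_closed.
apply: gM; rewrite leNgt; apply: contra_notN yM => yM.
by rewrite /= in_itv /= -ler_norml ltW.
Qed.

End RealLine.

Section Divergence.
Context (R : realType).
Implicit Types F : E3 R -> R.
Local Notation leb3 := (sleb3 R).

(* Fubini reduces the integral to the integral of a compactly supported derivative
   along the lines parallel to the chosen axis. *)
Lemma Rintegral_derive_ebasis F (M : R) j : Ck false 1 F ->
  (forall x : E3 R, (M <= `|x.1.1|) || (M <= `|x.1.2|) || (M <= `|x.2|) -> F x = 0) ->
  rintegrable leb3 ('D_(ebasis R j) F) -> \int[leb3]_x 'D_(ebasis R j) F x = 0.
Proof.
move=> CF FM Fi.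
case: j Fi => -[|[|[|//]]] j3 Fi.
- rewrite (Rintegral_prod21 Fi) -[RHS](rintegral0 (sleb1 R)).
  apply: ae_eq_Rintegral; apply: filterS (ae_integrable2 Fi) => c Fic _.
  rewrite (Rintegral_prod21 Fic) -[RHS](rintegral0 (sleb1 R)).
  apply: eq_Rintegral => y _.
  have AL (h : R) (v : R^o) (x : R^o) : (((h *: v + x, y), c) : E3 R) = h *: (((v, 0), 0) : E3 R) + ((x, y), c).
    transitivity (((h *: v + x, h *: 0 + y), h *: 0 + c) : E3 R) => //.
    by rewrite !scaler0 !add0r.
  rewrite -(@Rintegral_derive_compact R false (F \o (fun s : R => ((s, y), c))) M).
  + apply: eq_Rintegral => x _.
    by rewrite (derive_affine (W := E3 R) (L := fun v : R => ((v, 0), 0)) AL).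
  + exact: (Ck_affine (W := E3 R) (L := fun v : R => ((v, 0), 0)) AL).
  + by move=> x Mx /=; apply: FM; rewrite /= Mx ?orbT.
- rewrite (Rintegral_prod21 Fi) -[RHS](rintegral0 (sleb1 R)).
  apply: ae_eq_Rintegral; apply: filterS (ae_integrable2 Fi) => c Fic _.
  rewrite (Rintegral_prod12 Fic) -[RHS](rintegral0 (sleb1 R)).
  apply: eq_Rintegral => y _.
  have AL (h : R) (v : R^o) (x : R^o) : (((y, h *: v + x), c) : E3 R) = h *: (((0, v), 0) : E3 R) + ((y, x), c).
    transitivity (((h *: 0 + y, h *: v + x), h *: 0 + c) : E3 R) => //.
    by rewrite !scaler0 !add0r.
  rewrite -(@Rintegral_derive_compact R false (F \o (fun s : R => ((y, s), c))) M).
  + apply: eq_Rintegral => x _.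
    by rewrite (derive_affine (W := E3 R) (L := fun v : R => ((0, v), 0)) AL).
  + exact: (Ck_affine (W := E3 R) (L := fun v : R => ((0, v), 0)) AL).
  + by move=> x Mx /=; apply: FM; rewrite /= Mx ?orbT.
- rewrite (Rintegral_prod12 Fi) -[RHS](rintegral0 (sleb2 R)).
  apply: eq_Rintegral => y _.
  have AL (h : R) (v : R^o) (x : R^o) : ((y, h *: v + x) : E3 R) = h *: ((0, v) : E3 R) + (y, x).
    transitivity ((h *: 0 + y, h *: v + x) : E3 R) => //.
    by rewrite scaler0 add0r.
  rewrite -(@Rintegral_derive_compact R false (F \o (fun s : R => (y, s))) M).
  + apply: eq_Rintegral => x _.
    by rewrite (derive_affine (W := E3 R) (L := fun v : R => (0, v)) AL).
  + exact: (Ck_affine (W := E3 R) (L := fun v : R => (0, v)) AL).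
  + by move=> x Mx /=; apply: FM; rewrite /= Mx ?orbT.
Qed.

End Divergence.

(** * Product rule for primitives of integrable functions *)

Section ProductRule.
Context (R : realType).
Implicit Types f g : R -> R.
Local Notation leb1 := (sleb1 R).

Lemma measurable_le2 :
  measurable_fun setT (fun w : R * R => (w.1 <= w.2)%R%:R : R).
Proof.
have m21 : measurable_fun setT (fun w : measurableTypeR R * measurableTypeR R => w.2 - w.1 : R).
  by apply: measurable_funB; [exact: measurable_snd|exact: measurable_fst].
have mA := m21 measurableT _ (measurable_itv `[0%R, +oo[).
rewrite setTI in mA; have := (measurable_indicP R _).1 mA.
apply: eq_measurable_fun => w _; rewrite indicE; congr ((nat_of_bool _)%:R).
by apply/idP/idP; rewrite inE /= in_itv /= andbT subr_ge0.
Qed.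

Lemma normr_natb_le1 (b : bool) : `|b%:R : R| <= 1.
Proof. by case: b; rewrite ?normr1 ?normr0. Qed.

Lemma ler_norm_natbM (b : bool) (x : R) : `|b%:R * x| <= `|x|.
Proof. by rewrite normrM ler_piMl// normr_natb_le1. Qed.

Lemma rintegrable_leM f (s : R) : rintegrable leb1 f ->
  rintegrable leb1 (fun r => (r <= s)%R%:R * f r) /\
  rintegrable leb1 (fun r => (s <= r)%R%:R * f r).
Proof.
move=> fi; split; apply: (@rintegrable_bdM _ _ _ _ 1) => //.
- apply: (measurableT_comp measurable_le2 (g := fun r => (r, s))).
  exact: measurable_fun_pair.
- by move=> x; exact: normr_natb_le1.
- apply: (measurableT_comp measurable_le2 (g := fun r => (s, r))).
  exact: measurable_fun_pair.
- by move=> x; exact: normr_natb_le1.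
Qed.

(** Fubini on the triangle [r <= s], where [|g s| * |f r|] dominates the integrand. *)
Lemma Rintegral_le_swap f g : rintegrable leb1 f -> rintegrable leb1 g ->
  \int[leb1]_s (g s * \int[leb1]_r ((r <= s)%R%:R * f r)) =
  \int[leb1]_r (f r * \int[leb1]_s ((r <= s)%R%:R * g s)).
Proof.
move=> fi gi; have mf := rintegrable_measurable fi.
have mg := rintegrable_measurable gi.
pose P (w : R * R) := (w.2 <= w.1)%R%:R * (g w.1 * f w.2).
have m1 : measurable_fun setT (fst : R * R -> R) := measurable_fst.
have m2 : measurable_fun setT (snd : R * R -> R) := measurable_snd.
have mP : measurable_fun setT P.
  apply: measurable_funM; last first.
    by apply: measurable_funM; [exact: (measurableT_comp mg)|exact: (measurableT_comp mf)].
  exact: (measurableT_comp measurable_le2 (measurable_fun_pair m2 m1)).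
have Pi1 s : rintegrable leb1 (fun r => P (s, r)).
  rewrite /P /=; have -> : (fun r => (r <= s)%R%:R * (g s * f r)) =
    (fun r => g s * ((r <= s)%R%:R * f r)) by apply/funext => r; rewrite mulrCA.
  by apply: rintegrableZl; exact: (rintegrable_leM s fi).1.
have Pi : rintegrable (leb1 \x leb1)%E P.
  apply: (@rintegrable_prod12 _ _ _ _ _ leb1 leb1 P
    (fun s => (\int[leb1]_r `|f r|) * `|g s|)) => //.
    move=> s; rewrite mulrC -rintegralZl; last exact: rintegrable_norm.
    apply: ler_rintegral; [exact: rintegrable_norm|exact/rintegrableZl/rintegrable_norm|].
    by move=> r; rewrite /P /= -normrM; exact: ler_norm_natbM.
  exact/rintegrableZl/rintegrable_norm.
transitivity (\int[leb1]_s \int[leb1]_r P (s, r)).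
  apply: eq_Rintegral => s _; rewrite -rintegralZl; last exact: (rintegrable_leM s fi).1.
  by apply: eq_Rintegral => r _; rewrite /P /= mulrCA.
rewrite -Rintegral_prod12// (Rintegral_prod21 Pi).
apply: eq_Rintegral => r _; rewrite -rintegralZl; last exact: (rintegrable_leM r gi).2.
by apply: eq_Rintegral => s _; rewrite /P /= [RHS]mulrCA [f r * _]mulrC.
Qed.

(* Both iterated integrals run over the square, one over each side of the diagonal. *)
Lemma Rintegral_mul f g : rintegrable leb1 f -> rintegrable leb1 g ->
  \int[leb1]_s (f s * \int[leb1]_r ((r <= s)%R%:R * g r)) +
  \int[leb1]_s (g s * \int[leb1]_r ((r <= s)%R%:R * f r)) =
  (\int[leb1]_s f s) * (\int[leb1]_s g s).
Proof.
move=> fi gi; rewrite (Rintegral_le_swap fi gi).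
have mf := rintegrable_measurable fi.
have mg := rintegrable_measurable gi.
have bd h (b : R -> R -> bool) s : rintegrable leb1 h ->
    (forall s, rintegrable leb1 (fun r => (b s r)%:R * h r)) ->
    `|\int[leb1]_r ((b s r)%:R * h r)| <= \int[leb1]_r `|h r|.
  move=> hi bh; apply: le_trans (norm_rintegral_le _) _ => //.
  apply: ler_rintegral; [exact: rintegrable_norm|exact: rintegrable_norm|].
  by move=> r; exact: ler_norm_natbM.
have m1 : measurable_fun setT (fst : R * R -> R) := measurable_fst.
have m2 : measurable_fun setT (snd : R * R -> R) := measurable_snd.
have i1 : rintegrable leb1 (fun s => f s * \int[leb1]_r ((r <= s)%R%:R * g r)).
  under eq_fun do rewrite mulrC.
  apply: (@rintegrable_bdM _ _ _ _ (\int[leb1]_r `|g r|)) => //.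
    apply: (@measurable_Rintegral2 _ _ _ _ _ leb1 (fun w : R * R => (w.2 <= w.1)%R%:R * g w.2)).
    apply: measurable_funM; last exact: (measurableT_comp mg).
    exact: (measurableT_comp measurable_le2 (measurable_fun_pair m2 m1)).
  by move=> s; apply: (bd g (fun s r => r <= s)) => // r; exact: (rintegrable_leM r gi).1.
have i2 : rintegrable leb1 (fun s => f s * \int[leb1]_r ((s <= r)%R%:R * g r)).
  under eq_fun do rewrite mulrC.
  apply: (@rintegrable_bdM _ _ _ _ (\int[leb1]_r `|g r|)) => //.
    apply: (@measurable_Rintegral2 _ _ _ _ _ leb1 (fun w : R * R => (w.1 <= w.2)%R%:R * g w.2)).
    apply: measurable_funM; last exact: (measurableT_comp mg m2).
    exact: measurable_le2.
  by move=> s; apply: (bd g (fun s r => s <= r)) => // r; exact: (rintegrable_leM r gi).2.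
rewrite -rintegralD// [RHS]mulrC -rintegralZl//; apply: eq_Rintegral => s _.
rewrite -mulrDr mulrC; congr (_ * _).
rewrite -rintegralD; [|exact: (rintegrable_leM s gi).1|exact: (rintegrable_leM s gi).2].
(* The two order indicators add up to 1 except on the diagonal [r = s], a null set for fixed [s]. *)
apply: ae_eq_Rintegral; exists [set s]; split => //; first exact: lebesgue_measure_set1.
move=> r /=; apply: contra_notP => /eqP rs _.
by case: ltgtP rs => //; rewrite ?mul0r ?mul1r ?add0r ?addr0.
Qed.

(* The integrand is only evaluated on [[a, b]]. *)
Definition has_density (a b : R) g f := rintegrable leb1 (fun s => \1_`[a, b] s * f s) /\
  forall t, a <= t <= b -> g t = g a + \int[leb1]_(s in `[a, t]) f s.

(** Writes the primitive with one density that is integrable on the whole line and an order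
    indicator, the form in which [Rintegral_mul] applies. *)
Lemma has_densityE a b g f t : has_density a b g f -> a <= t <= b ->
  g t = g a + \int[leb1]_r ((r <= t)%R%:R * (\1_`[a, b] r * f r)).
Proof.
move=> [_ gE] /[dup] atb /andP[at_ tb]; rewrite gE// rintegral_indicM; congr (_ + _).
apply: eq_Rintegral => r _; rewrite mulrA; congr (_ * _); rewrite !indicE.
rewrite -natrM mulnb; congr ((nat_of_bool _)%:R).
apply/idP/andP => [|[rt]]; rewrite !inE /= !in_itv /=.
  by move=> /andP[ar rt]; rewrite ar rt (le_trans rt).
by move=> /andP[-> _].
Qed.

(** Integration by parts without pointwise differentiation: once both primitives are inserted, the
    double integrals over the two halves of the square add up to the product of the two
    increments. *)
Lemma has_densityM a b g1 f1 g2 f2 :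
  has_density a b g1 f1 -> has_density a b g2 f2 ->
  has_density a b (fun t => g1 t * g2 t) (fun t => f1 t * g2 t + f2 t * g1 t).
Proof.
move=> d1 d2; have [i1 g1E] := d1; have [i2 g2E] := d2.
pose F1 r := \1_`[a, b] r * f1 r; pose F2 r := \1_`[a, b] r * f2 r.
have m1 : measurable_fun setT (fst : R * R -> R) := measurable_fst.
have m2 : measurable_fun setT (snd : R * R -> R) := measurable_snd.
have iM F G : rintegrable leb1 F -> rintegrable leb1 G ->
    rintegrable leb1 (fun s => F s * \int[leb1]_r ((r <= s)%R%:R * G r)).
  move=> Fi Gi; under eq_fun do rewrite mulrC.
  apply: (@rintegrable_bdM _ _ _ _ (\int[leb1]_r `|G r|)) => //.
    apply: (@measurable_Rintegral2 _ _ _ _ _ leb1 (fun w : R * R => (w.2 <= w.1)%R%:R * G w.2)).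
    apply: measurable_funM; last exact: (measurableT_comp (rintegrable_measurable Gi)).
    exact: (measurableT_comp measurable_le2 (measurable_fun_pair m2 m1)).
  move=> s; apply: le_trans (norm_rintegral_le _) _; first exact: (rintegrable_leM s Gi).1.
  apply: ler_rintegral; [exact/rintegrable_norm/(rintegrable_leM s Gi).1|exact: rintegrable_norm|].
  by move=> r; exact: ler_norm_natbM.
have EF (t : R) : t <= b -> forall s, \1_`[a, t] s * (f1 s * g2 s + f2 s * g1 s) =
    (s <= t)%R%:R * (F1 s * g2 a + F1 s * \int[leb1]_r ((r <= s)%R%:R * F2 r) +
    (F2 s * g1 a + F2 s * \int[leb1]_r ((r <= s)%R%:R * F1 r))).
  move=> tb s; rewrite indicE.
  have [|sat] := boolP (s \in _).
    rewrite inE /= in_itv /= => /andP[as_ st]; rewrite st !mul1r.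
    have asb : a <= s <= b by rewrite as_ (le_trans st).
    rewrite -!mulrDr -(has_densityE d1 asb) -(has_densityE d2 asb).
    by rewrite /F1 /F2 indicE mem_set ?mul1r.
  rewrite mul0r; have [st|] := boolP (s <= t); last by rewrite mul0r.
  rewrite /F1 /F2 !indicE memNset ?mul0r ?add0r ?mulr0//=.
  rewrite in_itv /= => /andP[as_ _]; move/negP: sat; apply; rewrite inE /= in_itv /=.
  by rewrite as_.
have iZ F (k : R) : rintegrable leb1 F -> rintegrable leb1 (fun s => F s * k).
  by move=> Fi; under eq_fun do rewrite mulrC; exact: rintegrableZl.
have iT : rintegrable leb1 (fun s =>
    (F1 s * g2 a + F1 s * \int[leb1]_r ((r <= s)%R%:R * F2 r) +
    (F2 s * g1 a + F2 s * \int[leb1]_r ((r <= s)%R%:R * F1 r)))).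
  by apply: rintegrableD; apply: rintegrableD; try exact: iZ; exact: iM.
split.
  under eq_fun do rewrite EF//.
  exact: (rintegrable_leM b iT).1.
move=> t /[dup] atb /andP[at_ tb].
rewrite rintegral_indicM; under eq_Rintegral do rewrite EF//.
(* Cut at [t], the densities have full integrals equal to the increments of [g1] and [g2] from [a]
   to [t], so [Rintegral_mul] yields the product of these increments. *)
pose H1 r := (r <= t)%R%:R * F1 r; pose H2 r := (r <= t)%R%:R * F2 r.
have H1i : rintegrable leb1 H1 := (rintegrable_leM t i1).1.
have H2i : rintegrable leb1 H2 := (rintegrable_leM t i2).1.
rewrite (has_densityE d1 atb) (has_densityE d2 atb) -/F1 -/F2.
rewrite -/(\int[leb1]_r H1 r) -/(\int[leb1]_r H2 r).
transitivity (g1 a * g2 a + \int[leb1]_s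
    (H1 s * g2 a + H1 s * \int[leb1]_r ((r <= s)%R%:R * H2 r) +
    (H2 s * g1 a + H2 s * \int[leb1]_r ((r <= s)%R%:R * H1 r)))).
  rewrite rintegralD; [|by apply: rintegrableD; [exact: iZ|exact: iM]..].
  rewrite rintegralD; [|exact: iZ|exact: iM].
  rewrite [X in _ + (_ + X)]rintegralD; [|exact: iZ|exact: iM].
  rewrite !RintegralZr// addrACA (Rintegral_mul H1i H2i).
  by rewrite mulrDl !mulrDr [_ * g1 a]mulrC !addrA; congr (_ + _); rewrite addrAC.
congr (_ + _); apply: eq_Rintegral => s _.
have [st|st] := boolP (s <= t); last by rewrite /H1 /H2 (negbTE st) !mul0r !add0r.
rewrite mul1r {1 2}/H1 {2 3}/H2 st !mul1r.
congr (_ + _ * _ + (_ + _ * _)); apply: eq_Rintegral => r _; rewrite /H1 /H2;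
 by have [rs|] := boolP (r <= s); rewrite ?mul0r// (le_trans rs st) !mul1r.
Qed.

End ProductRule.

(** * A smooth step, and weak derivatives in time *)

Section Bump.
Context (R : realType) (chi : E3 R -> R) (chiP : cutoff chi).
Local Notation leb1 := (sleb1 R).

(** Restricting the cutoff to a coordinate axis gives a ready-made smooth bump on the line,
    supported in [[-1, 1]] and equal to 1 near 0. *)
Definition bump (s : R) : R := chi ((s, 0), 0).

Lemma smooth_bump : smooth bump.
Proof.
have [[schi _] _ _ _] := chiP.
apply: (@smooth_affine R R^o (E3 R) (fun s => ((s, 0), 0)) (fun s => ((s, 0), 0))) => //.
  move=> h v x; transitivity (((h *: v + x, h *: 0 + 0), h *: 0 + 0) : E3 R) => //.
  by rewrite !scaler0 !addr0.
apply: continuous_fun_pair; last exact: cst_continuous.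
apply: continuous_fun_pair; last exact: cst_continuous.
by move=> s; exact: cvg_id.
Qed.

Lemma enorm_line (s : R) : enorm ((s, 0), 0) = `|s|.
Proof. by rewrite /enorm /= expr0n /= !addr0 sqrtr_sqr. Qed.

Lemma bump_off s : 1 <= `|s| -> bump s = 0.
Proof.
have [[_ [_ chiB]] _ _ _] := chiP; move=> s1; apply: contrapT => /eqP bs.
have /chiB/interior_subset : closure [set x | chi x != 0] ((s, 0), 0).
  exact: subset_closure.
by rewrite /eball /= subr0 enorm_line ltNge s1.
Qed.

Lemma bump_ge0 s : 0 <= bump s.
Proof. by have [_ _ /(_ ((s, 0), 0))/andP[]] := chiP. Qed.

Lemma bump_int : rintegrable leb1 bump.
Proof.
apply: (@rintegrable_le _ _ R leb1 bump (fun s : R => \1_(`[(-1)%R, 1%R]%classic : set R) s)).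
- by apply: continuous_measurable_fun; exact: (smooth_continuous smooth_bump).
- apply: rintegrable_indic => //=; rewrite lebesgue_measure_itv/=.
  by case: ifP => _; rewrite ?ltry// -EFinD ltry.
- move=> s; rewrite indicE; have [_|] := boolP (_ \in _).
    have [_ _ /(_ ((s, 0), 0))/andP[b0 b1] _] := chiP.
    by rewrite ger0_norm.
  rewrite notin_setE /= in_itv /= => /negP; rewrite -ler_norml -ltNge => /ltW/bump_off ->.
  by rewrite normr0.
Qed.

Lemma bump_gt0 : 0 < \int[leb1]_s bump s.
Proof.
have [_ _ _ [vt [/andP[vt0 _] chi1]]] := chiP.
have mI : measurable `](- vt)%R, vt[%classic by exact: measurable_itv.
have Ifin : (leb1 `](- vt)%R, vt[%classic < +oo)%E.
  rewrite /= lebesgue_measure_itv/=.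
  by case: ifP => _; rewrite ?ltry// -EFinD ltry.
apply: (@lt_le_trans _ _ (\int[leb1]_s \1_(`](- vt)%R, vt[%classic : set R) s)).
  rewrite /Rintegral integral_indic// setIT /= lebesgue_measure_itv/= lte_fin.
  by rewrite gt0_cp// -EFinD /= opprK addr_gt0.
apply: ler_rintegral; [exact: rintegrable_indic|exact: bump_int|].
move=> s; rewrite indicE; have [|_] := boolP (_ \in _); last exact: bump_ge0.
rewrite inE /= in_itv /= -ltr_norml => svt.
by rewrite /bump chi1// /eball /= subr0 enorm_line.
Qed.

End Bump.

Lemma derivable_cmul (R : realType) (c : R) (f : R -> R) s : derivable f s 1 ->
  derivable (fun t => c * f t) s 1 /\ 'D_1 (fun t => c * f t) s = c * 'D_1 f s.
Proof.
move=> df; have dc : derivable (fun _ : R => c) s 1 by exact: derivable_cst.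
split; first exact: (derivableM dc df).
by rewrite (deriveM dc df) derive_cst scaler0 addr0.
Qed.

Section SmoothStep.
Context (R : realType) (beta : R -> R).
Local Notation leb1 := (sleb1 R).
Hypotheses (smooth_beta : smooth beta) (beta0 : forall s, 1 <= `|s| -> beta s = 0).
Hypotheses (beta_ge0 : forall s, 0 <= beta s) (beta_int : rintegrable leb1 beta).
Hypothesis c_gt0 : 0 < \int[leb1]_s beta s.

Let I (s : R) : R := \int[leb1]_(t in `]-oo, s]) beta t.

Let I_derivable s : derivable I s 1 /\ 'D_1 I s = beta s.
Proof.
have bi : (@lebesgue_measure R).-integrable [set` Interval -oo%O (BRight (s + 1))] (EFin \o beta).
  exact: integrableS beta_int.
have s1 : s < s + 1 by rewrite ltrDl.
have cb : {for s, continuous beta} by exact: smooth_continuous.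
have [dF DF] := continuous_FTC1 s1 bi (ltNyr s) cb.
by split; [exact: dF|rewrite -DF derive1E].
Qed.

Let I_before s : s <= -1 -> I s = 0.
Proof.
move=> s1; rewrite /I rintegral_indicM -[RHS](rintegral0 leb1); apply: eq_Rintegral => t _.
rewrite indicE; have [|_] := boolP (_ \in _); last by rewrite mul0r.
rewrite inE /= in_itv /= => ts.
have t1 : t <= -1 := le_trans ts s1.
have t0 : t <= 0 := le_trans t1 (lerN10 R).
have nt : 1 <= `|t| by rewrite (ler0_norm t0) lerNr.
by rewrite (beta0 nt) mulr0.
Qed.

Let I_after s : 1 <= s -> I s = \int[leb1]_s beta s.
Proof.
move=> s1; rewrite /I rintegral_indicM; apply: eq_Rintegral => t _.
rewrite indicE; have [|] := boolP (_ \in _); first by rewrite mul1r.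
rewrite notin_setE /= in_itv /= => /negP; rewrite -ltNge => st.
have nt : 1 <= `|t| by rewrite (le_trans s1)// (le_trans (ltW st))// ler_norm.
by rewrite (beta0 nt) mulr0.
Qed.

Let I_ge0 s : 0 <= I s <= \int[leb1]_s beta s.
Proof.
have mI : measurable `]-oo, s]%classic by exact: measurable_itv.
have bS : rintegrable leb1 (fun t => \1_`]-oo, s] t * beta t).
  have [h _] := @rintegrable_indicM _ _ R leb1 _ beta mI.
  by apply: h; apply: integrableS beta_int.
rewrite /I rintegral_indicM; apply/andP; split.
  by apply: Rintegral_ge0 => t _; rewrite mulr_ge0.
apply: ler_rintegral => // t.
by rewrite ler_piMl// indicE lern1 leq_b1.
Qed.

Let I_smooth : smooth I.
Proof.
clearbody I; apply: smooth_primitive.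
- by move=> s; apply: derivable_continuous; case: (I_derivable s).
- move=> v s; apply: diff_derivable; apply/derivable1_diffP.
  by case: (I_derivable s).
- move=> v; have -> : 'D_v I = (fun s => v * beta s).
    apply/funext => s; have [dH DH] := I_derivable s.
    have dfH : differentiable I s by apply/derivable1_diffP.
    by rewrite deriveE// -[in LHS](mulr1 v) linearZ /= -deriveE// DH.
  exact: smoothZ.
Qed.

(** [H] is the primitive of the bump divided by its total integral. *)
Lemma smooth_step_of_bump : exists H : R -> R, [/\ smooth H, forall s, 0 <= 'D_1 H s,
  forall s, s <= -1 -> H s = 0, forall s, 1 <= s -> H s = 1 & forall s, 0 <= H s <= 1].
Proof.
clearbody I; exists (fun s => (\int[leb1]_s beta s)^-1 * I s); split.
- exact: smoothZ.
- move=> s; have [dI DI] := I_derivable s.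
  by rewrite (derivable_cmul _ dI).2 DI mulr_ge0// invr_ge0 ltW.
- by move=> s /I_before ->; rewrite mulr0.
- by move=> s /I_after ->; rewrite mulVf// gt_eqF.
- move=> s; have /andP[I0 I1] := I_ge0 s.
  by rewrite mulr_ge0 ?invr_ge0 ?(ltW c_gt0)//= mulrC ler_pdivrMr// mul1r.
Qed.

End SmoothStep.

Lemma smooth_step (R : realType) (chi : E3 R -> R) : cutoff chi ->
  exists H : R -> R, [/\ smooth H, forall s, 0 <= 'D_1 H s,
  forall s, s <= -1 -> H s = 0, forall s, 1 <= s -> H s = 1 & forall s, 0 <= H s <= 1].
Proof.
move=> chiP; apply: (@smooth_step_of_bump R (bump chi)).
- exact: smooth_bump.
- exact: bump_off.
- exact: bump_ge0.
- exact: bump_int.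
- exact: bump_gt0.
Qed.

Section WeakDerivative.
Context (R : realType) (H : R -> R).
Hypotheses (smoothH : smooth H) (DH0 : forall s, 0 <= 'D_1 H s).
Hypotheses (HN1 : forall s, s <= -1 -> H s = 0) (H1 : forall s, 1 <= s -> H s = 1).
Hypothesis H01 : forall s, 0 <= H s <= 1.
Local Notation leb1 := (sleb1 R).

(** A smooth Heaviside function at [c] whose transition takes place within [1 / n.+1] of [c]. Its
    derivative [k] is an approximate identity at [c]. *)
Definition step (c : R) n (s : R) : R := H (n.+1%:R * (s - c)).

Lemma smooth_scale_line (c a : R) (f : R -> R) :
  smooth f -> smooth (fun s : R => f (a * (s - c))).
Proof.
move=> sf; apply: (@smooth_affine R R^o R^o (fun s => a * (s - c)) (fun s => a * s)) => //.
  by move=> h v x; rewrite /= /GRing.scale /= -addrA mulrDr mulrCA.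
move=> s; apply: (@continuousM _ _ (fun=> a) (fun s => s - c)); first exact: cst_continuous.
by apply: (@continuousB _ _ _ id (fun=> c)); [exact: cvg_id|exact: cst_continuous].
Qed.

Lemma derive_scale_line (c a : R) (f : R -> R) s : smooth f ->
  'D_1 (fun s : R => f (a * (s - c))) s = a * 'D_1 f (a * (s - c)).
Proof.
move=> sf.
have -> := @derive_affine R R^o R^o (fun s => a * (s - c)) (fun s => a * s) _ f 1 s.
  have : differentiable f (a * (s - c)).
    by apply/derivable1_diffP; exact: smooth_derivable.
  move: (a * (s - c)) => y df; rewrite mulr1 !deriveE//.
  by rewrite -{1}(mulr1 a) linearZ.
by move=> h v x; rewrite /= /GRing.scale /= -addrA mulrDr mulrCA.
Qed.

Lemma smooth_step_at c n : smooth (step c n).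
Proof. exact: smooth_scale_line. Qed.

Lemma step_before c n s : s <= c - n.+1%:R^-1 -> step c n s = 0.
Proof.
move=> sc; rewrite /step HN1// mulrC -ler_pdivlMr// lerBlDl mulN1r.
by rewrite (le_trans sc).
Qed.

Lemma step_after c n s : c + n.+1%:R^-1 <= s -> step c n s = 1.
Proof.
move=> sc; rewrite /step H1// mulrC -ler_pdivrMr// mul1r lerBrDl.
by rewrite (le_trans _ sc).
Qed.

Let k c n s := 'D_1 (step c n) s.

Let k_ge0 c n s : 0 <= k c n s.
Proof. by rewrite /k derive_scale_line// mulr_ge0. Qed.

Let k_off c n s : ~ `[c - n.+1%:R^-1, c + n.+1%:R^-1]%classic s -> k c n s = 0.
Proof.
rewrite /= in_itv /= => /negP; rewrite negb_and -!ltNge => /orP[sc|sc].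
  rewrite /k (@near_eq_derive R R^o R^o _ (fun=> 0)) ?derive_cst//.
  have : nbhs s `]-oo, (c - n.+1%:R^-1)[%classic.
    by apply: open_nbhs_nbhs; split => //=; rewrite in_itv.
  by apply: filterS => y; rewrite /= in_itv /= => /ltW /step_before.
rewrite /k (@near_eq_derive R R^o R^o _ (fun=> 1)) ?derive_cst//.
have : nbhs s `](c + n.+1%:R^-1), +oo[%classic.
  by apply: open_nbhs_nbhs; split => //=; rewrite in_itv /= sc.
by apply: filterS => y; rewrite /= in_itv /= andbT => /ltW /step_after.
Qed.

Let k_smooth c n : smooth (k c n).
Proof. by apply: smooth_derive; exact: smooth_step_at. Qed.

Let k_bd c n : exists C, forall s, `|k c n s| <= C.
Proof.
have [C kC] := compact_continuous_bounded
  (@segment_compact R (c - n.+1%:R^-1) (c + n.+1%:R^-1)) (smooth_continuous (k_smooth c n)).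
exists (Num.max C 0) => s; have [sI|/k_off->] := pselect (`[c - n.+1%:R^-1, c + n.+1%:R^-1]%classic s).
  by rewrite le_max kC.
by rewrite normr0 le_max lexx orbT.
Qed.

Let mk c n : measurable_fun setT (k c n).
Proof. by apply: continuous_measurable_fun; exact: (smooth_continuous (k_smooth c n)). Qed.

Let k_M (G : R -> R) c n : rintegrable leb1 G -> rintegrable leb1 (fun s => k c n s * G s).
Proof.
move=> Gi; have [C kC] := k_bd c n.
by apply: (@rintegrable_bdM _ _ R leb1 C) => //; exact: mk.
Qed.

Let k_int c n : rintegrable leb1 (k c n).
Proof.
have [C kC] := k_bd c n.
have -> : k c n = (fun s => k c n s * \1_(`[c - n.+1%:R^-1, c + n.+1%:R^-1]%classic : set R) s).
  apply/funext => s; rewrite indicE; have [|] := boolP (_ \in _); first by rewrite mulr1.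
  by rewrite notin_setE mulr0 => /k_off.
apply: k_M; apply: rintegrable_indic => //=; rewrite lebesgue_measure_itv/=.
by case: ifP => _; rewrite ?ltry// -EFinD ltry.
Qed.

Let k_int1 c n : \int[leb1]_s k c n s = 1.
Proof.
transitivity (\int[leb1]_(s in `[c - n.+1%:R^-1, c + n.+1%:R^-1]) k c n s).
  rewrite [RHS]Rintegral_mkcond; apply: eq_Rintegral => s _.
  by rewrite patchE; case: ifPn => //; rewrite notin_setE => /k_off.
rewrite Rintegral_derive.
- by rewrite (@step_after c n (c + _))// (@step_before c n (c - _))// subr0.
- by rewrite lerD2l (@le_trans _ _ 0)// ?oppr_le0 ?invr_ge0.
- by move=> x; apply: smooth_derivable; exact: smooth_step_at.
- exact: (smooth_continuous (k_smooth c n)).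
Qed.

Lemma near_invn (e : R) : 0 < e -> \forall n \near \oo, n.+1%:R^-1 < e.
Proof. by move=> e0; exact: near_infty_natSinv_lt (PosNum e0). Qed.

(** The kernels are nonnegative, have integral 1 and shrink to [c]. The integral sees only the
    almost everywhere class of [G], while the limit is the value at [c] of its representative [g],
    continuous there. *)
Lemma approximate_identity (G g : R -> R) c (d : R) : 0 < d -> rintegrable leb1 G ->
  {for c, continuous g} ->
  {ae leb1, forall s, `|s - c| < d -> G s = g s} ->
  (fun n => \int[leb1]_s (k c n s * G s)) @ \oo --> g c.
Proof.
move=> d0 Gi cg Gg; apply/cvgrPdist_le => e e0.
have /nbhs_ballP[r /= r0 rg] : \forall s \near c, `|g c - g s| <= e.
  by move/cvgrPdist_le : cg => /(_ _ e0).
near=> n.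
have nd : n.+1%:R^-1 < d by near: n; exact: near_invn.
have nr : n.+1%:R^-1 < r by near: n; exact: near_invn.
have Gci : rintegrable leb1 (fun s => k c n s * G s) by exact: k_M.
have gci : rintegrable leb1 (fun s => g c * k c n s) by exact: rintegrableZl.
have kE : g c - \int[leb1]_s (k c n s * G s) = \int[leb1]_s (g c * k c n s - k c n s * G s).
  by rewrite rintegralB// rintegralZl// k_int1 mulr1.
rewrite kE; apply: le_trans (norm_rintegral_le _) _; first exact: rintegrableB.
have ek : \int[leb1]_s (e * k c n s) = e by rewrite rintegralZl// k_int1 mulr1.
rewrite -[leRHS]ek /Rintegral fine_le//.
- exact: integrable_fin_num (rintegrable_norm (rintegrableB gci Gci)).
- exact: integrable_fin_num (rintegrableZl _ _).
apply: ae_ge0_le_integral => //.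
- by apply/measurable_EFinP; apply: rintegrable_measurable; exact: rintegrable_norm (rintegrableB gci Gci).
- by move=> s _; rewrite lee_fin mulr_ge0// ltW.
- by apply/measurable_EFinP; apply: rintegrable_measurable; exact: rintegrableZl.
apply: ae_imply Gg => s Gs _; rewrite lee_fin mulrC -mulrBr normrM ger0_norm// mulrC.
have [|/k_off ->] := pselect (`[c - n.+1%:R^-1, c + n.+1%:R^-1]%classic s); last by rewrite !mulr0.
rewrite /= in_itv /= => /andP[s1 s2].
have sc : `|s - c| <= n.+1%:R^-1 by rewrite ler_norml; apply/andP; split; [rewrite lerBrDl|rewrite lerBlDl].
rewrite ler_wpM2r// Gs ?(le_lt_trans sc)//; apply: rg.
by rewrite /ball /= distrC (le_lt_trans sc).
Unshelve. all: by end_near. Qed.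

(** At [c] itself the sequence is constantly [H 0], about which nothing is known beyond lying in
    [[0, 1]]; that single point is excluded. *)
Lemma step_cvg c s : s != c ->
  (fun n => step c n s) @ \oo --> ((c < s)%R%:R : R).
Proof.
move=> sc; apply: cvg_near_cst.
have d0 : 0 < `|s - c| by rewrite normr_gt0 subr_eq0.
near=> n; have nd : n.+1%:R^-1 < `|s - c| by near: n; exact: near_invn.
move: sc nd; rewrite neq_lt => /orP[sc|cs] nd.
  rewrite (lt_gtF sc) step_before// lerBrDl -lerBrDr (le_trans (ltW nd))//.
  by rewrite ltr0_norm ?subr_lt0// opprB.
by rewrite cs step_after// -lerBrDl (le_trans (ltW nd))// gtr0_norm// subr_gt0.
Unshelve. all: by end_near. Qed.

(* The test functions [step a n - step b n] increase from 0 to 1 near [a] and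
   decrease back to 0 near [b]. *)
Lemma weak_derivative_primitive (T0 T1 : R) (g G F : R -> R) :
  rintegrable leb1 G -> rintegrable leb1 F ->
  (forall t, T0 < t < T1 -> {for t, continuous g}) ->
  {ae leb1, forall s, T0 < s < T1 -> G s = g s} ->
  (forall th, Cc_infty `]T0, T1[%classic th ->
     \int[leb1]_s ('D_1 th s * G s + th s * F s) = 0) ->
  forall a b, T0 < a -> a <= b -> b < T1 ->
  g b = g a + \int[leb1]_(s in `[a, b]) F s.
Proof.
move=> Gi Fi cg Gg test a b T0a + bT1.
rewrite le_eqVlt => /predU1P[->|ab].
  by rewrite set_itv1 Rintegral_set1 addr0.
pose th n s := step a n s - step b n s.
have smooth_th n : smooth (th n) by apply: smoothB; exact: smooth_step_at.
have th_bd n s : `|th n s| <= 1.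
  have /andP[x0 x1] := H01 (n.+1%:R * (s - a)).
  have /andP[y0 y1] := H01 (n.+1%:R * (s - b)).
  by rewrite /th /step ler_norml; apply/andP; split; lra.
have cA c : T0 < c < T1 -> (fun n => \int[leb1]_s (k c n s * G s)) @ \oo --> g c.
  move=> /[dup] cT /andP[T0c cT1].
  have d0 : 0 < Num.min (c - T0) (T1 - c) by rewrite lt_min !subr_gt0 T0c.
  apply: (approximate_identity d0 Gi (cg _ cT)).
  apply: ae_imply Gg => s Gs; rewrite lt_min !ltr_norml => /andP[/andP[s1 s2] /andP[s3 s4]].
  by apply: Gs; apply/andP; split; lra.
have mth n : measurable_fun setT (th n).
  by apply: continuous_measurable_fun; exact: (smooth_continuous (smooth_th n)).
have thF n : rintegrable leb1 (fun s => th n s * F s).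
  by apply: (@rintegrable_bdM _ _ R leb1 1); [exact: mth|exact: th_bd|exact: Fi].
(* Dominated convergence with bound [|F|]: off the null set of the two endpoints, [th n] tends to
   the indicator of [[a, b]]. *)
have cF : (fun n => \int[leb1]_s (th n s * F s)) @ \oo --> \int[leb1]_(s in `[a, b]) F s.
  rewrite rintegral_indicM.
  have IF : rintegrable leb1 (fun s => \1_(`[a, b]%classic : set R) s * F s).
    apply: (@rintegrable_bdM _ _ R leb1 1) => //.
    by move=> s; rewrite indicE normr_natb_le1.
  have [] := @dominated_convergence _ _ R leb1 setT measurableT
    (fun n s => (th n s * F s)%:E) (fun s => (\1_(`[a, b]%classic : set R) s * F s)%:E)
    (fun s => `|F s|%:E).
  - by move=> n; apply/measurable_EFinP; exact: rintegrable_measurable (thF n).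
  - by apply/measurable_EFinP; exact: rintegrable_measurable IF.
  - have null (x : R) : leb1.-negligible [set x] by apply/negligibleP => //; exact: lebesgue_measure_set1.
    apply: (negligibleS _ (negligibleU (null a) (null b))) => s /=.
    apply: contra_notP => /not_orP[/eqP sa /eqP sb] _.
    apply/fine_cvgP; split; first by apply: nearW => n.
    rewrite /comp /=; apply: (@cvgM R _ _ _ (fun n => th n s) (fun=> F s)); last exact: cvg_cst.
    have -> : \1_(`[a, b]%classic : set R) s = ((a < s)%R%:R - (b < s)%R%:R : R).
      rewrite indicE; have [|] := boolP (s \in _).
        rewrite inE /= in_itv /= => /andP[as_ sb_].
        by rewrite lt_neqAle eq_sym sa as_ ltNge sb_ subr0.
      rewrite notin_setE /= in_itv /= => /negP; rewrite negb_and -!ltNge => /orP[sa_|bs].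
        by rewrite !ltNge !(ltW sa_) (le_trans (ltW sa_))//= ?subrr// ltW.
      by rewrite bs (lt_trans ab)// subrr.
    by apply: cvgB; exact: step_cvg.
  - exact: rintegrable_norm.
  - by apply: aeW => s n _; rewrite /= lee_fin normrM ler_piMl.
  move=> _ _; rewrite -[X in _ --> X](fineK (integrable_fin_num _ IF))//.
  exact: fine_cvg.
have DthE n s : 'D_1 (th n) s = k a n s - k b n s.
  by apply: deriveB; apply: smooth_derivable; exact: smooth_step_at.
have aT : T0 < a < T1 by rewrite T0a (lt_trans ab).
have bT : T0 < b < T1 by rewrite bT1 (lt_trans T0a).
have lim1 : (fun n => \int[leb1]_s (k a n s * G s) - \int[leb1]_s (k b n s * G s) +
    \int[leb1]_s (th n s * F s)) @ \oo -->
    g a - g b + \int[leb1]_(s in `[a, b]) F s.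
  apply: (@cvgD _ R^o); last exact: cF.
  by apply: (@cvgB _ R^o); exact: cA.
(* Once [1 / n.+1] is below the distances from [a] to [T0] and from [b] to [T1], [th n] is an
   admissible test function, and the sequence is eventually 0. *)
have lim0 : (fun n => \int[leb1]_s (k a n s * G s) - \int[leb1]_s (k b n s * G s) +
    \int[leb1]_s (th n s * F s)) @ \oo --> (0 : R).
  apply: cvg_near_cst.
  have d0 : 0 < Num.min (a - T0) (T1 - b) by rewrite lt_min !subr_gt0 T0a.
  near=> n.
  have : n.+1%:R^-1 < Num.min (a - T0) (T1 - b) by near: n; exact: near_invn.
  rewrite lt_min => /andP[na nb].
  have thC : Cc_infty `]T0, T1[%classic (th n).
    split; first exact: smooth_th.
    have sub : closure [set s | th n s != 0] `<=` `[a - n.+1%:R^-1, b + n.+1%:R^-1]%classic.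
      rewrite closureE => s; apply; split; first exact: interval_closed.
      move=> t /= tht; rewrite in_itv /=; apply/andP; split; rewrite leNgt;
        apply: contra tht => tab; rewrite /th.
      + rewrite (step_before (ltW tab)) (@step_before b n t) ?subrr//.
        by rewrite (le_trans (ltW tab))// lerD2r ltW.
      + rewrite (step_after (ltW tab)) (@step_after a n t) ?subrr//.
        by rewrite (le_trans _ (ltW tab))// lerD2r ltW.
    split.
      by apply: (subclosed_compact _ (@segment_compact R _ _) sub); exact: closed_closure.
    move=> s /sub sI; apply: open_nbhs_nbhs; split; first exact: itv_open.
    move: sI; rewrite /= !in_itv /= => /andP[s1 s2]; apply/andP; split.
      by rewrite (lt_le_trans _ s1)// ltrBrDr -ltrBrDl.
    by rewrite (le_lt_trans s2)// -ltrBrDl.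
  rewrite -[RHS](test _ thC) rintegralD; last 2 first.
  - under eq_fun do rewrite DthE mulrBl.
    by apply: rintegrableB; exact: k_M.
  - exact: thF.
  congr (_ + _); rewrite -rintegralB; [|exact: k_M|exact: k_M].
  by apply: eq_Rintegral => s _; rewrite DthE mulrBl.
have e0 : g a - g b + \int[leb1]_(s in `[a, b]) F s = 0.
  by rewrite -(cvg_lim (@Rhausdorff R) lim1) (cvg_lim (@Rhausdorff R) lim0).
by rewrite -[LHS]addr0 -e0 addrA [g b + _]addrC subrK.
Unshelve. all: by end_near. Qed.

End WeakDerivative.

(** * Pointwise energy identity and rules for slices *)

Section EnergyIdentity.
Context (R : realType).

(* [a i j], [b i j], [s i j], [q j] stand for D_j U_i, D_j D_j U_i, D_j S_ij and
   D_j P, and [f1 j], [f2 j], [ft] for the derivatives of the weight [f]. *)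
Lemma energy_identity (U q f1 f2 : 'I_3 -> R) (a b S s : 'I_3 -> 'I_3 -> R)
    (P f ft : R) :
  let r i j := S i j - U i * U j in
  let e := \sum_i U i ^+ 2 in
  (forall i j, S i j = S j i) ->
  \sum_i a i i = 0 \/ f = 0 ->
  2^-1 * e * ft + \sum_i f * U i * (\sum_j b i j - \sum_j s i j - q i) =
  2^-1 * e * (ft + \sum_j f2 j) + 2^-1 * e * (\sum_j U j * f1 j)
  + \sum_i (\sum_j r i j * U j) * f1 i
  - f * \sum_i \sum_j a i j ^+ 2
  - (f * - (\sum_i \sum_j r i j * a i j) - P * \sum_j U j * f1 j)
  + \sum_j (\sum_i (f1 j * U i * a i j + f * a i j * a i j + f * U i * b i j)
     - ((\sum_i U i * a i j) * f1 j + 2^-1 * e * f2 j)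
     - (2^-1 * e * (f1 j * U j + f * a j j) + (\sum_i U i * a i j) * (f * U j))
     - \sum_i (f1 j * U i * r i j + f * a i j * r i j
         + f * U i * (s i j - (a i j * U j + U i * a j j)))
     - (f1 j * P * U j + f * q j * U j + f * P * a j j)).
Proof.
move=> r e Ssym div0; apply/eqP; rewrite -subr_eq0; apply/eqP.
have sym : \sum_i (\sum_j r i j * U j) * f1 i = \sum_j \sum_i f1 j * U i * r i j.
  apply: eq_bigr => j _; rewrite mulr_suml; apply: eq_bigr => i _.
  by rewrite /r Ssym; ring.
rewrite sym {sym}.
(* What does not cancel is this multiple of the divergence: the transport of energy and the pressure
   work are in divergence form only up to it. *)
transitivity (f * (P - 2^-1 * e) * \sum_i a i i); last first.
  by case: div0 => ->; rewrite ?mulr0// !mul0r.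
rewrite /r /e !big_ord_recl !big_ord0; by field.
Qed.

End EnergyIdentity.

Section DeriveRules.
Context (R : realType) (V : normedModType R).
Implicit Types (f g : V -> R) (x v : V).

Lemma is_derive_fM f g x v df dg : is_derive x v f df -> is_derive x v g dg ->
  is_derive x v (fun y => f y * g y) (f x * dg + g x * df).
Proof.
move=> [df1 <-] [dg1 <-]; apply: DeriveDef; first exact: (derivableM df1 dg1).
exact: (deriveM df1 dg1).
Qed.

Lemma is_derive_fD f g x v df dg : is_derive x v f df -> is_derive x v g dg ->
  is_derive x v (fun y => f y + g y) (df + dg).
Proof.
move=> [df1 <-] [dg1 <-]; apply: DeriveDef; first exact: (derivableD df1 dg1).
exact: (deriveD df1 dg1).
Qed.

Lemma is_derive_fB f g x v df dg : is_derive x v f df -> is_derive x v g dg ->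
  is_derive x v (fun y => f y - g y) (df - dg).
Proof.
move=> [df1 <-] [dg1 <-]; apply: DeriveDef; first exact: (derivableB df1 dg1).
exact: (deriveB df1 dg1).
Qed.

Lemma is_derive_fsum (I : Type) (s : seq I) (F : I -> V -> R) dF x v :
  (forall i, is_derive x v (F i) (dF i)) ->
  is_derive x v (fun y => \sum_(i <- s) F i y) (\sum_(i <- s) dF i).
Proof.
move=> FdF; elim: s => [|i s IH].
  under eq_fun do rewrite big_nil; rewrite big_nil.
  by apply: DeriveDef; [exact: derivable_cst|exact: derive_cst].
under eq_fun do rewrite big_cons; rewrite big_cons; exact: is_derive_fD.
Qed.

Lemma is_derive_fZ (k : R) f x v df : is_derive x v f df ->
  is_derive x v (fun y => k * f y) (k * df).
Proof.
move=> [df1 <-]; have dk : derivable (fun _ : V => k) x v by exact: derivable_cst.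
apply: DeriveDef; first exact: (derivableM dk df1).
by rewrite (deriveM dk df1) derive_cst scaler0 addr0.
Qed.

Lemma Ck_is_derive (b : bool) n f x v : Ck b n f -> is_derive x v f ('D_v f x).
Proof. by move=> Cf; apply: DeriveDef => //; exact: Ck_derivable Cf. Qed.

End DeriveRules.

Section Slices.
Context (R : realType).

Lemma slice_affine (t : R) (h : R) (v x : E3 R) :
  ((h *: v + x, t) : spacetime R) = h *: ((v, 0) : spacetime R) + (x, t).
Proof.
transitivity ((h *: v + x, h *: 0 + t) : spacetime R) => //.
by rewrite scaler0 add0r.
Qed.

Lemma dspaceE j (f : spacetime R -> R) (x : E3 R) t :
  dspace j f (x, t) = 'D_(ebasis R j) (fun y => f (y, t)) x.
Proof.
symmetry; exact: (@derive_affine R (E3 R) (spacetime R) (fun y => (y, t))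
  (fun v => (v, 0)) (slice_affine t) f (ebasis R j) x).
Qed.

Lemma smooth_slice (f : spacetime R -> R) t : smooth f ->
  smooth (fun y : E3 R => f (y, t)).
Proof.
move=> sf; apply: (@smooth_affine R (E3 R) (spacetime R) (fun y => (y, t))
  (fun v => (v, 0)) (slice_affine t) f) => //.
apply: continuous_fun_pair; last exact: cst_continuous.
by move=> y; exact: cvg_id.
Qed.

Lemma tslice_affine (x : E3 R) (h : R) (v t : R^o) :
  ((x, h *: v + t) : spacetime R) = h *: ((0, v) : spacetime R) + (x, t).
Proof.
transitivity ((h *: 0 + x, h *: v + t) : spacetime R) => //.
by rewrite scaler0 add0r.
Qed.

Lemma dtimeE (f : spacetime R -> R) (x : E3 R) (t : R) :
  dtime f (x, t) = 'D_1 (fun s : R => f (x, s)) t.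
Proof.
symmetry; exact: (@derive_affine R R^o (spacetime R) (fun s => (x, s))
  (fun v => (0, v)) (tslice_affine x) f 1 t).
Qed.

Lemma smooth_tslice (f : spacetime R -> R) (x : E3 R) : smooth f ->
  smooth (fun s : R => f (x, s)).
Proof.
move=> sf; apply: (@smooth_affine R R^o (spacetime R) (fun s => (x, s))
  (fun v => (0, v)) (tslice_affine x) f) => //.
apply: continuous_fun_pair; first exact: cst_continuous.
by move=> s; exact: cvg_id.
Qed.

End Slices.

(** * Slice bounds and integrable majorants *)

Section Tame.
Context (R : realType).
Local Notation leb3 := (sleb3 R).
Implicit Types (f : spacetime R -> R) (N : R -> R).

(** Integrability is asked at every time, so that convolutions and their derivatives are genuine on
    all slices. The mass bound [N] will be constant for the velocity and its products, but merely
    integrable in time for the pressure. *)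
Definition tame f N := [/\ measurable_fun setT f,
  forall t, rintegrable leb3 (fun y => f (y, t)) &
  forall t, \int[leb3]_y `|f (y, t)| <= N t].

Variables (D : set (E3 R)) (k : E3 R -> R).
Hypothesis kD : Cc_infty D k.

Lemma tame_conv_measurable f N : tame f N -> measurable_fun setT (sconv k f).
Proof.
move=> [mf _ _]; apply: measurable_conv => //; case: kD => sk _.
exact: smooth_continuous.
Qed.

Lemma tame_conv_bound f N : tame f N ->
  exists C, 0 <= C /\ forall z, `|sconv k f z| <= C * N z.2.
Proof.
move=> [mf fi fN]; have [C kC] := Cc_infty_bounded kD.
have C0 : 0 <= C by apply: le_trans (kC 0).
exists C; split=> // -[x t]; apply: le_trans (conv_bound kD x kC (fi t)) _.
by rewrite ler_wpM2l.
Qed.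

Lemma dspace_conv f N j : tame f N ->
  dspace j (sconv k f) = sconv ('D_(ebasis R j) k) f.
Proof.
move=> [_ fi _]; apply/funext => -[x t]; rewrite dspaceE.
exact: derive_conv kD (fi t).
Qed.

Lemma tame_slice f N n t : tame f N -> Ck false n (fun y => sconv k f (y, t)).
Proof. by move=> [_ fi _]; exact: Ck_conv kD (fi t). Qed.

End Tame.

Section Domination.
Context (R : realType) (B : set (E3 R)) (a b : R) (q : R -> R).
Local Notation leb3 := (sleb3 R).
Local Notation leb1 := (sleb1 R).
Local Notation leb4 := (sleb4 R).
Hypotheses (mB : measurable B) (Bfin : (leb3 B < +oo)%E).
Hypotheses (q0 : forall t, 0 <= q t) (qi : rintegrable leb1 q).
Implicit Types f g h : spacetime R -> R.

(** The flag [i] records localization to the set [B] of finite measure; the flag [j] records a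
    pressure factor, whose growth in time is controlled only by the integrable [q]. *)
Definition dweight (i j : bool) (z : spacetime R) : R :=
  (if i then \1_B z.1 else 1) * (if j then 1 + q z.2 else 1).

Definition dominated (i j : bool) h := measurable_fun setT h /\
  exists2 C, 0 <= C & forall z, a <= z.2 <= b -> `|h z| <= C * dweight i j z.

Lemma dominatedM i i' j f g : dominated i j f -> dominated i' false g ->
  dominated (i || i') j (fun z => f z * g z).
Proof.
move=> [mf [C C0 fC]] [mg [C' C'0 gC]]; split; first exact: measurable_funM.
exists (C * C'); first exact: mulr_ge0.
move=> z zab; rewrite normrM.
apply: le_trans (ler_pM _ _ (fC z zab) (gC z zab)) _ => //.
rewrite mulrACA; apply: ler_wpM2l; first exact: mulr_ge0.
rewrite /dweight mulr1 mulrAC; apply: ler_wpM2r.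
  by case: j {fC} => //; rewrite addr_ge0.
have i0 : 0 <= \1_B z.1 :> R by [].
have i1 : \1_B z.1 <= 1 :> R by rewrite indicE lern1 leq_b1.
case: i {fC}; case: i' {gC}; rewrite /= ?mul1r ?mulr1//.
by rewrite ler_piMr.
Qed.

Lemma dominatedMr i i' j f g : dominated i false f -> dominated i' j g ->
  dominated (i || i') j (fun z => f z * g z).
Proof.
move=> df dg; under eq_fun do rewrite mulrC.
by rewrite orbC; exact: dominatedM.
Qed.

Lemma dominatedW i f : dominated i false f -> dominated i true f.
Proof.
move=> [mf [C C0 fC]]; split => //; exists C => // z zab.
apply: le_trans (fC z zab) _; rewrite ler_wpM2l// /dweight ler_wpM2l//; first by case: i {fC}.
by rewrite lerDl.
Qed.

Lemma dominatedD i j f g : dominated i j f -> dominated i j g ->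
  dominated i j (fun z => f z + g z).
Proof.
move=> [mf [C C0 fC]] [mg [C' C'0 gC]]; split; first exact: measurable_funD.
exists (C + C'); first exact: addr_ge0.
move=> z zab; apply: le_trans (ler_normD _ _) _.
by rewrite mulrDl; apply: lerD; [exact: fC|exact: gC].
Qed.

Lemma dominatedN i j f : dominated i j f -> dominated i j (fun z => - f z).
Proof.
move=> [mf [C C0 fC]]; split; first exact: measurableT_comp.
by exists C => // z zab; rewrite normrN; exact: fC.
Qed.

Lemma dominatedB i j f g : dominated i j f -> dominated i j g ->
  dominated i j (fun z => f z - g z).
Proof. by move=> df dg; apply: dominatedD => //; exact: dominatedN. Qed.

Lemma dominated_cst (c : R) : dominated false false (fun=> c).
Proof.
split => //; exists `|c| => // z _; by rewrite /dweight !mulr1.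
Qed.

Lemma dominatedZ i j (c : R) f : dominated i j f -> dominated i j (fun z => c * f z).
Proof. by move=> df; apply: (dominatedMr (dominated_cst c) df). Qed.

Lemma dominated0 i j : dominated i j (fun=> 0).
Proof.
by split => //; exists 0 => // z _; rewrite normr0 mul0r.
Qed.

Lemma dominated_sum (I : Type) (s : seq I) (F : I -> spacetime R -> R) i j :
  (forall k, dominated i j (F k)) -> dominated i j (fun z => \sum_(k <- s) F k z).
Proof.
move=> dF; elim: s => [|k s IH].
  by under eq_fun do rewrite big_nil; exact: dominated0.
by under eq_fun do rewrite big_cons; exact: dominatedD.
Qed.

Lemma dominatedX2 f : dominated false false f -> dominated false false (fun z => f z ^+ 2).
Proof. by move=> df; under eq_fun do rewrite expr2; exact: (dominatedM df df). Qed.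

Definition slab : set (spacetime R) := [set: E3 R] `*` `]a, b[%classic.

Lemma indic_slab z : \1_slab z = \1_(`]a, b[%classic : set R) z.2 :> R.
Proof.
rewrite !indicE; congr ((nat_of_bool _)%:R); apply/idP/idP; rewrite !inE.
  by case.
by move=> zab; split.
Qed.

Lemma measurable_slab : measurable slab.
Proof. by apply: measurableX => //; exact: measurable_itv. Qed.

(** The majorant factors into an integrable function of space, the indicator of [B], and an
    integrable function of time, [1 + q] on []a, b[]. *)
Lemma dominated_integrable j h : dominated true j h ->
  rintegrable leb4 (fun z => \1_slab z * h z).
Proof.
move=> dh; have {dh}[mh [C C0 hC]] : dominated true true h.
  by case: j dh => // /dominatedW.
pose g t : R := \1_(`]a, b[%classic : set R) t * (1 + q t).
have g0 t : 0 <= g t by rewrite mulr_ge0// addr_ge0.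
have mg : measurable_fun setT g.
  apply: measurable_funM => //; apply: measurable_funD => //.
  exact: rintegrable_measurable qi.
have gi : rintegrable leb1 g.
  have -> : g = (fun t => \1_(`]a, b[%classic : set R) t + \1_(`]a, b[%classic : set R) t * q t).
    by apply/funext => t; rewrite /g mulrDr mulr1.
  apply: rintegrableD.
    apply: rintegrable_indic => //=; rewrite lebesgue_measure_itv/=.
    by case: ifP => _; rewrite ?ltry// -EFinD ltry.
  apply: (@rintegrable_bdM _ _ R leb1 1) => //.
  by move=> s; rewrite indicE normr_natb_le1.
have mB1 : measurable_fun setT (\1_B : E3 R -> R) by exact: measurable_indic.
have Bi : rintegrable leb3 (\1_B : E3 R -> R) by exact: rintegrable_indic.
have Bti t : rintegrable leb3 (fun x => \1_B x * g t).
  have -> : (fun x : E3 R => \1_B x * g t) = (fun x => g t * \1_B x).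
    by apply/funext => x; rewrite mulrC.
  exact: rintegrableZl.
have wi : rintegrable leb4 (fun z => \1_B z.1 * g z.2).
  apply: (@rintegrable_prod21 _ _ _ _ _ leb3 leb1 _
     (fun t => (\int[leb3]_x \1_B x) * g t)).
  - apply: measurable_funM.
      by apply: (measurableT_comp mB1); exact: measurable_fst.
    by apply: (measurableT_comp mg); exact: measurable_snd.
  - exact: Bti.
  - move=> t; rewrite mulrC -rintegralZl//.
    apply: ler_rintegral; [exact: rintegrable_norm (Bti t)|exact: rintegrableZl|].
    move=> x; rewrite ger0_norm; first by rewrite mulrC.
    by apply: mulr_ge0 => //; rewrite indicE ler0n.
  - exact: rintegrableZl.
apply: (@rintegrable_le _ _ R leb4 _ (fun z => C * (\1_B z.1 * g z.2))).
- by apply: measurable_funM => //; apply: measurable_indic; exact: measurable_slab.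
- exact: rintegrableZl.
- move=> z; rewrite indic_slab normrM indicE.
  have [zab|] := boolP (z.2 \in _); last first.
    move=> _; rewrite /= normr0 mul0r; apply: mulr_ge0 => //.
    by apply: mulr_ge0 => //; rewrite indicE ler0n.
  rewrite /= normr1 mul1r; apply: le_trans (hC z _) _.
    by move: zab; rewrite inE /= in_itv /= => /andP[/ltW-> /ltW->].
  by rewrite /dweight /g !indicE zab mul1r.
Qed.

Variable K : set (E3 R).
Hypotheses (cK : compact K) (KB : K `<=` B).

Lemma dominated_support f : continuous f -> (forall z, ~ K z.1 -> f z = 0) ->
  dominated true false f.
Proof.
move=> cf fK; split; first exact: continuous_measurable_spacetime.
have cKI : compact (K `*` `[a, b]%classic) by apply: compact_setX => //; exact: segment_compact.
have [C fC] := compact_continuous_bounded cKI cf.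
exists (Num.max C 0); first by rewrite le_max lexx orbT.
move=> z zab; rewrite /dweight mulr1 indicE.
have [zK|/fK->] := pselect (K z.1).
  rewrite mem_set ?mulr1; last exact: KB.
  by rewrite le_max fC//; split => //=; rewrite in_itv.
by rewrite normr0 mulr_ge0// le_max lexx orbT.
Qed.

End Domination.

(** * Energy balance of a coarse field on one slab *)

Section EnergyBalance.
Context (R : realType).
Local Notation leb3 := (sleb3 R).
Local Notation leb1 := (sleb1 R).
Local Notation leb4 := (sleb4 R).
Variables (D : set (E3 R)) (k : E3 R -> R).
Hypothesis kD : Cc_infty D k.
Variables (u : vfield R) (p : spacetime R -> R) (M : R) (q : R -> R).
Hypotheses (tu : forall i, tame (u i) (fun=> M))
  (tuu : forall i j, tame (fun z => u i z * u j z) (fun=> M)) (tp : tame p q)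
  (qi : rintegrable leb1 q).

Definition cU : vfield R := fun i => sconv k (u i).
Definition cP : spacetime R -> R := sconv k p.
Definition cS : tfield R := fun i j => sconv k (fun z => u i z * u j z).
Definition cR : tfield R := fun i j z => cS i j z - cU i z * cU j z.
Definition cpackage := Package cU cP cR.

(** The time derivative of the coarse velocity as prescribed by the mollified momentum equation:
    Laplacian minus divergence of the mollified tensor minus pressure gradient. *)
Definition cF i (z : spacetime R) : R :=
  \sum_j dspace j (dspace j (cU i)) z - \sum_j dspace j (cS i j) z - dspace i cP z.

Lemma cS_sym i j : cS i j = cS j i.
Proof. by congr sconv; apply/funext => z; rewrite mulrC. Qed.

Let dk (v : E3 R) := Cc_infty_derive v kD.

Lemma dspace_cU i j : dspace j (cU i) = sconv ('D_(ebasis R j) k) (u i).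
Proof. exact (dspace_conv kD j (tu i)). Qed.

Lemma dspace2_cU i j : dspace j (dspace j (cU i)) =
  sconv ('D_(ebasis R j) ('D_(ebasis R j) k)) (u i).
Proof. by rewrite dspace_cU (dspace_conv (dk _) j (tu i)). Qed.

Lemma dspace_cS i j l : dspace l (cS i j) =
  sconv ('D_(ebasis R l) k) (fun z => u i z * u j z).
Proof. exact (dspace_conv kD l (tuu i j)). Qed.

Lemma dspace_cP j : dspace j cP = sconv ('D_(ebasis R j) k) p.
Proof. exact (dspace_conv kD j tp). Qed.

Variables (B : set (E3 R)) (a b m : R).
Hypotheses (ab : a < b) (mB : measurable B) (Bfin : (leb3 B < +oo)%E).
Hypothesis Bbox : forall x : E3 R, B x -> [/\ `|x.1.1| < m, `|x.1.2| < m & `|x.2| < m].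
Local Notation dom := (dominated B a b q).
Local Notation slab := (slab a b).

Let q0 t : 0 <= q t.
Proof.
by have [_ _ /(_ t)] := tp; apply: le_trans; exact: Rintegral_ge0.
Qed.

Let dom_bounded kk f : Cc_infty D kk -> tame f (fun=> M) -> dom false false (sconv kk f).
Proof.
move=> kkD tf; split; first exact: (tame_conv_measurable kkD tf).
have [C [C0 fC]] := tame_conv_bound kkD tf.
have M0 : 0 <= M.
  by have [_ _ /(_ 0)] := tf; apply: le_trans; exact: Rintegral_ge0.
exists (C * M); first exact: mulr_ge0.
by move=> z _; rewrite /dweight !mulr1.
Qed.

Let dom_pressure kk : Cc_infty D kk -> dom false true (sconv kk p).
Proof.
move=> kkD; split; first exact: (tame_conv_measurable kkD tp).
have [C [C0 fC]] := tame_conv_bound kkD tp.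
exists C => // z _; apply: le_trans (fC z) _.
by rewrite /dweight mul1r ler_wpM2l// lerDr.
Qed.

Lemma dom_cU i : dom false false (cU i).
Proof. exact (dom_bounded kD (tu i)). Qed.
Lemma dom_dcU i j : dom false false (dspace j (cU i)).
Proof. by rewrite dspace_cU; exact (dom_bounded (dk _) (tu i)). Qed.
Lemma dom_ddcU i j : dom false false (dspace j (dspace j (cU i))).
Proof.
by rewrite dspace2_cU; exact (dom_bounded (Cc_infty_derive _ (dk _)) (tu i)).
Qed.
Lemma dom_cS i j : dom false false (cS i j).
Proof. exact (dom_bounded kD (tuu i j)). Qed.
Lemma dom_dcS i j l : dom false false (dspace l (cS i j)).
Proof. by rewrite dspace_cS; exact (dom_bounded (dk _) (tuu i j)). Qed.
Lemma dom_cP : dom false true cP.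
Proof. exact (dom_pressure kD). Qed.
Lemma dom_dcP j : dom false true (dspace j cP).
Proof. by rewrite dspace_cP; exact (dom_pressure (dk _)). Qed.
Lemma dom_cR i j : dom false false (cR i j).
Proof.
apply: dominatedB; first exact: dom_cS.
by apply: (dominatedM q0 (dom_cU i) (dom_cU j)).
Qed.
Lemma dom_sqnorm : dom false false (sqnorm cU).
Proof. by apply: dominated_sum => i; apply: dominatedX2 => //; exact: dom_cU. Qed.

Lemma dom_cF i : dom false true (cF i).
Proof.
apply: dominatedB; last exact: dom_dcP.
apply: dominatedW => //; apply: dominatedB; apply: dominated_sum => j.
  exact: dom_ddcU.
exact: dom_dcS.
Qed.

Variables (phi : spacetime R -> R) (K : set (E3 R)).
Hypotheses (smooth_phi : smooth phi) (cK : compact K) (KB : K `<=` B).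
Hypothesis phiK : forall z, ~ K z.1 -> phi z = 0.

Lemma closedK : closed K.
Proof. by apply: compact_closed => //; exact: norm_hausdorff. Qed.

Lemma dspace_support (f : spacetime R -> R) j : (forall z, ~ K z.1 -> f z = 0) ->
  forall z, ~ K z.1 -> dspace j f z = 0.
Proof.
move=> fK [x t] /= Kx; rewrite dspaceE.
by apply: (derive_off_closed _ closedK _ Kx) => y Ky; exact: fK.
Qed.

Lemma dtime_support (f : spacetime R -> R) : (forall z, ~ K z.1 -> f z = 0) ->
  forall z, ~ K z.1 -> dtime f z = 0.
Proof.
move=> fK [x t] /= Kx; rewrite dtimeE.
have -> : (fun s : R => f (x, s)) = fun=> 0 by apply/funext => s; exact: fK.
exact: derive_cst.
Qed.

Let dom_supp f : smooth f -> (forall z, ~ K z.1 -> f z = 0) -> dom true false f.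
Proof. by move=> sf; apply: (dominated_support a b q cK KB); exact: smooth_continuous. Qed.

Let sdphi j : smooth (dspace j phi). Proof. exact: smooth_derive. Qed.

Lemma dom_phi : dom true false phi.
Proof. exact (dom_supp smooth_phi phiK). Qed.
Lemma dom_dphi j : dom true false (dspace j phi).
Proof. exact (dom_supp (sdphi j) (dspace_support j phiK)). Qed.
Lemma dom_ddphi j : dom true false (dspace j (dspace j phi)).
Proof.
exact (dom_supp (smooth_derive _ (sdphi j)) (dspace_support j (dspace_support j phiK))).
Qed.
Lemma dom_tphi : dom true false (dtime phi).
Proof. exact (dom_supp (smooth_derive _ smooth_phi) (dtime_support phiK)). Qed.

Lemma dom_transport (v : vfield R) : (forall i, dom false false (v i)) ->
  dom true false (transport v phi).
Proof.
by move=> dv; apply: dominated_sum => j; exact: (dominatedMr q0 (dv j) (dom_dphi j)).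
Qed.

Definition densW z := phi z * pkPi cpackage z - cP z * transport cU phi z.
Definition densD z := phi z * \sum_i \sum_j dspace j (cU i) z ^+ 2.
Definition densL z := 2^-1 * sqnorm cU z * (dtime phi z + laplacian phi z)
   + 2^-1 * sqnorm cU z * transport cU phi z
   + transport (fun i y => \sum_j cR i j y * cU j y) phi z.

Lemma dom_pkPi : dom false false (pkPi cpackage).
Proof.
apply: dominatedN; apply: dominated_sum => i; apply: dominated_sum => j.
exact (dominatedM q0 (dom_cR i j) (dom_dcU i j)).
Qed.

Lemma dom_phiPi : dom true true (fun z => phi z * pkPi cpackage z).
Proof. by apply: dominatedW => //; exact: (dominatedM q0 dom_phi dom_pkPi). Qed.

Lemma dom_Ptransport : dom true true (fun z => cP z * transport cU phi z).
Proof. exact: (dominatedM q0 dom_cP (dom_transport dom_cU)). Qed.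

Lemma dom_densW : dom true true densW.
Proof. exact: dominatedB dom_phiPi dom_Ptransport. Qed.

Lemma dom_densD : dom true true densD.
Proof.
apply: dominatedW => //; apply: (dominatedM q0 dom_phi).
by do 2 (apply: dominated_sum => ?); apply: dominatedX2 => //; exact: dom_dcU.
Qed.

Lemma dom_densL : dom true true densL.
Proof.
have hE : dom false false (fun z => 2^-1 * sqnorm cU z).
  by apply: dominatedZ => //; exact: dom_sqnorm.
apply: dominatedW => //; apply: dominatedD; last first.
  apply: dom_transport => i; apply: dominated_sum => j.
  exact (dominatedM q0 (dom_cR i j) (dom_cU j)).
apply: dominatedD; last exact: (dominatedMr q0 hE (dom_transport dom_cU)).
apply: (dominatedMr q0 hE); apply: dominatedD; first exact: dom_tphi.
by apply: dominated_sum => j; exact: dom_ddphi.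
Qed.

(** The time derivative of [2^-1 * |U|^2 * phi], with [cF] standing for the time derivative of
    [U]. *)
Definition densH z := 2^-1 * sqnorm cU z * dtime phi z + \sum_i phi z * cU i z * cF i z.

Lemma dom_densH : dom true true densH.
Proof.
have hE : dom false false (fun z => 2^-1 * sqnorm cU z).
  by apply: dominatedZ => //; exact: dom_sqnorm.
apply: dominatedD; first by apply: dominatedW => //; exact: (dominatedMr q0 hE dom_tphi).
apply: dominated_sum => i.
exact: (dominatedMr (i := true) (i' := false) q0 (dominatedM q0 dom_phi (dom_cU i)) (dom_cF i)).
Qed.

(* Integrating [H] reduces to [densL - densD - densW] because the difference is the
   divergence of this flux. *)
Definition flux j (z : spacetime R) : R :=
  \sum_i phi z * cU i z * dspace j (cU i) z - 2^-1 * sqnorm cU z * dspace j phi z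
  - 2^-1 * sqnorm cU z * (phi z * cU j z)
  - \sum_i phi z * cU i z * cR i j z - phi z * cP z * cU j z.

(** The product rule applied to [flux j] along axis [j], expanded by hand so that it matches the
    terms of [energy_identity]; [is_derive_flux] justifies it. *)
Definition dflux j (z : spacetime R) : R :=
  let U i := cU i z in let A i j := dspace j (cU i) z in
  let f := phi z in let f1 j := dspace j phi z in
  \sum_i (f1 j * U i * A i j + f * A i j * A i j
            + f * U i * dspace j (dspace j (cU i)) z)
     - ((\sum_i U i * A i j) * f1 j + 2^-1 * sqnorm cU z * dspace j (dspace j phi) z)
     - (2^-1 * sqnorm cU z * (f1 j * U j + f * A j j) + (\sum_i U i * A i j) * (f * U j))
     - \sum_i (f1 j * U i * cR i j z + f * A i j * cR i j z
         + f * U i * (dspace j (cS i j) z - (A i j * U j + U i * A j j)))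
     - (f1 j * cP z * U j + f * dspace j cP z * U j + f * cP z * A j j).

(** The divergence is known to vanish only over [K]; elsewhere the weight is 0, hence the
    disjunction. *)
Lemma densH_flux z : \sum_i dspace i (cU i) z = 0 \/ phi z = 0 ->
  densH z = densL z - densD z - densW z + \sum_j dflux j z.
Proof.
move=> div0; rewrite /densH /densL /densD /densW /dflux /cF /pkPi /transport /laplacian /=.
exact: (@energy_identity R (fun i => cU i z) (fun j => dspace j cP z)
  (fun j => dspace j phi z) (fun j => dspace j (dspace j phi) z)
  (fun i j => dspace j (cU i) z) (fun i j => dspace j (dspace j (cU i)) z)
  (fun i j => cS i j z) (fun i j => dspace j (cS i j) z) (cP z) (phi z) (dtime phi z)
  (fun i j => congr1 (@^~ z) (cS_sym i j)) div0).
Qed.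

Lemma dom_dflux j : dom true true (dflux j).
Proof.
have hE : dom false false (fun z => 2^-1 * sqnorm cU z).
  by apply: dominatedZ => //; exact: dom_sqnorm.
have hA : dom false false (fun z => \sum_i cU i z * dspace j (cU i) z).
  by apply: dominated_sum => i; exact (dominatedM q0 (dom_cU i) (dom_dcU i j)).
have f1U i : dom true false (fun z => dspace j phi z * cU i z).
  exact (dominatedM q0 (dom_dphi j) (dom_cU i)).
have fU i : dom true false (fun z => phi z * cU i z).
  exact (dominatedM q0 dom_phi (dom_cU i)).
have fA i l : dom true false (fun z => phi z * dspace l (cU i) z).
  exact (dominatedM q0 dom_phi (dom_dcU i l)).
apply: dominatedB; last first.
  apply: dominatedD; first apply: dominatedD.
  - exact (dominatedM q0 (dominatedMr q0 (dom_dphi j) dom_cP) (dom_cU j)).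
  - exact (dominatedM q0 (dominatedMr q0 dom_phi (dom_dcP j)) (dom_cU j)).
  - exact (dominatedM q0 (dominatedMr q0 dom_phi dom_cP) (dom_dcU j j)).
apply: dominatedW => //; apply: dominatedB; last first.
  apply: dominated_sum => i; apply: dominatedD; first apply: dominatedD.
  - exact (dominatedM q0 (f1U i) (dom_cR i j)).
  - exact (dominatedM q0 (fA i j) (dom_cR i j)).
  - apply: (dominatedM q0 (fU i)); apply: dominatedB; first exact: dom_dcS.
    apply: dominatedD; first exact (dominatedM q0 (dom_dcU i j) (dom_cU j)).
    exact (dominatedM q0 (dom_cU i) (dom_dcU j j)).
apply: dominatedB; last first.
  apply: dominatedD; last exact: (dominatedMr q0 hA (fU j)).
  by apply: (dominatedMr q0 hE); exact: dominatedD.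
apply: dominatedB; last first.
  apply: dominatedD; first exact: (dominatedMr q0 hA (dom_dphi j)).
  exact: (dominatedMr q0 hE (dom_ddphi j)).
apply: dominated_sum => i; apply: dominatedD; first apply: dominatedD.
- exact (dominatedM q0 (f1U i) (dom_dcU i j)).
- exact (dominatedM q0 (fA i j) (dom_dcU i j)).
- exact (dominatedM q0 (fU i) (dom_ddcU i j)).
Qed.

Let alg1 (y y1 y2 y3 y4 : R) : y - (y1 * y2 + y3 * y4) = y - (y4 * y3 + y1 * y2).
Proof. by ring. Qed.
Let alg2 (f f1 v v1 r r1 : R) :
  f * v * r1 + r * (f * v1 + v * f1) = f1 * v * r + f * v1 * r + f * v * r1.
Proof. by ring. Qed.
Let alg3 (e e1 f f1 v v1 : R) :
  e * (f * v1 + v * f1) + f * v * e1 = e * (f1 * v + f * v1) + e1 * (f * v).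
Proof. by ring. Qed.
Let alg4 (f f1 P P1 v v1 : R) :
  f * P * v1 + v * (f * P1 + P * f1) = f1 * P * v + f * P1 * v + f * P * v1.
Proof. by ring. Qed.
Let alg5 (e e1 f f1 : R) : e * f1 + f * e1 = e1 * f + e * f1.
Proof. by ring. Qed.

Let alg6 (i l d w s : R) : i * (l - d - w + s) = i * l - i * d - i * w + i * s.
Proof. by ring. Qed.

Section FluxDerivative.
Local Opaque sconv dspace dtime.
Variables (j : 'I_3) (t : R).
Local Notation e := (ebasis R j).

Let d_phi x : is_derive x e (fun y => phi (y, t)) (dspace j phi (x, t)).
Proof. by rewrite dspaceE; exact (Ck_is_derive x e (smooth_Ck false 0 (smooth_slice t smooth_phi))). Qed.

Let d_dphi x : is_derive x e (fun y => dspace j phi (y, t)) (dspace j (dspace j phi) (x, t)).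
Proof.
rewrite [X in is_derive _ _ _ X]dspaceE.
exact (Ck_is_derive x e (smooth_Ck false 0 (smooth_slice t (sdphi j)))).
Qed.

Let d_conv kk f N x : Cc_infty D kk -> tame f N ->
  is_derive x e (fun y => sconv kk f (y, t)) (dspace j (sconv kk f) (x, t)).
Proof.
by move=> kkD tf; rewrite dspaceE; exact (Ck_is_derive x e (tame_slice kkD 0 t tf)).
Qed.

Let d_U x i : is_derive x e (fun y => cU i (y, t)) (dspace j (cU i) (x, t)).
Proof. exact (d_conv x kD (tu i)). Qed.

Let d_dU x i : is_derive x e (fun y => dspace j (cU i) (y, t)) (dspace j (dspace j (cU i)) (x, t)).
Proof.
rewrite [dspace j (cU i)]dspace_cU; exact (d_conv x (dk _) (tu i)).
Qed.

Let d_S x i : is_derive x e (fun y => cS i j (y, t)) (dspace j (cS i j) (x, t)).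
Proof. exact (d_conv x kD (tuu i j)). Qed.

Let d_P x : is_derive x e (fun y => cP (y, t)) (dspace j cP (x, t)).
Proof. exact (d_conv x kD tp). Qed.

Let d_R x i : is_derive x e (fun y => cR i j (y, t))
  (dspace j (cS i j) (x, t) - (dspace j (cU i) (x, t) * cU j (x, t) + cU i (x, t) * dspace j (cU j) (x, t))).
Proof.
apply: is_derive_eq; first exact (is_derive_fB (d_S x i) (is_derive_fM (d_U x i) (d_U x j))).
exact (alg1 _ _ _ _ _).
Qed.

Let d_E x : is_derive x e (fun y => 2^-1 * sqnorm cU (y, t))
  (\sum_i cU i (x, t) * dspace j (cU i) (x, t)).
Proof.
rewrite /sqnorm; have -> : (fun y => 2^-1 * (\sum_i cU i (y, t) ^+ 2)) =
    (fun y => 2^-1 * (\sum_i cU i (y, t) * cU i (y, t))).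
  by apply/funext => y; congr (_ * _); apply: eq_bigr => i _; rewrite expr2.
apply: is_derive_eq.
  exact (is_derive_fZ 2^-1 (is_derive_fsum (index_enum 'I_3) (fun i => is_derive_fM (d_U x i) (d_U x i)))).
by cbv beta; rewrite mulr_sumr; apply: eq_bigr => i _; field.
Qed.

Lemma is_derive_flux x : is_derive x e (fun y => flux j (y, t)) (dflux j (x, t)).
Proof.
rewrite /flux /dflux; apply: is_derive_fB; first apply: is_derive_fB; first apply: is_derive_fB;
  first apply: is_derive_fB.
- apply: is_derive_fsum => i; apply: is_derive_eq.
    exact (is_derive_fM (is_derive_fM (d_phi x) (d_U x i)) (d_dU x i)).
  exact (alg2 _ _ _ _ _ _).
- apply: is_derive_eq; first exact (is_derive_fM (d_E x) (d_dphi x)).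
  exact (alg5 _ _ _ _).
- apply: is_derive_eq; first exact (is_derive_fM (d_E x) (is_derive_fM (d_phi x) (d_U x j))).
  exact (alg3 _ _ _ _ _ _).
- apply: is_derive_fsum => i; apply: is_derive_eq.
    exact (is_derive_fM (is_derive_fM (d_phi x) (d_U x i)) (d_R x i)).
  exact (alg2 _ _ _ _ _ _).
- apply: is_derive_eq; first exact (is_derive_fM (is_derive_fM (d_phi x) (d_P x)) (d_U x j)).
  exact (alg4 _ _ _ _ _ _).
Qed.

Lemma Ck_flux : Ck false 1 (fun y => flux j (y, t)).
Proof.
have c_phi : Ck false 1 (fun y : E3 R => phi (y, t)).
  exact (smooth_Ck false 1 (smooth_slice t smooth_phi)).
have c_dphi : Ck false 1 (fun y : E3 R => dspace j phi (y, t)).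
  exact (smooth_Ck false 1 (smooth_slice t (sdphi j))).
have c_U i : Ck false 1 (fun y => cU i (y, t)) by exact (tame_slice kD 1 t (tu i)).
have c_dU i : Ck false 1 (fun y => dspace j (cU i) (y, t)).
  by rewrite [dspace j (cU i)]dspace_cU; exact (tame_slice (dk _) 1 t (tu i)).
have c_R i : Ck false 1 (fun y => cR i j (y, t)).
  apply: (CkD (f := fun y => cS i j (y, t))); first exact (tame_slice kD 1 t (tuu i j)).
  exact (CkN (CkM (c_U i) (c_U j))).
have c_P : Ck false 1 (fun y => cP (y, t)) by exact (tame_slice kD 1 t tp).
have c_E : Ck false 1 (fun y => 2^-1 * sqnorm cU (y, t)).
  apply: CkM; first exact: Ck_cst.
  by apply: Ck_sum => i; under eq_fun do rewrite expr2; exact (CkM (c_U i) (c_U i)).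
rewrite /flux.
apply: CkD; last by apply: CkN; exact (CkM (CkM c_phi c_P) (c_U j)).
apply: CkD; last by apply: CkN; apply: Ck_sum => i; exact (CkM (CkM c_phi (c_U i)) (c_R i)).
apply: CkD; last by apply: CkN; exact (CkM c_E (CkM c_phi (c_U j))).
apply: CkD; last by apply: CkN; exact (CkM c_E c_dphi).
by apply: Ck_sum => i; exact (CkM (CkM c_phi (c_U i)) (c_dU i)).
Qed.

End FluxDerivative.

Lemma flux_support j z : ~ K z.1 -> flux j z = 0.
Proof.
move=> Kz; rewrite /flux (phiK Kz) (dspace_support j phiK Kz).
rewrite !big1 => [|i _|i _]; try by rewrite !mul0r.
by rewrite !(mul0r, mulr0) !subr0.
Qed.

(** At a fixed time in the slab the integrand is the [j]-th partial derivative of a function that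
    vanishes outside [K], hence outside a box. Almost every slice is integrable, which is all that
    Fubini needs. *)
Lemma Rintegral_dflux j : \int[leb4]_z (\1_slab z * dflux j z) = 0.
Proof.
have di := dominated_integrable mB Bfin q0 qi (dom_dflux j).
rewrite (Rintegral_prod21 di) -[RHS](rintegral0 leb1).
apply: ae_eq_Rintegral; apply: ae_imply (ae_integrable2 di) => t dit _.
have [tab|tab] := boolP (t \in (`]a, b[%classic : set R)); last first.
  rewrite -[RHS](rintegral0 leb3); apply: eq_Rintegral => x _.
  by rewrite indic_slab indicE (negbTE tab) mul0r.
have E1 x : \1_slab (x, t) * dflux j (x, t) = 'D_(ebasis R j) (fun y => flux j (y, t)) x.
  have [_ ->] := is_derive_flux j t x.
  by rewrite indic_slab indicE tab mul1r.
under eq_Rintegral do rewrite E1.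
apply: (@Rintegral_derive_ebasis R _ m).
- exact: Ck_flux.
- move=> x mx; apply: flux_support => /= /KB/Bbox[x1 x2 x3].
  by move: mx; rewrite !leNgt x1 x2 x3.
- by move: dit => /=; under eq_fun do rewrite E1.
Qed.

(** Later instantiated by the coarse velocity of the untruncated field. It matches [cU] only at
    almost every time, but it is the one that is a primitive of [cF], so the energies at [a] and [b]
    are taken from it. *)
Variable Uo : vfield R.
Hypothesis Uo_density : forall x i, K x ->
  has_density a b (fun t => Uo i (x, t)) (fun t => cF i (x, t)).
Hypothesis Uo_ae : forall x, K x ->
  {ae leb1, forall s, a < s < b -> forall i, Uo i (x, s) = cU i (x, s)}.
Hypothesis cU_div : forall x s, K x -> \sum_i dspace i (cU i) (x, s) = 0.

Definition energy t (x : E3 R) := 2^-1 * sqnorm Uo (x, t) * phi (x, t).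
Hypotheses (energy_a : rintegrable leb3 (energy a)) (energy_b : rintegrable leb3 (energy b)).

Lemma phi_density x : has_density a b (fun t => phi (x, t)) (fun t => dtime phi (x, t)).
Proof.
have sx := smooth_tslice x smooth_phi.
have E : (fun t => dtime phi (x, t)) = 'D_1 (fun s : R => phi (x, s)).
  by apply/funext => t; rewrite dtimeE.
have cD : continuous ('D_1 (fun s : R => phi (x, s))).
  by apply: smooth_continuous; exact: smooth_derive.
rewrite E; split.
  have mI : measurable `[a, b]%classic by exact: measurable_itv.
  have [h _] := @rintegrable_indicM _ _ R leb1 _ ('D_1 (fun s : R => phi (x, s))) mI.
  apply: h; apply: continuous_compact_integrable; first exact: segment_compact.
  exact: continuous_subspaceT.
move=> t /andP[at_ _]; rewrite Rintegral_derive//; last by move=> s; exact: smooth_derivable.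
by rewrite addrCA subrr addr0.
Qed.

(** For [x] in [K], two uses of [has_densityM] give each [Uo i * Uo i * phi] a density in time;
    outside [K] both sides vanish with the weight. *)
Lemma energy_diff x : energy b x - energy a x = \int[leb1]_s (\1_slab (x, s) * densH (x, s)).
Proof.
have [Kx|Kx] := pselect (K x); last first.
  rewrite /energy !phiK// !mulr0 subrr -[LHS](rintegral0 leb1).
  apply: eq_Rintegral => s _; rewrite /densH phiK// (dtime_support phiK)//.
  by rewrite mulr0 add0r big1 ?mulr0// => i _; rewrite !mul0r.
have d i := has_densityM (has_densityM (Uo_density i Kx) (Uo_density i Kx)) (phi_density x).
have bb : a <= b <= b by rewrite lexx ltW.
have -> : energy b x - energy a x = \sum_i 2^-1 * \int[leb1]_s (\1_(`[a, b]%classic : set R) s *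
    ((cF i (x, s) * Uo i (x, s) + cF i (x, s) * Uo i (x, s)) * phi (x, s) +
      dtime phi (x, s) * (Uo i (x, s) * Uo i (x, s)))).
  rewrite /energy /sqnorm !(mulr_sumr, mulr_suml) -sumrB; apply: eq_bigr => i _.
  have [_ /(_ b bb)] := d i; rewrite rintegral_indicM => E.
  by rewrite !expr2 -!(mulrA 2^-1) -mulrBr E addrAC subrr add0r.
under eq_bigr do rewrite -(rintegralZl _ (d _).1).
rewrite -rintegral_sum; last by move=> i; exact: rintegrableZl (d i).1.
have null (y : R) : {ae leb1, forall s, s <> y}.
  exists [set y]; split => //; first exact: lebesgue_measure_set1.
  by move=> s /= /contrapT.
apply: ae_eq_Rintegral.
(* Discards the endpoints, where the closed and the open interval differ, together with the null set
   of times at which [Uo] and [cU] differ. *)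
apply: ae_imply (ae_and (ae_and (null a) (null b)) (Uo_ae Kx)) => s [[sa sb] Us] _.
rewrite indic_slab /= !indicE.
have [sI|sI] := boolP (s \in (`]a, b[%classic : set R)).
  have sab : a < s < b by move: sI; rewrite inE /= in_itv.
  have -> : s \in (`[a, b]%classic : set R).
    by move: sab; rewrite inE /= in_itv /= => /andP[/ltW-> /ltW->].
  rewrite mul1r /densH /sqnorm mulr_sumr mulr_suml -big_split /=.
  apply: eq_bigr => i _; rewrite (Us sab) mul1r; by field.
have -> : (s \in (`[a, b]%classic : set R)) = false.
  apply/negP; rewrite inE /= in_itv /= => /andP[as_ sb_].
  move/negP: sI; apply; rewrite inE /= in_itv /= !lt_neqAle as_ sb_ !andbT.
  by apply/andP; split; apply/eqP => // /esym.
by rewrite mul0r big1// => i _; rewrite mul0r mulr0.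
Qed.

Theorem energy_balance :
  \int[leb3]_x energy b x - \int[leb3]_x energy a x =
  \int[leb4]_(z in slab) densL z - \int[leb4]_(z in slab) densD z
  - \int[leb4]_(z in slab) densW z.
Proof.
have iH := dominated_integrable mB Bfin q0 qi dom_densH.
have iL := dominated_integrable mB Bfin q0 qi dom_densL.
have iD := dominated_integrable mB Bfin q0 qi dom_densD.
have iW := dominated_integrable mB Bfin q0 qi dom_densW.
have iF j := dominated_integrable mB Bfin q0 qi (dom_dflux j).
rewrite -rintegralB//; under eq_Rintegral do rewrite energy_diff.
rewrite -(Rintegral_prod12 iH) !(rintegral_indicM _ slab).
rewrite -rintegralB// -[RHS]rintegralB//; last exact: rintegrableB.
(* Inserts the three vanishing flux integrals, after which the integrands agree pointwise by
   [densH_flux]. *)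
rewrite -[RHS]addr0 -[X in _ + X](@big1 R 0 +%R 'I_3 (index_enum 'I_3) xpredT
  (fun j => \int[leb4]_z (\1_slab z * dflux j z)) (fun j _ => Rintegral_dflux j)).
rewrite -rintegral_sum// -rintegralD; last 2 first.
- by apply: rintegrableB => //; exact: rintegrableB.
- exact: rintegrable_sum.
apply: eq_Rintegral => -[x t] _; rewrite densH_flux.
  by rewrite alg6 mulr_sumr.
have [Kx|Kx] := pselect (K x); first by left; exact: cU_div.
by right; exact: phiK.
Qed.

End EnergyBalance.

(** * Euclidean balls and the mollifier at scale [l] *)

Section Geometry.
Context (R : realType).
Local Notation leb3 := (sleb3 R).
Implicit Types (x y : E3 R) (r : R).

Lemma continuous_enorm : continuous (@enorm R).
Proof.
have c1 : continuous (fun x : E3 R => x.1.1).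
  by move=> y; apply: (@continuous_comp _ _ _ fst fst); exact: cvg_fst.
have c2 : continuous (fun x : E3 R => x.1.2).
  by move=> y; apply: (@continuous_comp _ _ _ fst snd); [exact: cvg_fst|exact: cvg_snd].
have c3 : continuous (fun x : E3 R => x.2) by move=> y; exact: cvg_snd.
have sq (f : E3 R -> R) : continuous f -> continuous (fun x => f x ^+ 2).
  move=> cf y; under eq_fun do rewrite expr2.
  by apply: (@continuousM _ _ f f); exact: cf.
have cs : continuous (fun x : E3 R => x.1.1 ^+ 2 + x.1.2 ^+ 2 + x.2 ^+ 2).
  move=> x.
  apply: (@continuousD _ _ _ (fun x : E3 R => x.1.1 ^+ 2 + x.1.2 ^+ 2) (fun x => x.2 ^+ 2)).
    by apply: (@continuousD _ _ _ (fun x : E3 R => x.1.1 ^+ 2) (fun x => x.1.2 ^+ 2));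
      [exact: (sq _ c1)|exact: (sq _ c2)].
  exact: (sq _ c3).
by move=> x; exact: (continuous_comp (cs x) (@sqrt_continuous R _)).
Qed.

Lemma continuous_subr x : continuous (fun y : E3 R => y - x).
Proof.
move=> y; apply: (@continuousB R _ (E3 R) id (fun=> x)).
  exact: cvg_id.
exact: cst_continuous.
Qed.

Lemma open_eball x r : open (eball x r).
Proof.
have c : continuous (fun y : E3 R => enorm (y - x)).
  by move=> y; exact: (continuous_comp (@continuous_subr x y) (@continuous_enorm _)).
rewrite (_ : eball x r = (fun y : E3 R => enorm (y - x)) @^-1` `]-oo, r[%classic).
  by move/continuousP : c; apply; exact: lray_open.
by apply/seteqP; split => y; rewrite /eball /= in_itv.
Qed.

Lemma coord_le_enorm x : [/\ `|x.1.1| <= enorm x, `|x.1.2| <= enorm x & `|x.2| <= enorm x].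
Proof.
by split; rewrite -sqrtr_sqr ler_sqrt ?addr_ge0 ?sqr_ge0//;
  have [] := (sqr_ge0 x.1.1, sqr_ge0 x.1.2, sqr_ge0 x.2); move=> []; lra.
Qed.

Lemma eball_box x r : exists m, forall y, eball x r y ->
  [/\ `|y.1.1| < m, `|y.1.2| < m & `|y.2| < m].
Proof.
exists (r + enorm x) => y; rewrite /eball /= => yr.
have [y1 y2 y3] := coord_le_enorm (y - x); have [x1 x2 x3] := coord_le_enorm x.
have tri (s t : R) : `|s - t| <= enorm (y - x) -> `|t| <= enorm x -> `|s| < r + enorm x.
  move=> st tx; rewrite -(subrK t s); apply: le_lt_trans (ler_normD _ _) _.
  exact: ltr_leD (le_lt_trans st yr) tx.
by split; [exact: (tri _ _ y1 x1)|exact: (tri _ _ y2 x2)|exact: (tri _ _ y3 x3)].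
Qed.

Lemma measurable_eball x r : measurable (eball x r).
Proof. by apply: open_measurable_E3; exact: open_eball. Qed.

Lemma eball_finite x r : (leb3 (eball x r) < +oo)%E.
Proof.
have [m ym] := eball_box x r.
pose I := `](- m)%R, m[%classic : set R.
have mI : measurable I by exact: measurable_itv.
have sub : eball x r `<=` (I `*` I) `*` I.
  by move=> y /ym[y1 y2 y3]; split; [split|]; rewrite /I /= in_itv /= -ltr_norml.
apply: le_lt_trans (le_measure _ _ _ sub) _; rewrite ?inE.
- exact: measurable_eball.
- by apply: measurableX => //; exact: measurableX.
have If : (sleb1 R I < +oo)%E.
  rewrite /= /I lebesgue_measure_itv/=.
  by case: ifP => _; rewrite ?ltry// -EFinD ltry.
have Ifin : sleb1 R I \is a fin_num by rewrite ge0_fin_numE.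
rewrite [X in (X < _)%E](product_measure1E (sleb2 R) (sleb1 R)) //; last exact: measurableX.
rewrite [X in (X * _ < _)%E](product_measure1E (sleb1 R) (sleb1 R)) //.
have fin3 (s t v : \bar R) : s \is a fin_num -> t \is a fin_num -> v \is a fin_num ->
    (s * t * v < +oo)%E by move=> /fineK<- /fineK<- /fineK<-; rewrite -!EFinM ltry.
exact: fin3.
Qed.

Lemma compact_measurable_E3 (K : set (E3 R)) : compact K -> measurable K.
Proof.
move=> cK; rewrite -(setCK K); apply: measurableC; apply: open_measurable_E3.
by apply: closed_openC; apply: compact_closed => //; exact: norm_hausdorff.
Qed.

Lemma enormN x : enorm (- x) = enorm x.
Proof. by rewrite /enorm /= !sqrrN. Qed.

Lemma enormZ r x : enorm (r *: x) = `|r| * enorm x.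
Proof.
rewrite /enorm /= !exprMn -!mulrDr sqrtrM ?sqr_ge0//.
by rewrite sqrtr_sqr.
Qed.

End Geometry.

Section Kernel.
Context (R : realType) (rho : E3 R -> R) (l : R).
Hypotheses (rhoP : mollifier rho) (l_gt0 : 0 < l).

(** With this kernel [sconv] is convertible to [smoothing rho l], so the results on convolutions
    apply to the coarse package as it stands. *)
Definition moll (v : E3 R) : R := l ^- 3 * rho (l^-1 *: v).

Lemma Cc_infty_moll : Cc_infty (eball 0 l) moll.
Proof.
have [[srho [crho rho1]] _ _ _] := rhoP.
split.
  apply: smoothZ; apply: (@smooth_affine R (E3 R) (E3 R) (fun v => l^-1 *: v) (fun v => l^-1 *: v)) => //.
    by move=> h v x; rewrite scalerDr !scalerA mulrC.
  exact: scaler_continuous.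
pose K := (fun v : E3 R => l *: v) @` closure [set x | rho x != 0].
have cK : compact K.
  apply: continuous_compact => //; apply: continuous_subspaceT; exact: scaler_continuous.
have sub : closure [set x | moll x != 0] `<=` K.
  rewrite closureE => x; apply; split.
    by apply: compact_closed => //; exact: norm_hausdorff.
  move=> v /= kv; exists (l^-1 *: v); last by rewrite scalerA divff ?gt_eqF// scale1r.
  by apply: subset_closure => /=; apply: contra kv => /eqP rv; rewrite /moll rv mulr0.
split; first by apply: (subclosed_compact _ cK sub); exact: closed_closure.
move=> x /sub[v /rho1/interior_subset]; rewrite /eball /= subr0 => v1 <-.
apply: open_nbhs_nbhs; split; first exact: open_eball.
by rewrite /eball /= subr0 enormZ gtr0_norm// gtr_pMr.
Qed.

End Kernel.

(** * Truncation to the good times *)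

Section Truncation.
Context (R : realType).
Local Notation leb3 := (sleb3 R).
Local Notation leb1 := (sleb1 R).
Local Notation leb4 := (sleb4 R).
Variables (B0 : set (E3 R)) (T0 T1 C : R) (u : vfield R) (p : spacetime R -> R).
Hypotheses (mB0 : measurable B0) (B0fin : (leb3 B0 < +oo)%E) (C0 : 0 <= C).
Let Q : set (spacetime R) := B0 `*` `]T0, T1[%classic.
Hypotheses (mu : forall i, measurable_fun Q (u i)) (mp : measurable_fun Q p).
Hypothesis uC : {ae leb1, forall t, T0 < t < T1 ->
  (\int[leb3]_(x in B0) (sqnorm u (x, t))%:E <= C%:E)%E}.
Hypothesis pL : (\int[leb4]_(z in Q) (`|p z| `^ (3 / 2))%:E < +oo)%E.

(* The a priori bounds hold only at almost every time. Cutting the fields off at the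
   exceptional times makes every slice integrable. *)
Definition good_time : set (measurableTypeR R) := [set t | [/\ T0 < t < T1,
  (\int[leb3]_(x in B0) (sqnorm u (x, t))%:E <= C%:E)%E &
  (\int[leb3]_(x in B0) `|p (x, t)|%:E < +oo)%E]].

Let mI : measurable `]T0, T1[%classic. Proof. exact: measurable_itv. Qed.
Let mQ : measurable Q. Proof. exact: measurableX. Qed.

Let m_sq : measurable_fun Q (sqnorm u).
Proof. by apply: measurable_sum => i; apply: measurable_funX; exact: mu. Qed.

Let Qslice (f : spacetime R -> R) t : T0 < t < T1 ->
  (\int[leb3]_(x in B0) (f (x, t))%:E = \int[leb3]_x (\1_Q (x, t) * f (x, t))%:E)%E.
Proof.
move=> tT; rewrite integral_mkcond; apply: eq_integral => x _.
rewrite patchE indicE; have [xB|xB] := boolP (x \in B0).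
  have -> : (x, t) \in Q by rewrite inE; split; [rewrite inE in xB|rewrite /= in_itv].
  by rewrite mul1r.
have -> : ((x, t) \in Q) = false.
  by apply/negP; rewrite inE => -[/= xB' _]; move/negP: xB; apply; rewrite inE.
by rewrite mul0r.
Qed.

Let m_slice (f : spacetime R -> R) : measurable_fun Q f -> (forall z, 0 <= f z) ->
  measurable_fun setT (fun t => (\int[leb3]_x (\1_Q (x, t) * f (x, t))%:E)%E).
Proof.
move=> mf f0.
have := @measurable_fun_fubini_tonelli_G _ _ _ _ _ leb3 (fun z : E3 R * R => (\1_Q z * f z)%:E).
apply; first by apply/measurable_EFinP; exact: measurable_indicM.
by move=> z; rewrite lee_fin mulr_ge0.
Qed.

Let sq0 z : 0 <= sqnorm u z. Proof. by apply: sumr_ge0 => i _; exact: sqr_ge0. Qed.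

Let mabsp : measurable_fun Q (fun z => `|p z|).
Proof. exact: measurableT_comp. Qed.

(** Tonelli makes the slice integrals measurable in time, and [good_time] is cut out by bounds on
    them. Measurability of the truncated fields depends on it. *)
Lemma measurable_good_time : measurable good_time.
Proof.
have -> : good_time = `]T0, T1[%classic `&`
    ((fun t => \int[leb3]_x (\1_Q (x, t) * sqnorm u (x, t))%:E)%E @^-1` `]-oo, C%:E]%classic) `&`
    ((fun t => \int[leb3]_x (\1_Q (x, t) * `|p (x, t)|)%:E)%E @^-1` `]-oo, +oo%E[%classic).
  apply/seteqP; split => t /=; rewrite !in_itv /=.
    move=> [tT h1 h2]; rewrite -(Qslice (sqnorm u) tT) -(Qslice (fun z => `|p z|) tT).
    by rewrite tT h1 h2.
  move=> [[tT]]; rewrite -(Qslice (sqnorm u) tT) -(Qslice (fun z => `|p z|) tT) => h1 h2.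
  by split.
have m1 := m_slice m_sq sq0.
have m2 := m_slice mabsp (fun z => normr_ge0 (p z)).
apply: measurableI; first apply: measurableI => //.
- by rewrite -[X in measurable X]setTI; apply: m1 => //; exact: emeasurable_itv.
- by rewrite -[X in measurable X]setTI; apply: m2 => //; exact: emeasurable_itv.
Qed.

Let Qfin : (leb4 Q < +oo)%E.
Proof.
rewrite [X in (X < _)%E](product_measure1E leb3 leb1) //.
have f1 : leb3 B0 \is a fin_num by rewrite ge0_fin_numE.
have f2 : leb1 `]T0, T1[%classic \is a fin_num.
  rewrite ge0_fin_numE//= lebesgue_measure_itv/=.
  by case: ifP => _; rewrite ?ltry// -EFinD ltry.
have fin2 (s t : \bar R) : s \is a fin_num -> t \is a fin_num -> (s * t < +oo)%E.
  by move=> /fineK<- /fineK<-; rewrite -EFinM ltry.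
exact: fin2.
Qed.

Lemma powR_32_ge (x : R) : 0 <= x -> x <= 1 + x `^ (3 / 2).
Proof.
move=> x0; have [x1|x1] := leP x 1.
  by rewrite (le_trans x1)// lerDl powR_ge0.
rewrite (@le_trans _ _ (x `^ (3 / 2)))//; last by rewrite lerDr.
rewrite -{1}(powRr1 x0); apply: ler_powR; first exact: ltW.
by lra.
Qed.

(** On the set [Q] of finite measure [L^{3/2}] embeds into [L^1], through [|p| <= 1 + |p|^{3/2}]. *)
Lemma p_integrable : rintegrable leb4 (fun z => \1_Q z * p z).
Proof.
apply: (@rintegrable_le _ _ R leb4 _ (fun z => \1_Q z + \1_Q z * (`|p z| `^ (3 / 2)))).
- exact: measurable_indicM.
- apply: rintegrableD; first exact: rintegrable_indic.
  have [h _] := @rintegrable_indicM _ _ R leb4 _ (fun z => `|p z| `^ (3 / 2)) mQ.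
  apply: h; apply/integrableP; split.
    apply/measurable_EFinP; apply: (measurableT_comp (measurable_powR _)); exact: mabsp.
  apply: le_lt_trans pL; rewrite le_eqVlt; apply/orP; left; apply/eqP.
  by apply: eq_integral => z _ /=; rewrite ger0_norm// powR_ge0.
- move=> z; rewrite indicE; have [_|_] := boolP (z \in Q); last by rewrite !mul0r normr0 addr0.
  by rewrite !mul1r; exact: powR_32_ge.
Qed.

Lemma ae_good_time : {ae leb1, forall t, T0 < t < T1 -> good_time t}.
Proof.
have pi := ae_integrable2 p_integrable.
apply: ae_imply (ae_and uC pi) => t [ut /integrableP[_ pt]] tT.
split => //; first exact: ut.
rewrite (Qslice (fun z => `|p z|) tT); apply: le_lt_trans pt; rewrite le_eqVlt; apply/orP; left; apply/eqP.
by apply: eq_integral => x _ /=; rewrite normrM indicE normr_nat.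
Qed.

Definition trunc (f : spacetime R -> R) (z : spacetime R) := \1_(B0 `*` good_time) z * f z.

Lemma good_timeT t : good_time t -> T0 < t < T1. Proof. by case. Qed.

Let mBG : measurable (B0 `*` good_time).
Proof. by apply: measurableX => //; exact: measurable_good_time. Qed.

Lemma measurable_trunc f : measurable_fun Q f -> measurable_fun setT (trunc f).
Proof.
move=> mf; apply: measurable_indicM => //.
apply: measurable_funS mf => // -[x t] [/= Bx /good_timeT tT].
by split => //=; rewrite in_itv.
Qed.

Lemma trunc_off f x t : ~ good_time t -> trunc f (x, t) = 0.
Proof. by move=> gt; rewrite /trunc indicE memNset ?mul0r// => -[]. Qed.

Lemma trunc_good f x t : good_time t -> trunc f (x, t) = \1_B0 x * f (x, t).
Proof.
move=> gt; rewrite /trunc !indicE; congr ((nat_of_bool _)%:R * _).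
by apply/idP/idP; rewrite !inE; [case|].
Qed.

Let N (t : R) : R := fine (leb3 B0) + C.

Let N0 t : 0 <= N t. Proof. by rewrite addr_ge0// fine_ge0. Qed.

Let sq_slice t : rintegrable leb3 (fun y => trunc (sqnorm u) (y, t)) /\
  \int[leb3]_y trunc (sqnorm u) (y, t) <= C.
Proof.
have [gt|gt] := pselect (good_time t); last first.
  have -> : (fun y => trunc (sqnorm u) (y, t)) = fun=> 0.
    by apply/funext => y; exact: trunc_off.
  by rewrite rintegral0; split => //; exact: rintegrable0.
have E : (\int[leb3]_y (trunc (sqnorm u) (y, t))%:E =
    \int[leb3]_(x in B0) (sqnorm u (x, t))%:E)%E.
  rewrite [RHS]integral_mkcond; apply: eq_integral => y _; rewrite trunc_good// patchE indicE.
  by case: (y \in B0); rewrite ?mul1r ?mul0r.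
have [_ gC _] := gt.
have mt : measurable_fun setT (fun y => trunc (sqnorm u) (y, t)).
  by apply: measurable_fun_pair1; exact: measurable_trunc.
split.
  apply/integrableP; split; first exact/measurable_EFinP.
  rewrite (le_lt_trans _ (ltry C))// (le_trans _ gC)// -E le_eqVlt; apply/orP; left; apply/eqP.
  by apply: eq_integral => y _ /=; rewrite ger0_norm// mulr_ge0.
rewrite /Rintegral E -lee_fin fineK//.
by rewrite fin_numE; apply/andP; split; rewrite -?ltNye -?ltey;
  [rewrite (lt_le_trans (ltNyr 0))// integral_ge0// => x _; rewrite lee_fin|exact: le_lt_trans gC (ltry C)].
Qed.

Let slice_bound f t : measurable_fun Q f ->
  (forall z, `|trunc f z| <= \1_B0 z.1 + trunc (sqnorm u) z) ->
  rintegrable leb3 (fun y => trunc f (y, t)) /\ \int[leb3]_y `|trunc f (y, t)| <= N t.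
Proof.
move=> mf fb; have [si sC] := sq_slice t.
have Bi : rintegrable leb3 (\1_B0 : E3 R -> R) by exact: rintegrable_indic.
have bi := rintegrableD Bi si.
have fi : rintegrable leb3 (fun y => trunc f (y, t)).
  apply: (rintegrable_le _ bi); last by move=> y; exact: fb.
  by apply: measurable_fun_pair1; exact: measurable_trunc.
split => //.
apply: (le_trans (ler_rintegral (rintegrable_norm fi) bi (fun y => fb (y, t)))).
rewrite rintegralD//; apply: lerD => //.
by rewrite /Rintegral integral_indic// setIT.
Qed.

Let sq_coord i z : u i z ^+ 2 <= sqnorm u z.
Proof.
rewrite /sqnorm (bigD1 i)//= lerDl; apply: sumr_ge0 => j _; exact: sqr_ge0.
Qed.

Let sq_mul i j z : `|u i z * u j z| <= sqnorm u z.
Proof.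
rewrite normrM; have [ij|ij] := leP `|u i z| `|u j z|.
  by rewrite (le_trans _ (sq_coord j z))// -(real_normK (num_real (u j z))) expr2 ler_wpM2r.
by rewrite (le_trans _ (sq_coord i z))// -(real_normK (num_real (u i z))) expr2 ler_wpM2l// ltW.
Qed.

(** By [|u_i| <= 1 + |u|^2], the mass of every slice is at most the measure of [B0] plus the energy
    bound [C]. *)
Lemma trunc_u_tame i : tame (trunc (u i)) N.
Proof.
have b z : `|trunc (u i) z| <= \1_B0 z.1 + trunc (sqnorm u) z.
  rewrite /trunc !indicE; have [|_] := boolP (z \in _); last first.
    by rewrite !mul0r normr0 addr0 ler0n.
  rewrite inE => -[/= zB _]; rewrite mem_set// !mul1r.
  have := sq_coord i z; rewrite -real_normK ?num_real// => h.
  have [x1|x1] := leP `|u i z| 1; first by rewrite (le_trans x1)// lerDl.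
  apply: le_trans (_ : `|u i z| ^+ 2 <= _); first by rewrite expr2 ler_peMl// ltW.
  by rewrite (le_trans h)// lerDr.
by split; [exact: measurable_trunc|move=> t; exact: (slice_bound t (mu i) b).1
  |move=> t; exact: (slice_bound t (mu i) b).2].
Qed.

Lemma trunc_mul f g z : trunc f z * trunc g z = trunc (fun z => f z * g z) z.
Proof.
by rewrite /trunc indicE; case: (z \in _); rewrite ?mul1r ?mul0r.
Qed.

Lemma trunc_uu_tame i j : tame (fun z => trunc (u i) z * trunc (u j) z) N.
Proof.
have -> : (fun z => trunc (u i) z * trunc (u j) z) = trunc (fun z => u i z * u j z).
  by apply/funext => z; exact: trunc_mul.
have b z : `|trunc (fun z => u i z * u j z) z| <= \1_B0 z.1 + trunc (sqnorm u) z.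
  rewrite /trunc !indicE; have [|_] := boolP (z \in _); last first.
    by rewrite !mul0r normr0 addr0 ler0n.
  rewrite inE => -[/= zB _]; rewrite mem_set// !mul1r.
  by rewrite (le_trans (sq_mul i j z))// lerDr.
have m : measurable_fun Q (fun z => u i z * u j z) by exact: measurable_funM.
by split; [exact: measurable_trunc|move=> t; exact: (slice_bound t m b).1
  |move=> t; exact: (slice_bound t m b).2].
Qed.

Definition pressure_mass t := \int[leb3]_y `|trunc p (y, t)|.

Lemma trunc_p_tame : tame (trunc p) pressure_mass.
Proof.
split => //; first exact: measurable_trunc.
move=> t; have [gt|gt] := pselect (good_time t); last first.
  have -> : (fun y => trunc p (y, t)) = fun=> 0 by apply/funext => y; exact: trunc_off.
  exact: rintegrable0.
have [_ _ gp] := gt; apply/integrableP; split.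
  by apply/measurable_EFinP; apply: measurable_fun_pair1; exact: measurable_trunc.
apply: le_lt_trans gp; rewrite le_eqVlt [in X in _ == X]integral_mkcond; apply/orP; left; apply/eqP.
apply: eq_integral => y _ /=; rewrite trunc_good// normrM indicE normr_nat patchE.
by case: (y \in B0); rewrite ?mul1r ?mul0r.
Qed.

Lemma pressure_mass_integrable : rintegrable leb1 pressure_mass.
Proof.
have pi : rintegrable leb4 (fun z => `|trunc p z|).
  apply: rintegrable_norm; apply: (rintegrable_le _ (rintegrable_norm p_integrable)).
    exact: measurable_trunc.
  move=> z; rewrite /trunc !normrM ler_wpM2r// !indicE !normr_nat ler_nat.
  have [|//] := boolP (z \in B0 `*` good_time); rewrite inE => -[zB /good_timeT zT].
  by rewrite mem_set//; split => //=; rewrite in_itv.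
have mpi := rintegrable_measurable pi.
have mE : measurable_fun setT (EFin \o (fun z => `|trunc p z|)) by exact/measurable_EFinP.
have poo := (integrable21ltyP leb3 leb1 mE).1 pi.
apply/integrableP; split.
  apply/measurable_EFinP.
  exact: (@measurable_Rintegral1 _ _ _ _ _ leb3 (fun z => `|trunc p z|)).
apply: le_lt_trans poo; rewrite le_eqVlt; apply/orP; left; apply/eqP.
apply: eq_integral => t _ /=.
have [_ ti _] := trunc_p_tame.
rewrite ger0_norm; last exact: Rintegral_ge0.
rewrite /pressure_mass fineK; last exact: integrable_fin_num (rintegrable_norm (ti t)).
by apply: eq_integral => y _ /=; rewrite normr_id.
Qed.

End Truncation.

(** * Test functions that are products of a kernel and a function of time *)

Section TestFunction.
Context (R : realType).
Local Notation leb3 := (sleb3 R).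
Local Notation leb1 := (sleb1 R).
Local Notation leb4 := (sleb4 R).

(** Homogeneity in the direction, read off on the line through [x]. The case [c = -1] handles the
    reflection [x - y]. *)
Lemma derive_scale_dir (V : normedModType R) (f : V -> R) (c : R) (v x : V) :
  smooth f -> 'D_(c *: v) f x = c * 'D_v f x.
Proof.
move=> sf.
have AL w h s t : (h *: s + t : R^o) *: w + x = h *: (s *: w) + (t *: w + x) :> V.
  by rewrite scalerDl scalerA addrA.
have cA w : continuous (fun h : R => h *: w + x : V).
  by move=> h; apply: cvgD; [exact: scalel_continuous|exact: cvg_cst].
have sg : smooth (fun h : R => f (h *: v + x)).
  exact (@smooth_affine R R^o V (fun h => h *: v + x) (fun h => h *: v) (AL v) f (cA v) sf).
have E (w : V) : 'D_1 (fun h : R => f (h *: w + x)) 0 = 'D_w f x.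
  have := @derive_affine R R^o V (fun h => h *: w + x) (fun h => h *: w) (AL w) f 1 0.
  by rewrite scale1r scale0r add0r.
rewrite -(E (c *: v)) -(E v).
have -> : (fun h : R => f (h *: (c *: v) + x)) = (fun h : R => f ((c * (h - 0)) *: v + x)).
  by apply/funext => h; rewrite subr0 scalerA mulrC.
by rewrite (derive_scale_line 0 c 0 sg) subr0 mulr0.
Qed.

Variables (B0 : set (E3 R)) (T0 T1 l : R) (k : E3 R -> R) (x : E3 R) (th : R -> R).
Hypotheses (oB : open B0) (kl : Cc_infty (eball 0 l) k) (xB : eball x l `<=` B0).
Hypothesis thT : Cc_infty `]T0, T1[%classic th.

(** The reflected kernel centred at a fixed [x] turns spatial integration into a convolution
    evaluated at [x], leaving an identity in time alone. *)
Definition testfun (kk : E3 R -> R) (h : R -> R) (z : spacetime R) : R := kk (x - z.1) * h z.2.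

Lemma smooth_reflect (kk : E3 R -> R) : smooth kk -> smooth (fun y : E3 R => kk (x - y)).
Proof.
move=> sk; apply: (@smooth_affine R (E3 R) (E3 R) (fun y => x - y) (fun v => - v)) => //.
  by move=> h v y; rewrite opprD addrCA scalerN.
exact: continuous_subl.
Qed.

Lemma derive_reflect (kk : E3 R -> R) v y : smooth kk ->
  'D_v (fun y : E3 R => kk (x - y)) y = - 'D_v kk (x - y).
Proof.
move=> sk.
rewrite (@derive_affine R (E3 R) (E3 R) (fun y => x - y) (fun v => - v)).
  by have := derive_scale_dir (-1) v (x - y) sk; rewrite scaleN1r mulN1r.
by move=> h w z; rewrite opprD addrCA scalerN.
Qed.

Lemma smooth_testfun (kk : E3 R -> R) h : smooth kk -> smooth h -> smooth (testfun kk h).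
Proof.
move=> sk sh; apply: smoothM.
  apply: (@smooth_affine R (spacetime R) (E3 R) fst fst _ (fun y => kk (x - y))) => //.
    by move=> z; exact: cvg_fst.
  exact: smooth_reflect.
apply: (@smooth_affine R (spacetime R) R^o snd snd) => //.
by move=> z; exact: cvg_snd.
Qed.

Lemma dtime_testfun (kk : E3 R -> R) h z : smooth h ->
  dtime (testfun kk h) z = testfun kk ('D_1 h) z.
Proof.
case: z => y s sh; rewrite dtimeE /testfun /=.
by apply: (derivable_cmul _ _).2; exact: smooth_derivable.
Qed.

Lemma dspace_testfun (kk : E3 R -> R) h j : smooth kk ->
  dspace j (testfun kk h) = (fun z => - testfun ('D_(ebasis R j) kk) h z).
Proof.
move=> sk; apply/funext => -[y s]; rewrite dspaceE /testfun /=.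
have d1 : derivable (fun y : E3 R => kk (x - y)) y (ebasis R j).
  by apply: smooth_derivable; exact: smooth_reflect.
have d2 : derivable (fun _ : E3 R => h s) y (ebasis R j) by exact: derivable_cst.
rewrite (deriveM d1 d2) derive_cst scaler0 add0r derive_reflect// scalerN.
by congr (- _); exact: mulrC.
Qed.

Lemma laplacian_testfun (kk : E3 R -> R) h z : smooth kk ->
  laplacian (testfun kk h) z =
  \sum_j testfun ('D_(ebasis R j) ('D_(ebasis R j) kk)) h z.
Proof.
move=> sk; apply: eq_bigr => j _; rewrite (dspace_testfun _ _ sk).
have sD : smooth ('D_(ebasis R j) kk) by exact: smooth_derive.
have -> : (fun z => - testfun ('D_(ebasis R j) kk) h z) =
    testfun (fun v => -1 * 'D_(ebasis R j) kk v) h.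
  by apply/funext => w; rewrite /testfun mulN1r mulNr.
rewrite dspace_testfun; last exact: smoothZ.
rewrite /testfun -mulNr; congr (_ * _).
have dD : derivable ('D_(ebasis R j) kk) (x - z.1) (ebasis R j) by exact: smooth_derivable.
have dc : derivable (fun _ : E3 R => -1 : R) (x - z.1) (ebasis R j) by exact: derivable_cst.
by rewrite (deriveM dc dD) derive_cst scaler0 addr0 scaleN1r opprK.
Qed.

Lemma Cc_testfun : Cc_infty (B0 `*` `]T0, T1[%classic) (testfun k th).
Proof.
have [sk [ck kB]] := kl; have [st [ct tT]] := thT.
split; first exact: smooth_testfun.
pose K1 := (fun v : E3 R => x - v) @` closure [set v | k v != 0].
have cK1 : compact K1.
  by apply: continuous_compact => //; apply: continuous_subspaceT; exact: continuous_subl.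
have cK : compact (K1 `*` closure [set s | th s != 0]) by exact: compact_setX.
have sub : closure [set z | testfun k th z != 0] `<=` K1 `*` closure [set s | th s != 0].
  rewrite closureE => z; apply; split.
    by apply: compact_closed => //; exact: norm_hausdorff.
  move=> w /=; rewrite mulf_eq0 negb_or => /andP[kw tw]; split => /=.
    by exists (x - w.1); [exact: subset_closure|rewrite subKr].
  exact: subset_closure.
split; first by apply: (subclosed_compact _ cK sub); exact: closed_closure.
move=> [y s] /sub[/= [v /kB/interior_subset vl <-] /tT/interior_subset zT].
apply: open_nbhs_nbhs; split.
  have -> : B0 `*` `]T0, T1[%classic = (fst @^-1` B0) `&` (snd @^-1` `]T0, T1[%classic) :> set (spacetime R).
    by [].
  apply: openI.
    have /continuousP : continuous (fst : spacetime R -> E3 R) by move=> w; exact: cvg_fst.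
    by apply.
  have /continuousP : continuous (snd : spacetime R -> R) by move=> w; exact: cvg_snd.
  by apply; exact: itv_open.
split => //=; apply: xB; move: vl; rewrite /eball /= subr0 => vl.
by rewrite addrAC subrr add0r enormN.
Qed.

Lemma Rintegral_testfun D (kk : E3 R -> R) f N (h : R -> R) :
  Cc_infty D kk -> tame f N -> measurable_fun setT h ->
  rintegrable leb1 (fun t => `|h t| * N t) ->
  rintegrable leb4 (fun z => testfun kk h z * f z) /\
  \int[leb4]_z (testfun kk h z * f z) = \int[leb1]_s (h s * sconv kk f (x, s)).
Proof.
move=> kkD tf mh hN; have [mf fi fN] := tf; have [C kC] := Cc_infty_bounded kkD.
have C0 : 0 <= C by apply: le_trans (kC 0).
have sl t : rintegrable leb3 (fun y => h t * (kk (x - y) * f (y, t))).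
  by apply: rintegrableZl; exact (rintegrable_kernel kkD x (fi t)).
have E t : (fun y => testfun kk h (y, t) * f (y, t)) = (fun y => h t * (kk (x - y) * f (y, t))).
  by apply/funext => y; rewrite /testfun /= mulrAC mulrC.
have ti : rintegrable leb4 (fun z => testfun kk h z * f z).
  apply: (@rintegrable_prod21 _ _ _ _ _ leb3 leb1 _ (fun t => C * (`|h t| * N t))).
  - apply: measurable_funM => //; apply: measurable_funM.
      have mk := measurable_reflect x (smooth_continuous kkD.1).
      exact: (measurableT_comp mk measurable_fst).
    exact: (measurableT_comp mh measurable_snd).
  - by move=> t /=; rewrite E.
  - move=> t.
    have -> : (fun y : E3 R => `|testfun kk h (y, t) * f (y, t)|) =
        (fun y => `|h t| * `|kk (x - y) * f (y, t)|).
      by apply/funext => y; rewrite -normrM /testfun /= mulrAC [h t * _]mulrC.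
    rewrite rintegralZl; last by apply: rintegrable_norm; exact (rintegrable_kernel kkD x (fi t)).
    rewrite mulrCA ler_wpM2l//.
    apply: (@le_trans _ _ (C * \int[leb3]_y `|f (y, t)|)); last by rewrite ler_wpM2l.
    rewrite -rintegralZl; last exact: rintegrable_norm.
    apply: ler_rintegral.
    + by apply: rintegrable_norm; exact (rintegrable_kernel kkD x (fi t)).
    + exact/rintegrableZl/rintegrable_norm.
    + by move=> y; rewrite normrM ler_wpM2r.
  - exact: rintegrableZl.
split => //; rewrite (Rintegral_prod21 ti); apply: eq_Rintegral => t _.
rewrite -rintegralZl; last exact (rintegrable_kernel kkD x (fi t)).
by rewrite E.
Qed.

End TestFunction.

Section TimeIntegrable.
Context (R : realType).
Local Notation leb3 := (sleb3 R).
Local Notation leb1 := (sleb1 R).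
Variables (D : set (E3 R)) (k : E3 R -> R) (f : spacetime R -> R) (N : R -> R) (T0 T1 : R).
Hypotheses (kD : Cc_infty D k) (tf : tame f N).
Hypothesis off : forall y t, ~ (T0 < t < T1) -> f (y, t) = 0.
Let I : set R := `]T0, T1[%classic.
Hypothesis iN : rintegrable leb1 (fun t => \1_I t * N t).

Lemma sconv_off x t : ~ (T0 < t < T1) -> sconv k f (x, t) = 0.
Proof.
move=> tT; rewrite -[RHS](rintegral0 leb3); apply: eq_Rintegral => y _.
by rewrite /= off// mulr0.
Qed.

Lemma sconv_time_integrable : exists C, forall x,
  rintegrable leb1 (fun s => sconv k f (x, s)) /\
  \int[leb1]_s `|sconv k f (x, s)| <= C.
Proof.
have [C [C0 fC]] := tame_conv_bound kD tf.
have b x s : `|sconv k f (x, s)| <= C * (\1_I s * N s).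
  rewrite indicE; have [_|] := boolP (s \in I); first by rewrite mul1r; exact: fC.
  by rewrite notin_setE /I /= in_itv /= => /sconv_off ->; rewrite normr0 mul0r mulr0.
have iC : rintegrable leb1 (fun s => C * (\1_I s * N s)) by exact: rintegrableZl.
exists (\int[leb1]_s (C * (\1_I s * N s))) => x.
have si : rintegrable leb1 (fun s => sconv k f (x, s)).
  apply: (rintegrable_le _ iC) => //.
  apply: (measurable_fun_pair2 (f := sconv k f)).
  exact: (tame_conv_measurable kD tf).
by split => //; apply: ler_rintegral => //; exact: rintegrable_norm.
Qed.

Lemma testfun_weight (h : R -> R) : measurable_fun setT h -> (exists C, forall s, `|h s| <= C) ->
  (forall s, ~ (T0 < s < T1) -> h s = 0) -> rintegrable leb1 (fun t => `|h t| * N t).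
Proof.
move=> mh [C hC] h0.
have -> : (fun t => `|h t| * N t) = (fun t => `|h t| * (\1_I t * N t)).
  apply/funext => t; rewrite indicE; have [_|] := boolP (t \in I); first by rewrite mul1r.
  by rewrite notin_setE /I /= in_itv /= => /h0 ->; rewrite normr0 !mul0r.
apply: (@rintegrable_bdM _ _ R leb1 C) => //; first exact: measurableT_comp.
by move=> s; rewrite normr_id.
Qed.

End TimeIntegrable.

(** * Time evolution of the coarse velocity at a fixed point *)

Section Evolution.
Context (R : realType).
Local Notation leb3 := (sleb3 R).
Local Notation leb1 := (sleb1 R).
Local Notation leb4 := (sleb4 R).
Variables (B0 : set (E3 R)) (T0 T1 C : R) (u : vfield R) (p : spacetime R -> R).
Hypotheses (oB0 : open B0) (B0fin : (leb3 B0 < +oo)%E) (C0 : 0 <= C).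
Let Q : set (spacetime R) := B0 `*` `]T0, T1[%classic.
Hypotheses (mu : forall i, measurable_fun Q (u i)) (mp : measurable_fun Q p).
Hypothesis uC : {ae leb1, forall t, T0 < t < T1 ->
  (\int[leb3]_(x in B0) (sqnorm u (x, t))%:E <= C%:E)%E}.
Hypothesis pL : (\int[leb4]_(z in Q) (`|p z| `^ (3 / 2))%:E < +oo)%E.
Hypothesis wcont : weakly_continuous B0 T0 T1 u.
Hypothesis NS : NS_distributional B0 T0 T1 u p.
Variables (H : R -> R) (l : R) (k : E3 R -> R).
Hypotheses (smoothH : smooth H) (DH0 : forall s, 0 <= 'D_1 H s).
Hypotheses (HN1 : forall s, s <= -1 -> H s = 0) (H1 : forall s, 1 <= s -> H s = 1).
Hypothesis H01 : forall s, 0 <= H s <= 1.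
Hypothesis kl : Cc_infty (eball 0 l) k.

Let mB0 : measurable B0. Proof. exact: open_measurable_E3. Qed.

Local Notation good := (good_time B0 T0 T1 C u p).
Local Notation tr := (trunc B0 T0 T1 C u p).
Local Notation q := (pressure_mass B0 T0 T1 C u p).

Definition tu : vfield R := fun i => tr (u i).
Definition tp : spacetime R -> R := tr p.
Definition mass : R := fine (leb3 B0) + C.

Lemma tu_tame i : tame (tu i) (fun=> mass).
Proof. exact: trunc_u_tame. Qed.
Lemma tuu_tame i j : tame (fun z => tu i z * tu j z) (fun=> mass).
Proof. exact: trunc_uu_tame. Qed.
Lemma tp_tame : tame tp q.
Proof. exact: trunc_p_tame. Qed.
Lemma q_int : rintegrable leb1 q.
Proof. exact: pressure_mass_integrable. Qed.

Let tr_off f y t : ~ (T0 < t < T1) -> tr f (y, t) = 0.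
Proof. by move=> tT; apply: trunc_off => -[]. Qed.

Let off_u i y t : ~ (T0 < t < T1) -> tu i (y, t) = 0. Proof. exact: tr_off. Qed.
Let off_uu i j y t : ~ (T0 < t < T1) -> tu i (y, t) * tu j (y, t) = 0.
Proof. by move=> /off_u ->; rewrite mul0r. Qed.
Let off_p y t : ~ (T0 < t < T1) -> tp (y, t) = 0. Proof. exact: tr_off. Qed.

Let iM : rintegrable leb1 (fun t => \1_(`]T0, T1[%classic : set R) t * mass).
Proof.
under eq_fun do rewrite mulrC.
apply: rintegrableZl; apply: rintegrable_indic => //=; rewrite lebesgue_measure_itv/=.
by case: ifP => _; rewrite ?ltry// -EFinD ltry.
Qed.

Let iq : rintegrable leb1 (fun t => \1_(`]T0, T1[%classic : set R) t * q t).
Proof.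
apply: (@rintegrable_bdM _ _ R leb1 1) => //; last exact: q_int.
by move=> s; rewrite indicE normr_natb_le1.
Qed.

Variable x : E3 R.
Hypothesis xB : eball x l `<=` B0.

(** At a good time truncation alters the field only outside [B0], which a kernel of radius [l]
    centred at [x] does not see. *)
Lemma sconv_trunc kk f t : Cc_infty (eball 0 l) kk -> good t ->
  sconv kk f (x, t) = sconv kk (tr f) (x, t).
Proof.
move=> [_ [_ kkB]] gt; apply: eq_Rintegral => y _ /=.
have [yB|yB] := boolP (y \in B0).
  by rewrite trunc_good// indicE yB mul1r.
have [/eqP ->|k0] := boolP (kk (x - y) == 0); first by rewrite !mul0r.
exfalso; move/negP: yB; apply; rewrite inE; apply: xB.
have : eball 0 l (x - y) by apply: interior_subset; apply: kkB; exact: subset_closure.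
by rewrite /eball /= subr0 -enormN opprB.
Qed.

Lemma sconv_bad kk f t : ~ good t -> sconv kk (tr f) (x, t) = 0.
Proof.
move=> gt; rewrite -[RHS](rintegral0 leb3); apply: eq_Rintegral => y _.
by rewrite /= trunc_off// mulr0.
Qed.

(** The convolution at [x] pairs the slice with the fixed square integrable function [kk (x - y)] on
    the compact set [x - supp kk], so weak continuity applies. *)
Lemma sconv_continuous kk i t : Cc_infty (eball 0 l) kk -> T0 < t < T1 ->
  {for t, continuous (fun s : R => sconv kk (u i) (x, s))}.
Proof.
move=> kkl tT; have [skk [ck kB]] := kkl.
pose K := (fun v : E3 R => x - v) @` closure [set v | kk v != 0].
have cK : compact K.
  by apply: continuous_compact => //; apply: continuous_subspaceT; exact: continuous_subl.
have mK := compact_measurable_E3 cK.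
have KB : K `<=` B0.
  move=> _ [v /kB/interior_subset + <-]; rewrite /eball /= subr0 => vl.
  by apply: xB; rewrite /eball /= addrAC subrr add0r enormN.
have [_ wc] := wcont cK KB.
have mw : measurable_fun setT (fun y : E3 R => kk (x - y)).
  by apply: measurable_reflect; exact: smooth_continuous.
have w2 : (\int[leb3]_(y in K) (kk (x - y) ^+ 2)%:E < +oo)%E.
  have [Ck kkC] := Cc_infty_bounded kkl.
  apply: (@le_lt_trans _ _ (\int[leb3]_(y in K) (cst (Ck ^+ 2)%:E y))%E).
    apply: ge0_le_integral => //.
    - by move=> y _; rewrite lee_fin sqr_ge0.
    - apply/measurable_EFinP; apply: measurable_funX.
      exact: measurable_funS mw.
    - move=> y _; rewrite lee_fin -(real_normK (num_real (kk _))) lerXn2r// ?nnegrE//.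
      by rewrite (le_trans _ (kkC 0)).
  rewrite integral_cst//; apply: lte_mul_pinfty; rewrite ?lee_fin ?sqr_ge0//.
  by apply: le_lt_trans B0fin; apply: le_measure; rewrite ?inE.
have := wc i (fun y : E3 R => kk (x - y)) (measurable_funS measurableT (@subsetT _ K) mw) w2 t tT.
have -> // : (fun s : R => \int[Defs.leb3 R]_(y in K) (u i (y, s) * kk (x - y))) =
   (fun s : R => sconv kk (u i) (x, s)).
apply/funext => s; rewrite Rintegral_mkcond; apply: eq_Rintegral => y _ /=.
rewrite patchE; case: ifPn => [_|]; first exact: mulrC.
rewrite notin_setE => yK.
have -> : kk (x - y) = 0; last by rewrite mul0r.
apply: contrapT => /eqP k0; apply: yK; exists (x - y); last by rewrite subKr.
exact: subset_closure.
Qed.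

Local Notation cU := (cU k tu).
Local Notation cP := (cP k tp).
Local Notation cF := (cF k tu tp).
Let dk (v : E3 R) := Cc_infty_derive v kl.

Let cFE i s : cF i (x, s) =
  \sum_j sconv ('D_(ebasis R j) ('D_(ebasis R j) k)) (tu i) (x, s)
  - \sum_j sconv ('D_(ebasis R j) k) (fun z => tu i z * tu j z) (x, s)
  - sconv ('D_(ebasis R i) k) tp (x, s).
Proof.
rewrite /cF (dspace_cP kl tp_tame); congr (_ - _ - _); apply: eq_bigr => j _.
  by rewrite (dspace2_cU kl tu_tame).
by rewrite (dspace_cS kl tuu_tame).
Qed.

Let ti_u kk i : Cc_infty (eball 0 l) kk -> exists C', forall y,
    rintegrable leb1 (fun s => sconv kk (tu i) (y, s)) /\
    \int[leb1]_s `|sconv kk (tu i) (y, s)| <= C'.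
Proof. by move=> kkl; exact (sconv_time_integrable kkl (tu_tame i) (off_u i) iM). Qed.
Let ti_uu kk i j : Cc_infty (eball 0 l) kk -> exists C', forall y,
    rintegrable leb1 (fun s => sconv kk (fun z => tu i z * tu j z) (y, s)) /\
    \int[leb1]_s `|sconv kk (fun z => tu i z * tu j z) (y, s)| <= C'.
Proof. by move=> kkl; exact (sconv_time_integrable kkl (tuu_tame i j) (off_uu i j) iM). Qed.
Let ti_p kk : Cc_infty (eball 0 l) kk -> exists C', forall y,
    rintegrable leb1 (fun s => sconv kk tp (y, s)) /\
    \int[leb1]_s `|sconv kk tp (y, s)| <= C'.
Proof. by move=> kkl; exact (sconv_time_integrable kkl tp_tame off_p iq). Qed.

Let i_u kk i : Cc_infty (eball 0 l) kk -> rintegrable leb1 (fun s => sconv kk (tu i) (x, s)).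
Proof. by move=> /(ti_u i)[C' /(_ x)[]]. Qed.
Let i_uu kk i j : Cc_infty (eball 0 l) kk ->
  rintegrable leb1 (fun s => sconv kk (fun z => tu i z * tu j z) (x, s)).
Proof. by move=> /(ti_uu i j)[C' /(_ x)[]]. Qed.
Let i_p kk : Cc_infty (eball 0 l) kk -> rintegrable leb1 (fun s => sconv kk tp (x, s)).
Proof. by move=> /ti_p[C' /(_ x)[]]. Qed.

Lemma cF_integrable i : rintegrable leb1 (fun s => cF i (x, s)).
Proof.
under eq_fun do rewrite cFE.
apply: rintegrableB; last exact (i_p (dk _)).
by apply: rintegrableB; apply: rintegrable_sum => j;
  [exact (i_u i (Cc_infty_derive _ (dk _)))|exact (i_uu i j (dk _))].
Qed.

Section WithTestFunction.
Variable th : R -> R.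
Hypothesis thT : Cc_infty `]T0, T1[%classic th.

Let th_off s : ~ (T0 < s < T1) -> th s = 0.
Proof.
move=> sT; apply: contrapT => /eqP ths; apply: sT.
have [_ [_ thB]] := thT.
by have /thB/interior_subset : closure [set s | th s != 0] s by exact: subset_closure.
Qed.

Let dthT : Cc_infty `]T0, T1[%classic ('D_1 th). Proof. exact: Cc_infty_derive. Qed.

Let dth_off s : ~ (T0 < s < T1) -> 'D_1 th s = 0.
Proof.
move=> sT; apply: contrapT => /eqP ths; apply: sT.
have [_ [_ thB]] := dthT.
by have /thB/interior_subset : closure [set s | 'D_1 th s != 0] s by exact: subset_closure.
Qed.

Let mth : measurable_fun setT th.
Proof. by apply: continuous_measurable_fun; exact: (smooth_continuous thT.1). Qed.
Let mdth : measurable_fun setT ('D_1 th).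
Proof. by apply: continuous_measurable_fun; exact: (smooth_continuous dthT.1). Qed.
Let th_bd : exists C, forall s, `|th s| <= C. Proof. exact: Cc_infty_bounded thT. Qed.
Let dth_bd : exists C, forall s, `|'D_1 th s| <= C. Proof. exact: Cc_infty_bounded dthT. Qed.

Let w_M : rintegrable leb1 (fun t => `|th t| * mass).
Proof. exact (testfun_weight iM mth th_bd th_off). Qed.
Let w_dM : rintegrable leb1 (fun t => `|'D_1 th t| * mass).
Proof. exact (testfun_weight iM mdth dth_bd dth_off). Qed.
Let w_q : rintegrable leb1 (fun t => `|th t| * q t).
Proof. exact (testfun_weight iq mth th_bd th_off). Qed.

Local Notation tf := (testfun x).

(** Identifies [cF i] as the weak time derivative of [cU i] at [x], by testing the momentum equation
    with [testfun x k th]. The truncated fields may be inserted because almost every time in []T0,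
    T1[] is good. *)
Lemma momentum_test i : \int[leb1]_s ('D_1 th s * cU i (x, s) + th s * cF i (x, s)) = 0.
Proof.
have [NS1 _] := NS.
have := NS1 i (tf k th) (Cc_testfun oB0 kl xB thT).
have sk : smooth k by case: kl.
have sth : smooth th by case: thT.
pose D j := 'D_(ebasis R j) k.
pose DD j := 'D_(ebasis R j) ('D_(ebasis R j) k).
have [Ai AE] := Rintegral_testfun x kl (tu_tame i) mdth w_dM.
have B j := Rintegral_testfun x (Cc_infty_derive (ebasis R j) (dk (ebasis R j))) (tu_tame i) mth w_M.
have F j := Rintegral_testfun x (dk (ebasis R j)) (tuu_tame i j) mth w_M.
have [Gi GE] := Rintegral_testfun x (dk (ebasis R i)) tp_tame mth w_q.
(* Each spatial derivative of the reflected kernel brings a sign, so the Laplacian keeps its sign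
   while convection and pressure change theirs; these are the signs in [cF]. *)
pose E z := tf k ('D_1 th) z * tu i z + \sum_j tf (DD j) th z * tu i z
  - \sum_j tf (D j) th z * (tu i z * tu j z) - tf (D i) th z * tp z.
have -> : \int[Defs.leb4 R]_(z in B0 `*` `]T0, T1[%classic)
   (u i z * (dtime (tf k th) z + laplacian (tf k th) z)
    + (\sum_j u i z * u j z * dspace j (tf k th) z) + p z * dspace i (tf k th) z) =
   \int[leb4]_z E z.
  rewrite (rintegral_indicM leb4 Q); apply: ae_eq_Rintegral.
  have gz := ae_prod_snd leb3 (ae_good_time mB0 B0fin mp uC pL).
  apply: ae_imply gz => -[y s] /= gs _.
  rewrite (dtime_testfun _ _ _ sth) (laplacian_testfun _ _ _ sk).
  have [zQ|zQ] := boolP ((y, s) \in Q); last first.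
    have z0 f : tr f (y, s) = 0.
      rewrite /trunc indicE memNset ?mul0r// => -[/= yB [sT _ _]].
      by move/negP: zQ; apply; rewrite inE; split => //=; rewrite in_itv.
    rewrite indicE (negbTE zQ) mul0r /E /tu /tp !z0 !mulr0 add0r.
    by rewrite !big1 ?subr0// => j _; rewrite ?mul0r mulr0.
  have [yB sT] : B0 y /\ T0 < s < T1.
    by move: zQ; rewrite inE => -[/=]; rewrite in_itv.
  have z1 f : tr f (y, s) = f (y, s).
    by rewrite trunc_good; [rewrite indicE mem_set// mul1r|exact: gs].
  rewrite indicE zQ mul1r /E /tu /tp !z1.
  under [X in _ + X + _ = _]eq_bigr do rewrite (dspace_testfun _ _ _ sk) mulrN.
  rewrite (dspace_testfun _ _ _ sk) sumrN mulrN mulrDr mulr_sumr.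
  congr (_ + _ - _ - _).
  - exact: mulrC.
  - by apply: eq_bigr => j _; exact: mulrC.
  - by apply: eq_bigr => j _; rewrite z1; exact: mulrC.
  - exact: mulrC.
rewrite /E rintegralB; [|apply: rintegrableB; [apply: rintegrableD|]|]; last 4 first.
- exact: Ai.
- by apply: rintegrable_sum => j; exact: (B j).1.
- by apply: rintegrable_sum => j; exact: (F j).1.
- exact: Gi.
rewrite rintegralB; last 2 first.
- by apply: rintegrableD; [exact: Ai|apply: rintegrable_sum => j; exact: (B j).1].
- by apply: rintegrable_sum => j; exact: (F j).1.
rewrite rintegralD; last 2 first.
- exact: Ai.
- by apply: rintegrable_sum => j; exact: (B j).1.
rewrite AE GE rintegral_sum; last by move=> j; exact: (B j).1.
rewrite rintegral_sum; last by move=> j; exact: (F j).1.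
under eq_bigr do rewrite (B _).2.
under [X in _ - X - _]eq_bigr do rewrite (F _).2.
have [C1 thC1] := th_bd; have [C2 thC2] := dth_bd.
have thi g : rintegrable leb1 g -> rintegrable leb1 (fun s => th s * g s).
  by move=> gi; apply: (@rintegrable_bdM _ _ R leb1 C1).
have dthi g : rintegrable leb1 g -> rintegrable leb1 (fun s => 'D_1 th s * g s).
  by move=> gi; apply: (@rintegrable_bdM _ _ R leb1 C2).
have iU := dthi _ (i_u i kl).
have iB j := thi _ (i_u i (Cc_infty_derive (ebasis R j) (dk (ebasis R j)))).
have iF j := thi _ (i_uu i j (dk (ebasis R j))).
have iG := thi _ (i_p (dk (ebasis R i))).
rewrite -rintegral_sum; last exact: iB.
rewrite -rintegral_sum; last exact: iF.
rewrite -rintegralD; [|exact: iU|exact: rintegrable_sum].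
rewrite -rintegralB; [|by apply: rintegrableD; [exact: iU|exact: rintegrable_sum]|exact: rintegrable_sum].
rewrite -rintegralB; [|apply: rintegrableB; [by apply: rintegrableD; [exact: iU|exact: rintegrable_sum]|exact: rintegrable_sum]|exact: iG].
move=> E0; rewrite -[RHS]E0; apply: eq_Rintegral => s _.
rewrite cFE !mulrBr !mulr_sumr !addrA.
by [].
Qed.

Lemma divergence_test : \int[leb1]_s (th s * \sum_j sconv ('D_(ebasis R j) k) (tu j) (x, s)) = 0.
Proof.
have [_ NS2] := NS.
have := NS2 (tf k th) (Cc_testfun oB0 kl xB thT).
have sk : smooth k by case: kl.
have F j := Rintegral_testfun x (dk (ebasis R j)) (tu_tame j) mth w_M.
have -> : \int[Defs.leb4 R]_(z in B0 `*` `]T0, T1[%classic) transport u (tf k th) z =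
   \int[leb4]_z (- \sum_j tf ('D_(ebasis R j) k) th z * tu j z).
  rewrite (rintegral_indicM leb4 Q); apply: ae_eq_Rintegral.
  have gz := ae_prod_snd leb3 (ae_good_time mB0 B0fin mp uC pL).
  apply: ae_imply gz => -[y s] /= gs _.
  have [zQ|zQ] := boolP ((y, s) \in Q); last first.
    have z0 f : tr f (y, s) = 0.
      rewrite /trunc indicE memNset ?mul0r// => -[/= yB [sT _ _]].
      by move/negP: zQ; apply; rewrite inE; split => //=; rewrite in_itv.
    by rewrite indicE (negbTE zQ) mul0r big1 ?oppr0// => j _; rewrite /tu z0 mulr0.
  have [yB sT] : B0 y /\ T0 < s < T1.
    by move: zQ; rewrite inE => -[/=]; rewrite in_itv.
  have z1 f : tr f (y, s) = f (y, s).
    by rewrite trunc_good; [rewrite indicE mem_set// mul1r|exact: gs].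
  rewrite indicE zQ mul1r /transport -sumrN; apply: eq_bigr => j _.
  by rewrite (dspace_testfun _ _ _ sk) /tu z1 mulrN; congr (- _); exact: mulrC.
have Fi : rintegrable leb4 (fun z => \sum_j tf ('D_(ebasis R j) k) th z * tu j z).
  by apply: rintegrable_sum => j; exact: (F j).1.
rewrite rintegralN// => /eqP; rewrite oppr_eq0 => /eqP.
rewrite rintegral_sum; last by move=> j; exact: (F j).1.
under eq_bigr do rewrite (F _).2.
have [C1 thC1] := th_bd.
rewrite -rintegral_sum => [E0|j]; last first.
  by apply: (@rintegrable_bdM _ _ R leb1 C1) => //; exact (i_u j (dk _)).
by rewrite -[RHS]E0; apply: eq_Rintegral => s _; rewrite mulr_sumr.
Qed.

End WithTestFunction.
End Evolution.

(* [B0] is the ball carrying the solution and [C] its L^oo L^2 bound. *)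
Record ns_setting (R : realType) (B0 : set (E3 R)) (T0 T1 C : R) (u : vfield R)
    (p : spacetime R -> R) : Prop := NSSetting {
  ns_open : open B0;
  ns_finite : (sleb3 R B0 < +oo)%E;
  ns_C : 0 <= C;
  ns_mu : forall i, measurable_fun (B0 `*` `]T0, T1[%classic) (u i);
  ns_mp : measurable_fun (B0 `*` `]T0, T1[%classic) p;
  ns_uC : {ae sleb1 R, forall t, T0 < t < T1 ->
    (\int[sleb3 R]_(x in B0) (sqnorm u (x, t))%:E <= C%:E)%E};
  ns_pL : (\int[sleb4 R]_(z in B0 `*` `]T0, T1[%classic) (`|p z| `^ (3 / 2))%:E < +oo)%E;
  ns_wcont : weakly_continuous B0 T0 T1 u;
  ns_eq : NS_distributional B0 T0 T1 u p }.

Lemma enorm0 (R : realType) : enorm (0 : E3 R) = 0.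
Proof. by rewrite /enorm /= expr0n /= !addr0 sqrtr0. Qed.

(** * The untruncated coarse velocity: evolution, divergence, energy *)

Section CoarseEvolution.
Context (R : realType).
Local Notation leb3 := (sleb3 R).
Local Notation leb1 := (sleb1 R).
Local Notation leb4 := (sleb4 R).
Variables (B0 : set (E3 R)) (T0 T1 C : R) (u : vfield R) (p : spacetime R -> R).
Hypothesis st : ns_setting B0 T0 T1 C u p.
Variables (chi : E3 R -> R) (chiP : cutoff chi).
Variables (l : R) (k : E3 R -> R).
Hypotheses (l_gt0 : 0 < l) (kl : Cc_infty (eball 0 l) k).

Local Notation good := (good_time B0 T0 T1 C u p).
Local Notation tr := (trunc B0 T0 T1 C u p).
Local Notation tu := (tu B0 T0 T1 C u p).
Local Notation tp := (tp B0 T0 T1 C u p).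
Let mB0 : measurable B0. Proof. exact: open_measurable_E3 (ns_open st). Qed.

Lemma ae_good : {ae leb1, forall t, T0 < t < T1 -> good t}.
Proof. exact (ae_good_time mB0 (ns_finite st) (ns_mp st) (ns_uC st) (ns_pL st)). Qed.

Lemma ae_sconv_trunc x : eball x l `<=` B0 -> {ae leb1, forall t, T0 < t < T1 ->
  forall kk f, Cc_infty (eball 0 l) kk -> sconv kk (tr f) (x, t) = sconv kk f (x, t)}.
Proof.
move=> xB; apply: ae_imply ae_good => t gt tT kk f kkl.
by symmetry; exact (sconv_trunc xB f kkl (gt tT)).
Qed.

Let tut := tu_tame (ns_open st) (ns_finite st) (ns_C st) (ns_mu st) (ns_mp st).
Let tuut := tuu_tame (ns_open st) (ns_finite st) (ns_C st) (ns_mu st) (ns_mp st).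
Let tpt := tp_tame C (ns_open st) (ns_mu st) (ns_mp st).

Let iM : rintegrable leb1 (fun t => \1_(`]T0, T1[%classic : set R) t * mass B0 C).
Proof.
under eq_fun do rewrite mulrC.
apply: rintegrableZl; apply: rintegrable_indic => //=; rewrite lebesgue_measure_itv/=.
by case: ifP => _; rewrite ?ltry// -EFinD ltry.
Qed.

Let conv_integrable kk i x : Cc_infty (eball 0 l) kk ->
  rintegrable leb1 (fun s => sconv kk (tu i) (x, s)).
Proof.
move=> kkl.
have off y t : ~ (T0 < t < T1) -> tu i (y, t) = 0.
  by move=> tT; apply: trunc_off => -[].
by have [C' /(_ x)[]] := sconv_time_integrable kkl (tut i) off iM.
Qed.

(** The untruncated convolution supplies continuity in time, the truncated one integrability. They
    coincide at almost every time, as [weak_derivative_primitive] asks of [g] and [G]. *)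
Lemma coarse_evolution x i a b : eball x l `<=` B0 -> T0 < a -> a <= b -> b < T1 ->
  sconv k (u i) (x, b) = sconv k (u i) (x, a) + \int[leb1]_(s in `[a, b]) cF k tu tp i (x, s).
Proof.
move=> xB Ta ab bT.
have [H [sH DH HN1 H1 H01]] := smooth_step chiP.
apply: (weak_derivative_primitive sH DH HN1 H1 H01 (T0 := T0) (T1 := T1)
  (g := fun s => sconv k (u i) (x, s)) (G := fun s => sconv k (tu i) (x, s))
  (F := fun s => cF k tu tp i (x, s))) => //.
- exact: conv_integrable.
- exact (cF_integrable (ns_open st) (ns_finite st) (ns_C st) (ns_mu st) (ns_mp st)
    (ns_pL st) kl x i).
- move=> t tT.
  exact (sconv_continuous (ns_open st) (ns_finite st) (ns_wcont st) xB (kk := k) (i := i) kl tT).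
- apply: ae_imply (ae_sconv_trunc xB) => s h sT; exact (h sT k (u i) kl).
- move=> th thT.
  exact (momentum_test (ns_open st) (ns_finite st) (ns_C st) (ns_mu st) (ns_mp st)
    (ns_uC st) (ns_pL st) (ns_eq st) kl xB thT i).
Qed.

Lemma coarse_density x i a b : eball x l `<=` B0 -> T0 < a -> b < T1 ->
  has_density a b (fun t => sconv k (u i) (x, t)) (fun t => cF k tu tp i (x, t)).
Proof.
move=> xB Ta bT; split.
  have iF := cF_integrable (ns_open st) (ns_finite st) (ns_C st) (ns_mu st) (ns_mp st)
    (ns_pL st) kl x i.
  apply: (@rintegrable_bdM _ _ R leb1 1) => //.
  by move=> s; rewrite indicE normr_natb_le1.
by move=> t /andP[ta tb]; apply: coarse_evolution => //; exact: le_lt_trans tb bT.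
Qed.

(** At a bad time every truncated slice is 0. At a good time the divergence equals that of the
    untruncated field, which is continuous in time and has zero integral over every compact
    subinterval. *)
Lemma coarse_divergence_free x s : eball x l `<=` B0 ->
  \sum_i dspace i (cU k tu i) (x, s) = 0.
Proof.
move=> xB.
pose D j := 'D_(ebasis R j) k.
have kD j : Cc_infty (eball 0 l) (D j) by exact: Cc_infty_derive.
have E t : \sum_i dspace i (cU k tu i) (x, t) = \sum_i sconv (D i) (tu i) (x, t).
  by apply: eq_bigr => i _; rewrite (dspace_cU kl tut).
have [gs|gs] := pselect (good s); last first.
  by rewrite E big1// => i _; exact (sconv_bad x (D i) (u i) gs).
have sT : T0 < s < T1 by case: gs.
pose F t := \sum_i sconv (D i) (tu i) (x, t).
pose Fo (t : R) := \sum_i sconv (D i) (u i) (x, t).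
have FoE : {ae leb1, forall t, T0 < t < T1 -> F t = Fo t}.
  apply: ae_imply (ae_sconv_trunc xB) => t h tT.
  by apply: eq_bigr => i _; exact (h tT _ (u i) (kD i)).
have cFo t : T0 < t < T1 -> {for t, continuous Fo}.
  move=> tT; rewrite /Fo; elim: (index_enum _) => [|i r IH].
    have -> : (fun t : R => \sum_(i <- [::]) sconv (D i) (u i) (x, t)) = fun=> 0.
      by apply/funext => t'; rewrite big_nil.
    exact: cst_continuous.
  have -> : (fun t : R => \sum_(i <- i :: r) sconv (D i) (u i) (x, t)) =
      (fun t => sconv (D i) (u i) (x, t) + \sum_(i <- r) sconv (D i) (u i) (x, t)).
    by apply/funext => t'; rewrite big_cons.
  apply: (@continuousD _ _ _ (fun s : R => sconv (D i) (u i) (x, s))) => //.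
  exact (sconv_continuous (ns_open st) (ns_finite st) (ns_wcont st) xB (i := i) (kD i) tT).
have [H [sH DH HN1 H1 H01]] := smooth_step chiP.
have F0 a b : T0 < a -> a <= b -> b < T1 -> \int[leb1]_(t in `[a, b]) Fo t = 0.
  move=> Ta ab bT.
  (* Incompressibility, tested, says that [F] is the weak derivative of the zero function; with
     [g = G = 0] the primitive formula makes its integrals vanish. *)
  have E0 : 0 = 0 + \int[leb1]_(t in `[a, b]) F t.
    apply: (weak_derivative_primitive sH DH HN1 H1 H01 (T0 := T0) (T1 := T1)
      (g := fun=> 0) (G := fun=> 0) (F := F)) => //.
    - exact: rintegrable0.
    - by apply: rintegrable_sum => i; exact: conv_integrable.
    - by move=> t _; exact: cst_continuous.
    - exact: aeW.
    - move=> th thT; under eq_Rintegral do rewrite mulr0 add0r.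
      exact (divergence_test (ns_open st) (ns_finite st) (ns_C st) (ns_mu st) (ns_mp st)
        (ns_uC st) (ns_pL st) (ns_eq st) kl xB thT).
  rewrite [RHS]E0 add0r; apply: ae_eq_Rintegral; apply: ae_imply FoE => t h.
  rewrite /= in_itv /= => /andP[at_ tb].
  by rewrite h// (lt_le_trans Ta at_) (le_lt_trans tb bT).
rewrite E; transitivity (Fo s).
  by apply: eq_bigr => i _; symmetry; exact (sconv_trunc xB (u i) (kD i) gs).
case/andP: sT => Ts sT.
pose a := (T0 + s) / 2; pose b := (s + T1) / 2.
have [Ta as_ sb bT] : [/\ T0 < a, a < s, s < b & b < T1] by rewrite /a /b; split; lra.
have iFo : lebesgue_measure.-integrable `[a, b] (EFin \o Fo).
  apply: continuous_compact_integrable; first exact: segment_compact.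
  apply: continuous_in_subspaceT => t; rewrite inE /= in_itv /= => /andP[at_ tb].
  by apply: cFo; rewrite (lt_le_trans Ta at_) (le_lt_trans tb bT).
have sT' : T0 < s < T1 by rewrite Ts.
(* [Fo s] is the derivative at [s] of a primitive that is identically 0 near [s]. *)
have [_ <-] := continuous_FTC1_closed sb iFo as_ (cFo s sT').
rewrite derive1E (@near_eq_derive R R^o R^o _ (fun=> 0)) ?derive_cst//.
have : nbhs s `]a, b[%classic by apply: open_nbhs_nbhs; split; [exact: itv_open|rewrite /= in_itv /= as_].
apply: filterS => t; rewrite /= in_itv /= => /andP[at_ tb].
by apply: F0 => //; [exact: ltW|exact: lt_trans tb bT].
Qed.

Variables (K : set (E3 R)) (phi : spacetime R -> R).
Hypotheses (cK : compact K) (KB : forall x, K x -> eball x l `<=` B0).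
Hypotheses (sphi : smooth phi) (phiK : forall z, ~ K z.1 -> phi z = 0).

(** Valid at every time, in particular at slab ends, which may be bad times: the chosen
    representative has square integrable slices on compact subsets of [B0], and from [K] the kernel
    sees only the compact set [K - supp k]. *)
Lemma energy_integrable t : T0 < t < T1 ->
  rintegrable leb3 (energy phi (fun i => sconv k (u i)) t).
Proof.
move=> tT; have [sk [ck kB]] := kl.
pose K' := (fun w : E3 R * E3 R => w.1 - w.2) @` (K `*` closure [set v | k v != 0]).
have cK' : compact K'.
  apply: continuous_compact; last exact: compact_setX.
  apply: continuous_subspaceT => w.
  by apply: (@continuousB R (E3 R) (E3 R * E3 R)%type fst snd); [exact: cvg_fst|exact: cvg_snd].
have mK' := compact_measurable_E3 cK'.
have K'B : K' `<=` B0.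
  move=> _ [[x v] [/= /KB xB /kB/interior_subset vl] <-]; apply: xB.
  by move: vl; rewrite /eball /= subr0 addrAC subrr add0r enormN.
have K'fin : (leb3 K' < +oo)%E.
  by apply: le_lt_trans (ns_finite st); apply: le_measure; rewrite ?inE.
(* The slice at time [t], cut off to [K'] and regarded as a field constant in time, to which the
   convolution bounds apply. *)
pose v i : spacetime R -> R := fun z => \1_K' z.1 * u i (z.1, t).
have mv i : measurable_fun setT (fun y : E3 R => \1_K' y * u i (y, t)).
  have -> : (fun y => \1_K' y * u i (y, t)) =
      (fun y => \1_K' y * (\1_(B0 `*` `]T0, T1[%classic) (y, t) * u i (y, t))).
    apply/funext => y; rewrite !indicE; have [yK|_] := boolP (y \in K'); last by rewrite !mul0r.
    rewrite [_ \in _ `*` _]mem_set ?mul1r//; split => /=; last by rewrite in_itv.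
    by apply: K'B; rewrite inE in yK.
  apply: measurable_funM => //.
  apply: (measurable_fun_pair1 (f := fun z => \1_(B0 `*` `]T0, T1[%classic) z * u i z)).
  by apply: measurable_indicM; [exact: measurableX|exact: (ns_mu st)].
have iv i : rintegrable leb3 (fun y : E3 R => \1_K' y * u i (y, t)).
  have [u2 _] := ns_wcont st cK' K'B.
  have mu2 : measurable_fun setT (fun y : E3 R => \1_K' y * u i (y, t) ^+ 2).
    have -> : (fun y : E3 R => \1_K' y * u i (y, t) ^+ 2) =
        (fun y => (\1_K' y * u i (y, t)) ^+ 2).
      apply/funext => y; rewrite exprMn indicE; case: (y \in K'); rewrite ?expr0n ?expr1n//.
    exact: measurable_funX.
  apply: (@rintegrable_le _ _ R leb3 _ (fun y => \1_K' y + \1_K' y * u i (y, t) ^+ 2)) => //.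
    apply: rintegrableD; first exact: rintegrable_indic.
    apply/integrableP; split; first exact/measurable_EFinP.
    apply: le_lt_trans (u2 i t tT); rewrite [X in (_ <= X)%E]integral_mkcond le_eqVlt.
    apply/orP; left; apply/eqP; apply: eq_integral => y _ /=.
    rewrite patchE indicE; case: (y \in K'); last by rewrite mul0r normr0.
    by rewrite mul1r ger0_norm// sqr_ge0.
  move=> y; rewrite indicE; case: (y \in K'); last by rewrite !mul0r normr0 addr0.
  rewrite !mul1r -(real_normK (num_real (u i (y, t)))) /=.
  have := normr_ge0 (u i (y, t)); have := sqr_ge0 (`|u i (y, t)| - 1).
  by set s := `|u i (y, t)|; nra.
have E : energy phi (fun i => sconv k (u i)) t =
    (fun x => 2^-1 * sqnorm (fun i => sconv k (v i)) (x, t) * phi (x, t)).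
  apply/funext => x; rewrite /energy; have [Kx|Kx] := pselect (K x); last by rewrite phiK// !mulr0.
  congr (_ * _ * _); apply: eq_bigr => i _; congr (_ ^+ 2); apply: eq_Rintegral => y _ /=.
  rewrite /v /= indicE; have [|yK'] := boolP (y \in K'); first by rewrite mul1r.
  have -> : k (x - y) = 0; last by rewrite !mul0r.
  apply: contrapT => /eqP k0; move/negP: yK'; apply; rewrite inE.
  by exists (x, x - y); [split => //; exact: subset_closure|rewrite /= subKr].
rewrite E.
have [Ck kC] := Cc_infty_bounded kl.
have Ck0 : 0 <= Ck by apply: le_trans (kC 0).
pose Nv := \sum_i (Ck * \int[leb3]_y `|v i (y, t)|) ^+ 2.
apply: (@rintegrable_bdM _ _ R leb3 (2^-1 * Nv)).
- apply: measurable_funM => //; apply: measurable_sum => i; apply: measurable_funX.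
  apply: (measurable_fun_pair1 (f := sconv k (v i))).
  apply: measurable_conv; first exact: smooth_continuous.
  exact: (measurableT_comp (mv i) measurable_fst).
- move=> x; rewrite ger0_norm; last by rewrite mulr_ge0// sumr_ge0// => i _; exact: sqr_ge0.
  rewrite ler_wpM2l//; apply: ler_sum => i _.
  rewrite -(real_normK (num_real (sconv _ _ _))) lerXn2r// ?nnegrE//.
    by rewrite mulr_ge0//; exact: Rintegral_ge0.
  exact (conv_bound kl x kC (iv i)).
have [M phiM] := compact_continuous_bounded cK (smooth_continuous (smooth_slice t sphi)).
apply: (@rintegrable_le _ _ R leb3 _ (fun x => Num.max M 0 * \1_K x)).
- by apply: continuous_measurable_E3; exact: smooth_continuous (smooth_slice t sphi).
- apply: rintegrableZl; apply: rintegrable_indic; first exact: compact_measurable_E3.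
  apply: le_lt_trans (ns_finite st); apply: le_measure; rewrite ?inE//.
    exact: compact_measurable_E3.
  by move=> x Kx; apply: (KB Kx); rewrite /eball /= subrr enorm0.
- move=> x; rewrite indicE; have [|] := boolP (x \in K).
    by rewrite inE mulr1 le_max => /phiM ->.
  by rewrite notin_setE => Kx; rewrite phiK// normr0 mulr0.
Qed.

End CoarseEvolution.

(** * From the original package to the truncated one; linearity in the weight *)

Section PackageAgreement.
Context (R : realType) (pk pk' : package R) (phi : spacetime R -> R).

(** The spatial derivatives are listed separately, since values at a single point do not determine
    them. *)
Definition agree z := [/\ forall i, pkU pk i z = pkU pk' i z, pkP pk z = pkP pk' z,
  forall i j, pkR pk i j z = pkR pk' i j z &
  forall i j, dspace j (pkU pk i) z = dspace j (pkU pk' i) z].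

Lemma agree_transport z : agree z -> transport (pkU pk) phi z = transport (pkU pk') phi z.
Proof. by move=> [U _ _ _]; apply: eq_bigr => j _; rewrite U. Qed.

Lemma agree_sqnorm z : agree z -> sqnorm (pkU pk) z = sqnorm (pkU pk') z.
Proof. by move=> [U _ _ _]; apply: eq_bigr => j _; rewrite U. Qed.

Lemma agree_pkPi z : agree z -> pkPi pk z = pkPi pk' z.
Proof.
move=> [_ _ r d]; congr (- _); apply: eq_bigr => i _; apply: eq_bigr => j _.
by rewrite r d.
Qed.

Lemma agree_stress z : agree z ->
  transport (fun i y => \sum_j pkR pk i j y * pkU pk j y) phi z =
  transport (fun i y => \sum_j pkR pk' i j y * pkU pk' j y) phi z.
Proof.
move=> [U _ r _]; apply: eq_bigr => i _; congr (_ * _); apply: eq_bigr => j _.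
by rewrite r U.
Qed.

Variables (a b : R) (K : set (E3 R)).
Hypothesis agree_ae : {ae Defs.leb4 R, forall z, a < z.2 < b -> K z.1 -> agree z}.
Hypotheses (cK : compact K) (phiK : forall z, ~ K z.1 -> phi z = 0).

Lemma transport_support (v : vfield R) z : ~ K z.1 -> transport v phi z = 0.
Proof. by move=> Kz; apply: big1 => j _; rewrite (dspace_support cK)// mulr0. Qed.

Lemma transfer_agree (h h' : spacetime R -> R) : (forall z, agree z -> h z = h' z) ->
  (forall z, ~ K z.1 -> h z = h' z) ->
  \int[Defs.leb4 R]_(z in [set: E3 R] `*` `]a, b[%classic) h z =
  \int[Defs.leb4 R]_(z in [set: E3 R] `*` `]a, b[%classic) h' z.
Proof.
move=> hK hKc; apply: ae_eq_Rintegral; apply: ae_imply agree_ae => -[x s] /= gs [_ /=].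
rewrite in_itv /= => sab; have [Kx|Kx] := pselect (K x); last exact: hKc.
by apply: hK; apply: gs.
Qed.

Local Opaque dspace dtime.

Lemma agree_calW r : calW pk r a b phi = calW pk' r a b phi.
Proof.
rewrite /calW; apply: (congr1 ( *%R r^-1)).
apply: (transfer_agree (h := fun z => phi z * pkPi pk z - pkP pk z * transport (pkU pk) phi z)
  (h' := fun z => phi z * pkPi pk' z - pkP pk' z * transport (pkU pk') phi z)) => [z /[dup] agz [U P _ _]|z Kz].
  by rewrite P agree_pkPi// agree_transport.
by rewrite phiK// !transport_support// !mul0r !mulr0.
Qed.

Lemma agree_calD r : calD pk r a b phi = calD pk' r a b phi.
Proof.
rewrite /calD; apply: (congr1 ( *%R r^-1)).
apply: (transfer_agree (h := fun z => phi z * \sum_i \sum_j dspace j (pkU pk i) z ^+ 2)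
  (h' := fun z => phi z * \sum_i \sum_j dspace j (pkU pk' i) z ^+ 2)) => [z [_ _ _ d]|z Kz].
  by congr (_ * _); apply: eq_bigr => i _; apply: eq_bigr => j _; rewrite d.
by rewrite phiK// !mul0r.
Qed.

Lemma agree_calL r : calL pk r a b phi = calL pk' r a b phi.
Proof.
rewrite /calL; apply: (congr1 ( *%R r^-1)).
pose h (q : package R) z := 2^-1 * sqnorm (pkU q) z * (dtime phi z + laplacian phi z)
   + 2^-1 * sqnorm (pkU q) z * transport (pkU q) phi z
   + transport (fun i y => \sum_j pkR q i j y * pkU q j y) phi z.
apply: (transfer_agree (h := h pk) (h' := h pk')) => [z agz|z Kz].
  by rewrite /h agree_sqnorm// agree_stress// agree_transport.
rewrite /h !transport_support// (dtime_support phiK)// /laplacian big1 ?addr0 ?mulr0//.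
by move=> j _; do 2 (apply: (dspace_support cK) => //; move=> {Kz}z Kz).
Qed.

End PackageAgreement.

Section WeightLinearity.
Context (R : realType) (pk pk' : package R) (a b : R) (K : set (E3 R)).
Hypothesis agree_ae : {ae Defs.leb4 R, forall z, a < z.2 < b -> K z.1 -> agree pk pk' z}.
Hypothesis cK : compact K.
Implicit Types phi : spacetime R -> R.
Local Notation leb4 := (Defs.leb4 R).

Definition supported_weight phi := smooth phi /\ forall z, ~ K z.1 -> phi z = 0.

Let wPi q phi z := phi z * pkPi q z.
Let wP q phi z := pkP q z * transport (pkU q) phi z.
Let on f z : R := \1_(slab a b) z * f z.

Hypothesis iPi : forall phi, supported_weight phi -> rintegrable leb4 (on (wPi pk' phi)).
Hypothesis iP : forall phi, supported_weight phi -> rintegrable leb4 (on (wP pk' phi)).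

Let SlabE f : \int[leb4]_(z in [set: E3 R] `*` `]a, b[%classic) f z = \int[leb4]_z on f z.
Proof. by rewrite (rintegral_indicM leb4 (slab a b)). Qed.

Let on_B f g z : on (fun z => f z - g z) z = on f z - on g z.
Proof. by rewrite /on mulrBr. Qed.

(** Separating the two terms requires each to be integrable, which is assumed of [pk']; the
    functional of [pk] is first transferred to it. *)
Lemma calW_split r phi : supported_weight phi -> calW pk r a b phi =
  r^-1 * (\int[leb4]_z on (wPi pk' phi) z - \int[leb4]_z on (wP pk' phi) z).
Proof.
move=> sw; have [sphi phiK] := sw; rewrite (agree_calW agree_ae cK phiK).
apply: (congr1 ( *%R r^-1)); rewrite SlabE -rintegralB; [|exact: iPi|exact: iP].
by apply: eq_Rintegral => z _; exact: on_B.
Qed.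

Lemma dspace_comb (I : finType) phi0 (c : I -> R) (phi : I -> spacetime R -> R) j z :
  smooth phi0 -> (forall i, smooth (phi i)) ->
  dspace j (fun z => phi0 z + \sum_i c i * phi i z) z =
  dspace j phi0 z + \sum_i c i * dspace j (phi i) z.
Proof.
move=> s0 s.
have d i : is_derive z ((ebasis R j, 0) : spacetime R) (fun z => c i * phi i z) (c i * dspace j (phi i) z).
  by apply: is_derive_fZ; exact (Ck_is_derive _ _ (smooth_Ck false 0 (s i))).
have [_ <-] := is_derive_fD (Ck_is_derive z ((ebasis R j, 0) : spacetime R) (smooth_Ck false 0 s0))
  (is_derive_fsum (index_enum I) d).
by [].
Qed.

Lemma calW_comb r (I : finType) phi0 (c : I -> R) (phi : I -> spacetime R -> R) :
  supported_weight phi0 -> (forall i, supported_weight (phi i)) ->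
  calW pk r a b (fun z => phi0 z + \sum_i c i * phi i z) =
  calW pk r a b phi0 + \sum_i c i * calW pk r a b (phi i).
Proof.
move=> w0 w.
have wc : supported_weight (fun z => phi0 z + \sum_i c i * phi i z).
  split; first apply: (smoothD w0.1); first apply: smooth_sum => i; first exact: smoothZ (w i).1.
  by move=> z Kz; rewrite w0.2// big1 ?addr0// => i _; rewrite (w i).2// mulr0.
rewrite !calW_split//.
have E1 : \int[leb4]_z on (wPi pk' (fun z => phi0 z + \sum_i c i * phi i z)) z =
    \int[leb4]_z on (wPi pk' phi0) z + \sum_i c i * \int[leb4]_z on (wPi pk' (phi i)) z.
  transitivity (\int[leb4]_z (on (wPi pk' phi0) z + \sum_i c i * on (wPi pk' (phi i)) z)).
    apply: eq_Rintegral => z _; rewrite /on /wPi mulrDl mulrDr; congr (_ + _).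
    rewrite mulr_suml mulr_sumr; apply: eq_bigr => i _.
    by rewrite -mulrA mulrCA.
  rewrite rintegralD; [|exact: iPi|by apply: rintegrable_sum => i; apply: rintegrableZl; exact: iPi].
  congr (_ + _); rewrite rintegral_sum; last by move=> i; apply: rintegrableZl; exact: iPi.
  by apply: eq_bigr => i _; rewrite rintegralZl//; exact: iPi.
have E2 : \int[leb4]_z on (wP pk' (fun z => phi0 z + \sum_i c i * phi i z)) z =
    \int[leb4]_z on (wP pk' phi0) z + \sum_i c i * \int[leb4]_z on (wP pk' (phi i)) z.
  transitivity (\int[leb4]_z (on (wP pk' phi0) z + \sum_i c i * on (wP pk' (phi i)) z)).
    apply: eq_Rintegral => z _; rewrite /on /wP.
    have -> : transport (pkU pk') (fun z => phi0 z + \sum_i c i * phi i z) z =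
        transport (pkU pk') phi0 z + \sum_i c i * transport (pkU pk') (phi i) z.
      rewrite /transport; under eq_bigr do rewrite (dspace_comb _ _ _ w0.1 (fun i => (w i).1)) mulrDr.
      rewrite big_split /=; congr (_ + _).
      under [RHS]eq_bigr do rewrite mulr_sumr.
      rewrite exchange_big /=; apply: eq_bigr => j _.
      by rewrite mulr_sumr; apply: eq_bigr => i _; rewrite mulrCA.
    rewrite !mulrDr; congr (_ + _); rewrite !mulr_sumr; apply: eq_bigr => i _.
    by move: (transport _ _ _) => t; ring.
  rewrite rintegralD; [|exact: iP|by apply: rintegrable_sum => i; apply: rintegrableZl; exact: iP].
  congr (_ + _); rewrite rintegral_sum; last by move=> i; apply: rintegrableZl; exact: iP.
  by apply: eq_bigr => i _; rewrite rintegralZl//; exact: iP.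
rewrite E1 E2.
under [in RHS]eq_bigr do rewrite calW_split// mulrCA mulrBr.
by rewrite -mulr_sumr sumrB -mulrDr opprD addrACA.
Qed.

(** [pairing_G] integrates its two terms separately and over all of space-time. A weight that
    vanishes outside the slab in time reconciles both differences. *)
Lemma calW_pairing r phi : supported_weight phi -> (forall z, ~ (a < z.2 < b) -> phi z = 0) ->
  calW pk r a b phi = r^-1 * pairing_G pk phi.
Proof.
move=> sw phiI; have [sphi phiK] := sw; rewrite calW_split//.
have tI q z : ~ (a < z.2 < b) -> transport (pkU q) phi z = 0.
  case: z => x t /= tI; apply: big1 => j _.
  have -> : dspace j phi (x, t) = 0; last by rewrite mulr0.
  rewrite dspaceE (_ : (fun y => phi (y, t)) = fun=> 0) ?derive_cst//.
  by apply/funext => y; exact: phiI.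
have tr (h h' : spacetime R -> R) : (forall z, agree pk pk' z -> h z = h' z) ->
    (forall z, ~ K z.1 -> h z = h' z) -> (forall z, ~ (a < z.2 < b) -> h z = 0) ->
    \int[leb4]_z on h' z = \int[leb4]_z h z.
  move=> h1 h2 h3; rewrite -SlabE -(transfer_agree agree_ae h1 h2) SlabE.
  apply: eq_Rintegral => z _; rewrite /on indic_slab indicE.
  have [_|] := boolP (_ \in _); first by rewrite mul1r.
  by rewrite notin_setE /= in_itv /= => /h3 ->; rewrite mul0r.
apply: (congr1 ( *%R r^-1)); congr (_ - _).
- apply: (tr (fun z => phi z * pkPi pk z)) => z.
  + by move=> agz; rewrite /wPi (agree_pkPi agz).
  + by move=> Kz; rewrite /wPi phiK// !mul0r.
  + by move=> zI; rewrite phiI// mul0r.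
- apply: (tr (fun z => pkP pk z * transport (pkU pk) phi z)) => z.
  + by move=> agz; rewrite /wP (agree_transport _ agz); have [_ -> _ _] := agz.
  + by move=> Kz; rewrite /wP !(transport_support cK phiK)// !mulr0.
  + by move=> zI; rewrite tI// mulr0.
Qed.

End WeightLinearity.

(** * Balance of the actual coarse package on one slab *)

Section SlabBalance.
Context (R : realType).
Local Notation leb3 := (sleb3 R).
Local Notation leb1 := (sleb1 R).
Local Notation leb4 := (sleb4 R).
Variables (B0 : set (E3 R)) (T0 T1 C : R) (u : vfield R) (p : spacetime R -> R).
Hypothesis st : ns_setting B0 T0 T1 C u p.
Variables (chi : E3 R -> R) (chiP : cutoff chi).
Variables (l : R) (rho : E3 R -> R).
Hypotheses (l_gt0 : 0 < l) (rhoP : mollifier rho).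

Local Notation k := (moll rho l).
Local Notation good := (good_time B0 T0 T1 C u p).
Local Notation tu := (tu B0 T0 T1 C u p).
Local Notation tp := (tp B0 T0 T1 C u p).
Local Notation pk := (coarse_package rho l u p).
Local Notation cU := (cU k tu).
Local Notation cP := (cP k tp).
Local Notation cR := (cR k tu).
Local Notation cpk := (cpackage k tu tp).
Let V : set (E3 R) := [set x | eball x l `<=` B0].
Let kl : Cc_infty (eball 0 l) k. Proof. exact: Cc_infty_moll. Qed.
Let mB0 : measurable B0. Proof. exact: open_measurable_E3 (ns_open st). Qed.

Lemma interior_eball_inside x : V° x -> B0 x.
Proof. by move=> /interior_subset; apply; rewrite /eball /= subrr enorm0. Qed.

Lemma pkU_trunc x s i : V x -> good s -> pkU pk i (x, s) = cU i (x, s).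
Proof. by move=> Vx gs; exact (sconv_trunc Vx (u i) kl gs). Qed.

Lemma pkP_trunc x s : V x -> good s -> pkP pk (x, s) = cP (x, s).
Proof. by move=> Vx gs; exact (sconv_trunc Vx p kl gs). Qed.

Lemma pkR_trunc x s i j : V x -> good s -> pkR pk i j (x, s) = cR i j (x, s).
Proof.
move=> Vx gs.
have E : sconv k (fun z => u i z * u j z) (x, s) = cS k tu i j (x, s).
  have -> : cS k tu i j = sconv k (trunc B0 T0 T1 C u p (fun z => u i z * u j z)).
    by congr sconv; apply/funext => z; exact: trunc_mul.
  exact (sconv_trunc Vx (fun z => u i z * u j z) kl gs).
exact (congr2 (fun s t => s - t) E (congr2 *%R (pkU_trunc i Vx gs) (pkU_trunc j Vx gs))).
Qed.

(** A derivative sees a whole neighbourhood of [x], hence the interior of [V]. *)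
Lemma dspace_pkU_trunc x s i j : V° x -> good s ->
  dspace j (pkU pk i) (x, s) = dspace j (cU i) (x, s).
Proof.
move=> Vx gs; rewrite !dspaceE; apply: near_eq_derive.
by apply: filterS Vx => y Vy; exact: pkU_trunc.
Qed.

Variables (K : set (E3 R)) (a b : R).
Hypotheses (cK : compact K) (KV : K `<=` V°) (ab : a < b) (Ta : T0 < a) (bT : b < T1).

Lemma agree_trunc : {ae leb4, forall z, a < z.2 < b -> K z.1 -> agree pk cpk z}.
Proof.
have := ae_prod_snd leb3 (ae_good st).
apply: ae_imply => -[x s] /= gs /andP[as_ sb] Kx.
have {}gs : good s by apply: gs; rewrite (lt_trans Ta as_) (lt_trans sb bT).
have Vx := interior_subset (KV Kx).
split.
- by move=> i; exact (pkU_trunc i Vx gs).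
- exact (pkP_trunc Vx gs).
- by move=> i j; exact (pkR_trunc i j Vx gs).
- by move=> i j; exact (dspace_pkU_trunc i j (KV Kx) gs).
Qed.

Let tut := tu_tame (ns_open st) (ns_finite st) (ns_C st) (ns_mu st) (ns_mp st).
Let tuut := tuu_tame (ns_open st) (ns_finite st) (ns_C st) (ns_mu st) (ns_mp st).
Let tpt := tp_tame C (ns_open st) (ns_mu st) (ns_mp st).
Let qi := q_int C (ns_open st) (ns_finite st) (ns_mu st) (ns_mp st) (ns_pL st).
Let KB0 : K `<=` B0. Proof. by move=> x /KV/interior_eball_inside. Qed.

Let q0 t : 0 <= pressure_mass B0 T0 T1 C u p t. Proof. exact: Rintegral_ge0. Qed.

Lemma phiPi_integrable phi : supported_weight K phi ->
  rintegrable (Defs.leb4 R) (fun z => \1_(slab a b) z * (phi z * pkPi cpk z)).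
Proof.
move=> [sphi phiK].
exact (dominated_integrable mB0 (ns_finite st) q0 qi
  (dom_phiPi kl tut tuut tpt a b sphi cK KB0 phiK)).
Qed.

Lemma Ptransport_integrable phi : supported_weight K phi ->
  rintegrable (Defs.leb4 R) (fun z => \1_(slab a b) z * (pkP cpk z * transport (pkU cpk) phi z)).
Proof.
move=> [sphi phiK].
exact (dominated_integrable mB0 (ns_finite st) q0 qi
  (dom_Ptransport kl tut tpt a b sphi cK KB0 phiK)).
Qed.

Variable phi : spacetime R -> R.
Hypotheses (sphi : smooth phi) (phiK : forall z, ~ K z.1 -> phi z = 0).

Variable m : R.
Hypothesis B0box : forall x : E3 R, B0 x -> [/\ `|x.1.1| < m, `|x.1.2| < m & `|x.2| < m].

Theorem slab_balance r : calW pk r a b phi + calD pk r a b phi =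
  calL pk r a b phi + r^-1 * \int[leb3]_x energy phi (pkU pk) a x
  - r^-1 * \int[leb3]_x energy phi (pkU pk) b x.
Proof.
rewrite (agree_calW agree_trunc cK phiK) (agree_calD agree_trunc phiK).
rewrite (agree_calL agree_trunc cK phiK).
have KV' x : K x -> eball x l `<=` B0 by move=> /KV/interior_subset.
have aT : T0 < a < T1 by rewrite Ta (lt_trans ab bT).
have bT' : T0 < b < T1 by rewrite bT (lt_trans Ta ab).
have Uae x : K x -> {ae leb1, forall s, a < s < b -> forall i, pkU pk i (x, s) = cU i (x, s)}.
  move=> Kx; apply: ae_imply (ae_sconv_trunc st (KV' x Kx)) => s h /andP[as_ sb] i.
  by symmetry; apply: (h _ k (u i) kl); rewrite (lt_trans Ta as_) (lt_trans sb bT).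
(* The slab integrals now belong to the truncated package and the end energies to the original one;
   the choice [Uo := pkU pk] ties them together. *)
have EE := energy_balance kl tut tuut tpt qi ab mB0 (ns_finite st) B0box sphi cK KB0 phiK
  (Uo := pkU pk)
  (fun x i Kx => coarse_density st chiP kl i (KV' x Kx) Ta bT) Uae
  (fun x s Kx => coarse_divergence_free st chiP kl s (KV' x Kx))
  (energy_integrable st l_gt0 kl cK KV' sphi phiK aT)
  (energy_integrable st l_gt0 kl cK KV' sphi phiK bT').
have EW : calW cpk r a b phi = r^-1 * \int[leb4]_(z in slab a b) densW k tu tp phi z by [].
have ED : calD cpk r a b phi = r^-1 * \int[leb4]_(z in slab a b) densD k tu phi z by [].
have EL : calL cpk r a b phi = r^-1 * \int[leb4]_(z in slab a b) densL k tu phi z by [].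
rewrite EW ED EL; move: EE; set w := \int[_]_(_ in _) densW _ _ _ _ _.
set d := \int[_]_(_ in _) densD _ _ _ _; set e := \int[_]_(_ in _) densL _ _ _ _.
set ea := \int[_]_x energy _ _ a x; set eb := \int[_]_x energy _ _ b x.
move: w d e ea eb => w d e ea eb EE.
have -> : e = eb - ea + d + w by rewrite EE; ring.
by ring.
Qed.

End SlabBalance.

(** * Weights of the chain and geometry of its slabs *)

Section Weights.
Context (R : realType) (x0 : E3 R) (chi : E3 R -> R) (r t : R).
Hypotheses (chiP : cutoff chi) (r_gt0 : 0 < r).
Local Notation chi_at := (chi_at x0 chi r).
Local Notation rescale := (rescale x0 r t).
Local Notation K := (closure (eball x0 r)).

Let affine_space h (v z : spacetime R) :
  r^-1 *: ((h *: v + z).1 - x0) = h *: (r^-1 *: v.1) + r^-1 *: (z.1 - x0) :> E3 R.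
Proof. by rewrite /= -addrA scalerDr !scalerA mulrC. Qed.

Let continuous_space : continuous (fun z : spacetime R => r^-1 *: (z.1 - x0) : E3 R).
Proof.
move=> z; apply: (@continuousZr R (E3 R) (spacetime R) (fun z => z.1 - x0) r^-1).
by apply: (@continuousB R (E3 R) (spacetime R) fst (fun=> x0)); [exact: cvg_fst|exact: cst_continuous].
Qed.

Lemma smooth_chi_at : smooth (fun z : spacetime R => chi_at z.1).
Proof.
have [[schi _] _ _ _] := chiP.
exact (@smooth_affine R (spacetime R) (E3 R) (fun z => r^-1 *: (z.1 - x0)) (fun v => r^-1 *: v.1)
  affine_space chi continuous_space schi).
Qed.

Lemma smooth_rescale f : smooth f -> smooth (rescale f).
Proof.
move=> sf.
apply: (@smooth_affine R (spacetime R) (spacetime R)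
  (fun z => (r^-1 *: (z.1 - x0), (z.2 - t) / r ^+ 2)) (fun v => (r^-1 *: v.1, v.2 / r ^+ 2)) _ f) => //.
- move=> h v z; transitivity ((h *: (r^-1 *: v.1) + r^-1 *: (z.1 - x0),
    h *: (v.2 / r ^+ 2) + (z.2 - t) / r ^+ 2) : spacetime R) => //.
  congr (_, _); first exact: affine_space.
  by rewrite /= /GRing.scale /= -addrA mulrDl mulrA.
- apply: continuous_fun_pair => // z.
  apply: (@continuousM R (spacetime R) (fun z => z.2 - t) (fun=> (r ^+ 2)^-1)); last exact: cst_continuous.
  by apply: (@continuousB R R (spacetime R) snd (fun=> t)); [exact: cvg_snd|exact: cst_continuous].
Qed.

Lemma chi_at_off x : ~ K x -> chi_at x = 0.
Proof.
move=> Kx; apply: contrapT => /eqP cx; apply: Kx; apply: subset_closure.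
have [[_ [_ chiB]] _ _ _] := chiP.
have /chiB/interior_subset : closure [set y | chi y != 0] (r^-1 *: (x - x0)) by exact: subset_closure.
by rewrite /eball /= subr0 enormZ gtr0_norm ?invr_gt0// mulrC ltr_pdivrMr// mul1r.
Qed.

Lemma chi_at_ge0 x : 0 <= chi_at x.
Proof. by have [_ _ /(_ (r^-1 *: (x - x0)))/andP[]] := chiP. Qed.

(** A larger scale evaluates the radially nonincreasing [chi] nearer to the centre. *)
Lemma chi_at_le r' x : r <= r' -> chi_at x <= Defs.chi_at x0 chi r' x.
Proof.
move=> rr'; have [_ [_ mono] _ _] := chiP; apply: mono.
have r'0 : 0 < r' by apply: lt_le_trans rr'.
rewrite !enormZ !gtr0_norm ?invr_gt0//; apply: ler_wpM2r; first exact: sqrtr_ge0.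
by rewrite lef_pV2// posrE.
Qed.

Lemma rescale_off f z : Cc_infty (@unit_cyl R) f -> ~ (t < z.2 < t + r ^+ 2) -> rescale f z = 0.
Proof.
move=> [_ [_ fB]] zt; apply: contrapT => /eqP fz; apply: zt.
have /fB/interior_subset[_ /=] : closure [set y | f y != 0] (r^-1 *: (z.1 - x0), (z.2 - t) / r ^+ 2).
  exact: subset_closure.
rewrite in_itv /= ltr_pdivlMr ?exprn_gt0// ltr_pdivrMr ?exprn_gt0//.
by rewrite mul0r mul1r subr_gt0 ltrBlDl.
Qed.

Lemma supported_chi_at : supported_weight K (fun z => chi_at z.1).
Proof. by split; [exact: smooth_chi_at|move=> z /chi_at_off]. Qed.

Lemma supported_active f : Cc_infty (@unit_cyl R) f ->
  supported_weight K (fun z => chi_at z.1 * rescale f z).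
Proof.
move=> [sf _]; split; first by apply: smoothM; [exact: smooth_chi_at|exact: smooth_rescale].
by move=> z /chi_at_off ->; rewrite mul0r.
Qed.

Variables (m : nat) (eps : R) (B : 'M[R]_m) (psi : 'I_m -> spacetime R -> R).
Hypothesis psiP : forall j, Cc_infty (@unit_cyl R) (psi j).
Local Notation weight := (weight x0 chi r t eps (mix B psi)).

Lemma weight_ord0 : weight ord0 = fun z => chi_at z.1.
Proof. by apply/funext => z; rewrite /Defs.weight unlift_none. Qed.

(** Exhibits the weight as an affine combination of the functions that define the active
    coefficients, so that linearity turns [W] into [W_0 + eps * B g]. *)
Lemma weight_lift al : weight (lift ord0 al) =
  fun z => chi_at z.1 + \sum_j eps * B al j * (chi_at z.1 * rescale (psi j) z).
Proof.
apply/funext => z; rewrite /Defs.weight liftK mulrDr mulr1; congr (_ + _).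
rewrite /Defs.rescale /mix !mulr_sumr; apply: eq_bigr => j _; ring.
Qed.

Lemma supported_weight_weight b : supported_weight K (weight b).
Proof.
case: (unliftP ord0 b) => [al ->|->]; last by rewrite weight_ord0; exact: supported_chi_at.
rewrite weight_lift; split.
  apply: smoothD smooth_chi_at _; apply: smooth_sum => j; apply: smoothZ.
  exact: (supported_active (psiP j)).1.
move=> z Kz; rewrite chi_at_off// add0r big1// => j _.
by rewrite mul0r mulr0.
Qed.

Lemma weight_end b z : ~ (t < z.2 < t + r ^+ 2) -> weight b z = chi_at z.1.
Proof.
move=> zt; case: (unliftP ord0 b) => [al ->|->]; last by rewrite weight_ord0.
by rewrite weight_lift big1 ?addr0// => j _; rewrite rescale_off// !mulr0.
Qed.

End Weights.

Section RegionGeometry.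
Context (R : realType) (x0 : E3 R) (r0 T0 T1 l r a b : R).
Hypotheses (r_gt0 : 0 < r) (ab : a < b).
Local Notation K := (closure (eball x0 r)).
Hypothesis inside : compactly_contained (K `*` `[a, b]%classic) (coarse_region x0 r0 T0 T1 l).

Lemma chain_compact : compact K.
Proof.
have [cc _] := inside.
have c1 : compact (fst @` closure (K `*` `[a, b]%classic)).
  by apply: continuous_compact => //; apply: continuous_subspaceT => z; exact: cvg_fst.
apply: (subclosed_compact _ c1); first exact: closed_closure.
move=> x Kx; exists (x, a) => //; apply: subset_closure; split => //=.
by rewrite in_itv /= lexx ltW.
Qed.

Let in_region x s : K x -> a <= s <= b -> (coarse_region x0 r0 T0 T1 l)° (x, s).
Proof.
have [_ sub] := inside; move=> Kx sab; apply: sub; by apply: subset_closure.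
Qed.

Lemma chain_interior : K `<=` [set x | eball x l `<=` eball x0 (2 * r0)]°.
Proof.
move=> x Kx.
have aab : a <= a <= b by rewrite lexx ltW.
have [[A1 A2] [/= A1x A2a] A12] := in_region Kx aab.
by apply: filterS A1x => y A1y; have [] := A12 (y, a) (conj A1y (nbhs_singleton A2a)).
Qed.

Lemma chain_times : T0 < a /\ b < T1.
Proof.
have Kx0 : K x0 by apply: subset_closure; rewrite /eball /= subrr enorm0.
have aab : a <= a <= b by rewrite lexx ltW.
have bab : a <= b <= b by rewrite lexx ltW.
have [_ /andP[Ta _]] := interior_subset (in_region Kx0 aab).
by have [_ /andP[_ bT]] := interior_subset (in_region Kx0 bab).
Qed.

End RegionGeometry.

(** * Smallest singular value and selection of an index *)

Section SmallestSingularValue.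
Context (R : realType) (n : nat) (B : 'M[R]_n.+1).
Let M : 'M[R]_n.+1 := B^T *m B.
Let form (A : 'M[R]_n.+1) (v w : 'rV[R]_n.+1) : R := (v *m A *m w^T) 0 0.
Let sq (v : 'rV[R]_n.+1) : R := form 1%:M v v.

Let formDl A v v' w : form A (v + v') w = form A v w + form A v' w.
Proof. by rewrite /form !mulmxDl mxE. Qed.
Let formDr A v w w' : form A v (w + w') = form A v w + form A v w'.
Proof. by rewrite /form linearD /= mulmxDr mxE. Qed.
Let formZl A c v w : form A (c *: v) w = c * form A v w.
Proof. by rewrite /form -!scalemxAl mxE. Qed.
Let formZr A c v w : form A v (c *: w) = c * form A v w.
Proof. by rewrite /form linearZ /= -scalemxAr mxE. Qed.
Let form_sym A v w : A^T = A -> form A v w = form A w v.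
Proof.
move=> AT; rewrite /form; transitivity ((w *m A *m v^T)^T 0 0); last by rewrite mxE.
by rewrite !trmx_mul trmxK AT mulmxA.
Qed.
Let MT : M^T = M. Proof. by rewrite /M trmx_mul trmxK. Qed.

Let sqE v : sq v = \sum_j v 0 j ^+ 2.
Proof. by rewrite /sq /form mulmx1 mxE; apply: eq_bigr => j _; rewrite mxE expr2. Qed.

Let qE v : form M v v = \sum_i (\sum_j B i j * v 0 j) ^+ 2.
Proof.
have -> : form M v v = ((v *m B^T) *m (v *m B^T)^T) 0 0.
  by rewrite /form /M trmx_mul trmxK !mulmxA.
rewrite mxE; apply: eq_bigr => i _; rewrite [_^T i 0]mxE -expr2 mxE; congr (_ ^+ 2).
by apply: eq_bigr => j _; rewrite mxE mulrC.
Qed.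

Let q_ge0 v : 0 <= form M v v.
Proof. by rewrite qE sumr_ge0// => i _; exact: sqr_ge0. Qed.

Let sq_ge0 v : 0 <= sq v.
Proof. by rewrite sqE sumr_ge0// => i _; exact: sqr_ge0. Qed.

Let continuous_form A : continuous (fun v : 'rV[R]_n.+1 => form A v v).
Proof.
have cc j : continuous (fun v : 'rV[R]_n.+1 => v 0 j) by exact: coord_continuous.
have csum (F : 'I_n.+1 -> 'rV[R]_n.+1 -> R) : (forall j, continuous (F j)) ->
    continuous (fun v => \sum_j F j v).
  move=> cF; elim: (index_enum _) => [|j r IH].
    have -> : (fun v => \sum_(j <- [::]) F j v) = fun=> 0.
      by apply/funext => v; rewrite big_nil.
    exact: cst_continuous.
  have -> : (fun v => \sum_(i <- j :: r) F i v) = (fun v => F j v + \sum_(i <- r) F i v).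
    by apply/funext => v; rewrite big_cons.
  by move=> v; apply: continuousD; [exact: cF|exact: IH].
have -> : (fun v : 'rV[R]_n.+1 => form A v v) =
    (fun v => \sum_j (\sum_i v 0 i * A i j) * v 0 j).
  by apply/funext => v; rewrite /form mxE; apply: eq_bigr => j _; rewrite !mxE.
apply: (csum _) => j v.
apply: (@continuousM R 'rV[R]_n.+1 (fun v : 'rV[R]_n.+1 => \sum_i v 0 i * A i j) (fun v => v 0 j)); last exact: cc.
apply: (csum _) => i {}v.
by apply: (@continuousM R 'rV[R]_n.+1 (fun v : 'rV[R]_n.+1 => v 0 i) (fun=> A i j)); [exact: cc|exact: cst_continuous].
Qed.

Let minimizer : exists2 v0, sq v0 = 1 & forall v, sq v = 1 -> form M v0 v0 <= form M v v.
Proof.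
pose S := [set v | sq v = 1].
have cS : compact S.
  have cbox : compact [set v : 'rV[R]_n.+1 | forall i, `[-1, 1]%classic (v ord0 i)].
    by apply: (@rV_compact R n.+1 (fun=> `[-1, 1]%classic)) => i; exact: segment_compact.
  apply: (subclosed_compact _ cbox).
    have -> : S = sq @^-1` [set 1] by [].
    apply: closed_comp; first by move=> v _; exact: continuous_form.
    exact: closed_eq.
  move=> v; rewrite /S /= sqE => v1 i; rewrite in_itv /= -ler_norml.
  have : v 0 i ^+ 2 <= 1 by rewrite -v1 (bigD1 i)//= lerDl sumr_ge0// => j _; exact: sqr_ge0.
  by rewrite -real_normK ?num_real// expr_le1.
have S0 : S !=set0.
  exists (\row_j (j == 0)%:R); rewrite /S /= sqE (bigD1 0)//= big1 => [|j j0].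
    by rewrite mxE eqxx expr1n addr0.
  by rewrite mxE (negbTE j0) expr0n.
have [c] := @EVT_min_rV R n.+1 (fun v => form M v v) S S0 cS
  (continuous_subspaceT (@continuous_form M)).
rewrite inE => Sc cmin; exists c => // v v1; apply: cmin.
by rewrite inE.
Qed.

Let rayleigh v0 : sq v0 = 1 -> (forall v, sq v = 1 -> form M v0 v0 <= form M v v) ->
  forall v, form M v0 v0 * sq v <= form M v v.
Proof.
move=> v01 vmin v; have [sv|] := ltP 0 (sq v); last first.
  by move=> sv; have -> : sq v = 0; [apply/eqP; rewrite eq_le sv sq_ge0|rewrite mulr0].
pose c := (Num.sqrt (sq v))^-1.
have c2 : c ^+ 2 = (sq v)^-1 by rewrite /c exprVn sqr_sqrtr// ltW.
have h : sq (c *: v) = 1 by rewrite /sq formZl formZr mulrA -expr2 c2 mulVf// gt_eqF.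
have := vmin _ h; rewrite formZl formZr mulrA -expr2 c2 ler_pdivlMl//.
by rewrite mulrC.
Qed.

(* First variation: [f (v0 + s w) >= 0] for every [s] forces the linear term to vanish. *)
Let minimizer_eigen v0 : sq v0 = 1 -> (forall v, sq v = 1 -> form M v0 v0 <= form M v v) ->
  v0 *m M = form M v0 v0 *: v0.
Proof.
move=> v01 vmin; have ray := rayleigh v01 vmin; set mu := form M v0 v0 in ray *.
have T1 : (1%:M : 'M[R]_n.+1)^T = 1%:M by rewrite trmx1.
have lin w : form M v0 w - mu * form 1%:M v0 w = 0.
  set b := _ - _; have f0 s : 0 <= 2 * s * b + s ^+ 2 * (form M w w - mu * sq w).
    have := ray (v0 + s *: w); rewrite -subr_ge0 /sq !(formDl, formDr, formZl, formZr).
    rewrite (form_sym w v0 MT) (form_sym w v0 T1) -/(sq v0) -/(sq w) v01 /b -/mu.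
    by congr (_ <= _); ring.
  set g := form M w w - mu * sq w in f0; have g0 : 0 <= g by rewrite /g subr_ge0.
  have g1 : 0 < 1 + g by rewrite ltr_pwDl.
  (* This [s] replaces the vertex [- b / g] of the parabola and makes sense for [g = 0] too. The
     value there is [b ^+ 2] times a negative number, so [b] must be 0. *)
  have := f0 (- b / (1 + g)).
  have -> : 2 * (- b / (1 + g)) * b + (- b / (1 + g)) ^+ 2 * g =
      - (b ^+ 2 * ((2 + g) / (1 + g) ^+ 2)) by field; rewrite gt_eqF.
  have c0 : 0 < (2 + g) / (1 + g) ^+ 2 by rewrite divr_gt0 ?exprn_gt0// ltr_pwDl.
  rewrite oppr_ge0 pmulr_lle0// => b0.
  by apply/eqP; rewrite -sqrf_eq0 eq_le b0 sqr_ge0.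
apply/eqP; rewrite -subr_eq0; apply/eqP.
(* The first variation in the direction of the residual [x] itself is its squared norm. *)
set x := v0 *m M - _; have : sq x = 0.
  rewrite /sq; have -> : form 1%:M x x = form M v0 x - mu * form 1%:M v0 x; last exact: lin.
  rewrite /form !mulmx1 {1}/x mulmxBl -scalemxAl.
  have sub (X Y : 'M[R]_1) : (X - Y) 0 0 = X 0 0 - Y 0 0 by rewrite !mxE.
  have scale (X : 'M[R]_1) : (mu *: X) 0 0 = mu * X 0 0 by rewrite mxE.
  by rewrite sub scale.
move/eqP; rewrite sqE psumr_eq0 => [/allP x0|j _]; last exact: sqr_ge0.
apply/rowP => j; have := x0 j (mem_index_enum j); rewrite sqrf_eq0 => /eqP ->.
by rewrite mxE.
Qed.

(** Let [mu] be the minimum of [|B v|^2] on the unit sphere. A minimizer is an eigenvector of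
    [B^T B], so the square root of [mu] is a singular value; hence the infimum is at most it, and
    homogeneity extends the bound to all [v]. *)
Lemma sigma_min_spec : 0 <= sigma_min B /\ forall v : 'I_n.+1 -> R,
  sigma_min B ^+ 2 * \sum_j v j ^+ 2 <= \sum_i (\sum_j B i j * v j) ^+ 2.
Proof.
have [v0 v01 vmin] := minimizer; set mu := form M v0 v0.
have mu0 : 0 <= mu by exact: q_ge0.
have smu : singular_values B (Num.sqrt mu).
  split; first exact: sqrtr_ge0.
  rewrite sqr_sqrtr//; apply/eigenvalueP; exists v0; first exact: minimizer_eigen.
  by apply/eqP => v00; move: v01; rewrite v00 sqE big1 => [/eqP|j _];
    [rewrite eq_sym oner_eq0|rewrite mxE expr0n].
have lb0 : lbound (singular_values B) 0 by move=> s [].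
have s0 : 0 <= sigma_min B by apply: lb_le_inf => //; exists (Num.sqrt mu).
have smu2 : sigma_min B ^+ 2 <= mu.
  rewrite -[leRHS]sqr_sqrtr// lerXn2r// ?nnegrE ?sqrtr_ge0//.
  by apply: ge_inf => //; exists 0.
split => // v.
have := rayleigh v01 vmin (\row_j v j); rewrite sqE (qE (\row_j v j)) -/mu => ray.
have E1 : \sum_j (\row_j v j) 0 j ^+ 2 = \sum_j v j ^+ 2 by apply: eq_bigr => j _; rewrite mxE.
have E2 : \sum_i (\sum_j B i j * (\row_j v j) 0 j) ^+ 2 = \sum_i (\sum_j B i j * v j) ^+ 2.
  by apply: eq_bigr => i _; congr (_ ^+ 2); apply: eq_bigr => j _; rewrite mxE.
rewrite -E2 -E1; apply: le_trans ray; apply: ler_wpM2r => //.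
by apply: sumr_ge0 => j _; exact: sqr_ge0.
Qed.

End SmallestSingularValue.

Lemma sigma_min_le (R : realType) m (B : 'M[R]_m) (v : 'I_m -> R) : (0 < m)%N ->
  0 <= sigma_min B /\
  sigma_min B ^+ 2 * \sum_j v j ^+ 2 <= \sum_i (\sum_j B i j * v j) ^+ 2.
Proof.
by case: m B v => [//|n] B v _; have [? h] := sigma_min_spec B; split.
Qed.

(* If every [W i] were small, the differences [W i - W 0] would be too small to carry
   [B g], whose norm is at least [sigma_min B] times that of [g]. *)
Lemma selection_exists (R : realType) m (B : 'M[R]_m) (eps : R) (g : 'I_m -> R)
    (W : 'I_m.+1 -> R) : (0 < m)%N -> 0 < eps ->
  (forall al, W (lift ord0 al) = W ord0 + \sum_j eps * B al j * g j) ->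
  exists b, eps / (2 * Num.sqrt m%:R) * sigma_min B * Num.sqrt (\sum_j g j ^+ 2) <= `|W b|.
Proof.
move=> m0 e0 WE; have [s0 sB] := sigma_min_le B g m0.
set s := sigma_min B in s0 sB *; set G := \sum_j g j ^+ 2 in sB *.
have G0 : 0 <= G by apply: sumr_ge0 => j _; exact: sqr_ge0.
have mr0 : 0 < m%:R :> R by rewrite ltr0n.
set sm := Num.sqrt (m%:R : R); have sm0 : 0 < sm by rewrite sqrtr_gt0.
have sm2 : sm ^+ 2 = m%:R by rewrite sqr_sqrtr// ltW.
set c := _ * _ * _; apply: contrapT => /forallNP small.
have Wc b : `|W b| < c by rewrite ltNge; apply/negP; exact: small.
(* Failure of the conclusion already forces [c > 0], so a vanishing [g] or [sigma_min B] calls for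
   no separate case. *)
have c0 : 0 < c by apply: le_lt_trans (Wc ord0).
have c20 : 0 <= 2 * c by rewrite mulr_ge0// ltW.
have d al : (eps * \sum_j B al j * g j) ^+ 2 < 4 * c ^+ 2.
  have -> : eps * (\sum_j B al j * g j) = W (lift ord0 al) - W ord0.
    by rewrite WE addrAC subrr add0r mulr_sumr; apply: eq_bigr => j _; rewrite mulrA.
  have -> : 4 * c ^+ 2 = (2 * c) ^+ 2 by ring.
  rewrite -real_normK ?num_real// ltrXn2r// ?nnegrE//.
  apply: le_lt_trans (ler_normB _ _) _.
  by rewrite mulrC mulr_natr mulr2n ltrD.
have : \sum_(al < m) (eps * \sum_j B al j * g j) ^+ 2 < \sum_(al < m) 4 * c ^+ 2.
  apply: ltr_sum => [|al _]; last exact: d.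
  by apply/hasP; exists (Ordinal m0) => //; exact: mem_index_enum.
rewrite sumr_const card_ord -[X in _ < X]mulr_natr.
under eq_bigr do rewrite exprMn.
rewrite -mulr_sumr => /(le_lt_trans (ler_wpM2l (sqr_ge0 eps) sB)).
(* The denominator [2 * sqrt m] in the constant is made for this: [m] times [(2 c)^2] is exactly
   [eps^2 s^2 G], and the strict inequality contradicts itself. *)
have -> : 4 * c ^+ 2 * m%:R = eps ^+ 2 * (s ^+ 2 * G).
  rewrite /c !exprMn exprVn exprMn sm2 sqr_sqrtr//.
  by field; rewrite gt_eqF.
by rewrite ltxx.
Qed.

(** * Comparison of the CKN quantities *)

Section Threshold.
Context (R : realType).
Local Notation leb3 := (Defs.leb3 R).
Local Notation leb4 := (Defs.leb4 R).

(** The constant [4 = 2^{3-1}] of the cube, recovered from a quadratic bound by comparing squares: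
    [16 (a^3 + b^3)^2 - 8 (a^2 + b^2)^3] is [(a - b)^2] times a polynomial with nonnegative
    coefficients. *)
Lemma cube_le (n a b : R) : 0 <= n -> 0 <= a -> 0 <= b ->
  n ^+ 2 <= 2 * (a ^+ 2 + b ^+ 2) -> n ^+ 3 <= 4 * (a ^+ 3 + b ^+ 3).
Proof.
move=> n0 a0 b0 nab.
have ab0 : 0 <= 4 * (a ^+ 3 + b ^+ 3) by rewrite mulr_ge0// addr_ge0// exprn_ge0.
rewrite -(@ler_pXn2r _ 2)// ?nnegrE ?exprn_ge0// -exprM mulnC exprM.
have h : (n ^+ 2) ^+ 3 <= (2 * (a ^+ 2 + b ^+ 2)) ^+ 3.
  by rewrite lerXn2r// ?nnegrE ?sqr_ge0// (le_trans _ nab)// sqr_ge0.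
apply: (le_trans h); rewrite -subr_ge0.
have -> : (4 * (a ^+ 3 + b ^+ 3)) ^+ 2 - (2 * (a ^+ 2 + b ^+ 2)) ^+ 3 =
  8 * ((a - b) ^+ 2 * (a ^+ 4 + 2 * (a ^+ 3 * b) + 2 * (a * b ^+ 3) + b ^+ 4)) by ring.
by rewrite mulr_ge0// mulr_ge0 ?sqr_ge0// !addr_ge0 ?mulr_ge0 ?exprn_ge0.
Qed.

(** The same factor as for the cube is enough: [|x + y|] is at most twice the larger modulus, and
    [2^{3/2} <= 2^2]. *)
Lemma powR_32_le (x y : R) : `|x + y| `^ (3 / 2) <= 4 * (`|x| `^ (3 / 2) + `|y| `^ (3 / 2)).
Proof.
wlog xy : x y / `|x| <= `|y|.
  move=> h; have [/h//|/ltW/h] := leP `|x| `|y|.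
  by rewrite addrC [in X in _ <= X -> _]addrC.
apply: (@le_trans _ _ ((2 * `|y|) `^ (3 / 2))).
  apply: ge0_ler_powR; rewrite ?nnegrE// ?mulr_ge0//.
  by rewrite (le_trans (ler_normD _ _))// mulrC mulr_natr mulr2n lerD2r.
rewrite powRM//; apply: ler_pM; rewrite ?powR_ge0//; last by rewrite lerDr powR_ge0.
have -> : 4 = 2 `^ 2 :> R by rewrite (powR_mulrn 2)//; ring.
by apply: ler_powR; [rewrite ler1n|lra].
Qed.

Definition ckn_density (v : vfield R) (q : spacetime R -> R) x0 r z : R :=
  Num.sqrt (sqnorm v z) ^+ 3 + `|subtract_mean x0 r q z| `^ (3 / 2).

Lemma ckn_density_ge0 v q x0 r z : 0 <= ckn_density v q x0 r z.
Proof. by rewrite addr_ge0 ?powR_ge0// exprn_ge0// sqrtr_ge0. Qed.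

Lemma measurable_ckn_density v q x0 r : (forall i, measurable_fun setT (v i)) ->
  measurable_fun setT q -> measurable_fun setT (ckn_density v q x0 r).
Proof.
move=> mv mq; apply: measurable_funD.
  apply: measurable_funX; apply: (measurableT_comp (f := @Num.sqrt R)).
    by apply: continuous_measurable_fun; exact: sqrt_continuous.
  by apply: measurable_sum => i; apply: measurable_funX.
apply: (measurableT_comp (measurable_powR _)); apply: measurableT_comp => //.
apply: measurable_funB => //; apply: measurable_funM => //.
have m1 : measurable_fun setT (fun t => \int[leb3]_y (\1_(eball x0 r) y * q (y, t))).
  apply: (@measurable_Rintegral1 _ _ _ _ _ (sleb3 R) (fun z : spacetime R => \1_(eball x0 r) z.1 * q z)).
  have mi : measurable_fun setT (\1_(eball x0 r) : E3 R -> R).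
    by apply: measurable_indic; exact: measurable_eball.
  by apply: measurable_funM => //; exact: (measurableT_comp mi measurable_fst).
have -> : (fun z : spacetime R => \int[leb3]_(y in eball x0 r) q (y, z.2)) =
    (fun t => \int[leb3]_y (\1_(eball x0 r) y * q (y, t))) \o snd.
  by apply/funext => z /=; rewrite (rintegral_indicM leb3 (eball x0 r)).
exact: measurableT_comp.
Qed.

Let alg (a1 a2 a3 b1 b2 b3 : R) : a1 <= 4 * (a2 + a3) -> b1 <= 4 * (b2 + b3) ->
  a1 + b1 <= 4 * ((a2 + b2) + (a3 + b3)).
Proof. by lra. Qed.

Lemma ckn_triangle v w q s x0 t0 r :
  (forall i, measurable_fun setT (v i)) -> (forall i, measurable_fun setT (w i)) ->
  measurable_fun setT q -> measurable_fun setT s ->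
  (forall t, leb3.-integrable (eball x0 r) (EFin \o (fun y => q (y, t)))) ->
  (forall t, leb3.-integrable (eball x0 r) (EFin \o (fun y => s (y, t)))) ->
  (ckn v q x0 t0 r <= 4%:E * (ckn w s x0 t0 r
    + ckn (fun i z => v i z - w i z)%R (fun z => q z - s z)%R x0 t0 r))%E.
Proof.
move=> mv mw mq ms iq is_.
set d := fun i z => v i z - w i z; set e := fun z => q z - s z.
have md i : measurable_fun setT (d i) by exact: measurable_funB.
have me : measurable_fun setT e by exact: measurable_funB.
have mD f g : (forall i, measurable_fun setT (f i)) -> measurable_fun setT g ->
    measurable_fun (cyl x0 t0 r) (EFin \o ckn_density f g x0 r).
  move=> mf mg; apply/measurable_EFinP; apply: measurable_funS measurableT _ _ => //.
  exact: measurable_ckn_density.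
have mC : measurable (cyl x0 t0 r).
  by apply: measurableX; [exact: measurable_eball|exact: measurable_itv].
have le4 z : ckn_density v q x0 r z <= 4 * (ckn_density w s x0 r z + ckn_density d e x0 r z).
  have L1 : Num.sqrt (sqnorm v z) ^+ 3 <=
      4 * (Num.sqrt (sqnorm w z) ^+ 3 + Num.sqrt (sqnorm d z) ^+ 3).
    have s0 (f : vfield R) : 0 <= sqnorm f z by apply: sumr_ge0 => i _; exact: sqr_ge0.
    apply: cube_le; rewrite ?sqrtr_ge0// !sqr_sqrtr//.
    rewrite /sqnorm -big_split /= mulr_sumr; apply: ler_sum => i _; rewrite /d.
    (* [2 w^2 + 2 (v - w)^2 - v^2] is the square [(2 w - v)^2]. *)
    have := sqr_ge0 (2 * w i z - v i z); nra.
  (* The mean is additive only where the slice integrals are genuine; the integrability hypotheses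
     on the slices of [q] and [s] secure this. *)
  have L2 : subtract_mean x0 r q z = subtract_mean x0 r s z + subtract_mean x0 r e z.
    rewrite /subtract_mean /e RintegralB//; last exact: measurable_eball.
    by ring.
  have := powR_32_le (subtract_mean x0 r s z) (subtract_mean x0 r e z); rewrite -L2 => L3.
  exact (alg L1 L3).
have r2 : (0 <= (r ^- 2)%:E)%E by rewrite lee_fin invr_ge0 sqr_ge0.
have D0 f g z : (0 <= (EFin \o ckn_density f g x0 r) z)%E.
  by rewrite lee_fin ckn_density_ge0.
have I0 f g : (0 <= \int[leb4]_(z in cyl x0 t0 r) (EFin \o ckn_density f g x0 r) z)%E.
  exact: integral_ge0.
have key : (\int[leb4]_(z in cyl x0 t0 r) (EFin \o ckn_density v q x0 r) z <=
    4%:E * (\int[leb4]_(z in cyl x0 t0 r) (EFin \o ckn_density w s x0 r) z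
      + \int[leb4]_(z in cyl x0 t0 r) (EFin \o ckn_density d e x0 r) z))%E.
  rewrite -ge0_integralD//; [|exact: mD|exact: mD].
  rewrite -ge0_integralZl_EFin//; last 2 first.
  - by move=> z _; rewrite adde_ge0.
  - by apply: emeasurable_funD; exact: mD.
  apply: ge0_le_integral => //.
  - exact: mD.
  - by apply: measurable_funeM; apply: emeasurable_funD; exact: mD.
  - by move=> z _; rewrite /= -EFinD -EFinM lee_fin.
have := lee_wpmul2l r2 key.
rewrite muleCA [X in (_ <= 4%:E * X)%E -> _]ge0_muleDr//.
Qed.

(** The mean over the ball depends on the whole slice, so the pressures have to agree throughout the
    ball at almost every time. *)
Lemma ckn_congr v q v' q' x0 t0 r :
  {ae leb4, forall z, cyl x0 t0 r z -> (forall i, v i z = v' i z) /\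
     forall y, eball x0 r y -> q (y, z.2) = q' (y, z.2)} ->
  ckn v q x0 t0 r = ckn v' q' x0 t0 r.
Proof.
move=> vq; apply: (congr1 (fun e => ((r ^- 2)%:E * e)%E)).
apply: (@ae_eq_integral_nomeas _ _ _ leb4 _
  (EFin \o ckn_density v q x0 r) (EFin \o ckn_density v' q' x0 r)).
apply: ae_imply vq => -[x t] h xt; have [hv hq] := h xt.
have [/= xr _] := xt; apply: (congr1 EFin); rewrite /ckn_density.
have -> : sqnorm v (x, t) = sqnorm v' (x, t) by apply: eq_bigr => i _; rewrite hv.
have -> // : subtract_mean x0 r q (x, t) = subtract_mean x0 r q' (x, t).
rewrite /subtract_mean /= (hq x xr); congr (_ - _ * _).
by apply: eq_Rintegral => y; rewrite inE; exact: hq.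
Qed.

End Threshold.

Section CoarseThreshold.
Context (R : realType).
Variables (B0 : set (E3 R)) (T0 T1 C : R) (u : vfield R) (p : spacetime R -> R).
Hypothesis st : ns_setting B0 T0 T1 C u p.
Variables (l : R) (rho : E3 R -> R).
Hypotheses (l_gt0 : 0 < l) (rhoP : mollifier rho).
Local Notation k := (moll rho l).
Local Notation good := (good_time B0 T0 T1 C u p).
Local Notation tu := (tu B0 T0 T1 C u p).
Local Notation tp := (tp B0 T0 T1 C u p).
Local Notation pk := (coarse_package rho l u p).
Local Notation cU := (cU k tu).
Local Notation cP := (cP k tp).
Variables (x0 : E3 R) (t0 r : R).
Hypothesis cylV : cyl x0 t0 r `<=` [set z | eball z.1 l `<=` B0 /\ T0 < z.2 < T1].

Let kl : Cc_infty (eball 0 l) k. Proof. exact: Cc_infty_moll. Qed.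
Let tut := tu_tame (ns_open st) (ns_finite st) (ns_C st) (ns_mu st) (ns_mp st).
Let tpt := tp_tame C (ns_open st) (ns_mu st) (ns_mp st).

Let ae_cyl : {ae Defs.leb4 R, forall z, cyl x0 t0 r z -> good z.2 /\
  forall y, eball x0 r y -> B0 y /\ eball y l `<=` B0}.
Proof.
have := ae_prod_snd (sleb3 R) (ae_good st).
apply: ae_imply => -[x t] /= gt xt; have [/= xr tr] := xt.
have [_ /= tT] := cylV xt; split; first exact: gt.
move=> y yr; have [/= yV _] := @cylV (y, t) (conj yr tr).
by split => //; apply: yV; rewrite /eball /= subrr enorm0.
Qed.

Let trunc_inside f y t : good t -> B0 y -> trunc B0 T0 T1 C u p f (y, t) = f (y, t).
Proof. by move=> gt By; rewrite trunc_good// indicE mem_set// mul1r. Qed.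

(** All three quantities are rewritten with truncated fields, which are measurable on all of
    space-time and whose pressures are integrable over the ball at every time, as [ckn_triangle]
    demands. *)
Theorem ckn_coarse_bound : (ckn u p x0 t0 r <=
  4%:E * (Psi_coarse pk x0 t0 r + Omega u p pk x0 t0 r))%E.
Proof.
have -> : ckn u p x0 t0 r = ckn tu tp x0 t0 r.
  apply: ckn_congr; apply: ae_imply ae_cyl => -[x t] h xt; have [gt By] := h xt.
  have [xr _] := xt; split; last by move=> y /By[B0y _]; rewrite /tp trunc_inside.
  by move=> i; rewrite /tu trunc_inside//; exact: (By x xr).1.
have -> : Psi_coarse pk x0 t0 r = ckn cU cP x0 t0 r.
  apply: ckn_congr; apply: ae_imply ae_cyl => -[x t] h xt; have [gt By] := h xt.
  have [xr _] := xt; split; last by move=> y /By[_ yV]; exact (pkP_trunc l_gt0 rhoP yV gt).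
  by move=> i; exact (pkU_trunc l_gt0 rhoP i (By x xr).2 gt).
have -> : Omega u p pk x0 t0 r =
    ckn (fun i z => tu i z - cU i z) (fun z => tp z - cP z) x0 t0 r.
  apply: ckn_congr; apply: ae_imply ae_cyl => -[x t] h xt; have [gt By] := h xt.
  have [xr _] := xt; split.
    move=> i; have [B0x xV] := By x xr.
    exact (congr2 (fun s t => s - t) (esym (trunc_inside (u i) gt B0x))
      (pkU_trunc l_gt0 rhoP i xV gt)).
  move=> y /By[B0y yV].
  exact (congr2 (fun s t => s - t) (esym (trunc_inside p gt B0y))
    (pkP_trunc l_gt0 rhoP yV gt)).
have [mtp itp _] := tpt.
have mcP := tame_conv_measurable kl tpt.
apply: ckn_triangle => //.
- by move=> i; have [] := tut i.
- by move=> i; exact (tame_conv_measurable kl (tut i)).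
- by move=> t; apply: integrableS (itp t) => //; exact: measurable_eball.
- move=> t; apply/(@rintegrable_indicM _ _ R (sleb3 R) _ (fun y => cP (y, t)) (measurable_eball x0 r)).
  have [C' [C'0 cPC]] := tame_conv_bound kl tpt.
  under eq_fun do rewrite mulrC.
  apply: (@rintegrable_bdM _ _ R (sleb3 R) (C' * pressure_mass B0 T0 T1 C u p t)).
  + exact: (measurable_fun_pair1 (f := cP)).
  + by move=> y; exact (cPC (y, t)).
  + by apply: rintegrable_indic; [exact: measurable_eball|exact: eball_finite].
Qed.

End CoarseThreshold.

(** * Assembling the chain *)

Lemma threshold_arith (R : realType) (X Y Z : \bar R) (eps0 eta : R) :
  Y \is a fin_num -> Z \is a fin_num -> (X <= 4%:E * (Y + Z))%E ->
  (eps0%:E <= X)%E -> (Z <= (eta * eps0)%:E)%E -> (((4^-1 - eta) * eps0)%:E <= Y)%E.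
Proof.
move=> /fineK <- /fineK <-; set y := fine Y; set z := fine Z.
rewrite -EFinD -EFinM => XYZ /le_trans/(_ XYZ); rewrite !lee_fin => e1 e2.
by move: y z e1 e2 {XYZ} => y z e1 e2; lra.
Qed.

(** The telescope is inexact: [b i] and [a i.+1] stand for energies at the same time seen through
    the weights of two successive slabs, linked only by an inequality. *)
Lemma telescope_le (R : realType) (N : nat) (a b : nat -> R) : 0 <= a 0%N ->
  (forall i, (i < N)%N -> 0 <= b i) -> (forall i, (i.+1 < N)%N -> a i.+1 <= b i) ->
  \sum_(i < N) (a i - b i) <= a 0%N.
Proof.
move=> a0 b0 ab; case: N b0 ab => [|N] b0 ab; first by rewrite big_ord0.
suff h n : (n <= N)%N -> \sum_(i < n.+1) (a i - b i) <= a 0%N - b n.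
  by apply: le_trans (h N (leqnn _)) _; rewrite gerBl b0.
elim: n => [|n IH] nN; first by rewrite big_ord_recl big_ord0 addr0.
rewrite big_ord_recr /=; apply: le_trans (lerD (IH (ltnW nN)) (lexx _)) _.
by have := ab n nN; lra.
Qed.

Section ChainSlab.
Context (R : realType) (x0 : E3 R) (r0 T0 T1 C : R) (u : vfield R) (p : spacetime R -> R).
Hypothesis st : ns_setting (eball x0 (2 * r0)) T0 T1 C u p.
Variables (l : R) (rho chi : E3 R -> R).
Hypotheses (l_gt0 : 0 < l) (rhoP : mollifier rho) (chiP : cutoff chi).
Local Notation pk := (coarse_package rho l u p).

Definition chain_energy (r t : R) : R :=
  \int[Defs.leb3 R]_x (2^-1 * sqnorm (pkU pk) (x, t) * chi_at x0 chi r x).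

Lemma chain_energy_ge0 r t : 0 <= chain_energy r t.
Proof.
apply: Rintegral_ge0 => x _; apply: mulr_ge0; last exact: chi_at_ge0.
by apply: mulr_ge0 => //; apply: sumr_ge0 => i _; exact: sqr_ge0.
Qed.

Variables (r a b : R).
Hypotheses (r_gt0 : 0 < r) (abE : b - a = r ^+ 2).
Hypothesis inside : compactly_contained (closure (eball x0 r) `*` `[a, b]%classic)
  (coarse_region x0 r0 T0 T1 l).
Local Notation K := (closure (eball x0 r)).

Let bE : b = a + r ^+ 2. Proof. by rewrite -abE addrC subrK. Qed.
Let ab : a < b. Proof. by rewrite -subr_gt0 abE exprn_gt0. Qed.
Let cK : compact K. Proof. exact: (chain_compact ab inside). Qed.
Let KV : K `<=` [set x | eball x l `<=` eball x0 (2 * r0)]°.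
Proof. exact (chain_interior ab inside). Qed.
Let KB x : K x -> eball x l `<=` eball x0 (2 * r0). Proof. by move=> /KV/interior_subset. Qed.
Let Tab : T0 < a /\ b < T1. Proof. exact (chain_times r_gt0 ab inside). Qed.
Let kl : Cc_infty (eball 0 l) (moll rho l). Proof. exact: Cc_infty_moll. Qed.

Lemma chain_energy_integrable t : a <= t <= b ->
  rintegrable (Defs.leb3 R) (fun x => 2^-1 * sqnorm (pkU pk) (x, t) * chi_at x0 chi r x).
Proof.
have [Ta bT] := Tab; move=> /andP[at_ tb].
have [sc cK0] := supported_chi_at x0 chiP r_gt0.
apply: (energy_integrable st l_gt0 kl cK KB sc cK0).
by rewrite (lt_le_trans Ta at_) (le_lt_trans tb bT).
Qed.

Variables (m : nat) (eps : R) (B : 'M[R]_m) (psi : 'I_m -> spacetime R -> R).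
Hypothesis psiP : forall j, Cc_infty (@unit_cyl R) (psi j).
Local Notation phi := (weight x0 chi r a eps (mix B psi)).

Lemma chain_balance i : calW pk r a b (phi i) + calD pk r a b (phi i) =
  calL pk r a b (phi i) + r^-1 * chain_energy r a - r^-1 * chain_energy r b.
Proof.
have [Ta bT] := Tab.
have [sphi phiK] := supported_weight_weight x0 a chiP r_gt0 eps B psiP i.
have [mm box] := eball_box x0 (2 * r0).
rewrite (slab_balance st chiP l_gt0 rhoP cK KV ab Ta bT sphi phiK box r).
have E t : ~ (a < t < b) ->
    \int[sleb3 R]_x energy (phi i) (pkU pk) t x = chain_energy r t.
  move=> tab; apply: eq_Rintegral => x _; rewrite /energy (weight_end x0 chi r_gt0)//=.
  by rewrite -bE.
by rewrite !E// ltxx ?andbF.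
Qed.

Local Notation g j := (r^-1 * pairing_G pk (fun z => chi_at x0 chi r z.1 * rescale x0 r a (psi j) z)).

Lemma chain_selection : (0 < m)%N -> 0 < eps -> exists i,
  eps / (2 * Num.sqrt m%:R) * sigma_min B * active_norm x0 chi r a pk psi
    <= `|calW pk r a b (phi i)|.
Proof.
move=> m0 e0; have [Ta bT] := Tab.
have ag := agree_trunc st l_gt0 rhoP KV Ta bT.
have iPi := phiPi_integrable st l_gt0 rhoP a b cK KV.
have iP := Ptransport_integrable st l_gt0 rhoP a b cK KV.
apply: (selection_exists (g := fun j => g j) (W := fun i => calW pk r a b (phi i))) => // al.
rewrite weight_lift weight_ord0.
rewrite (calW_comb ag cK iPi iP r (fun j => eps * B al j)
  (supported_chi_at x0 chiP r_gt0) (fun j => supported_active x0 a chiP r_gt0 (psiP j))).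
congr (_ + _); apply: eq_bigr => j _; congr (_ * _).
apply: (calW_pairing ag cK iPi iP r (supported_active x0 a chiP r_gt0 (psiP j))) => z zab.
by rewrite (rescale_off x0 r_gt0 (psiP j)) ?mulr0// -bE.
Qed.

End ChainSlab.

(** The chain weight [r / r0] cancels the normalization [r^-1] of the energies and leaves [r0^-1],
    the same for all slabs; only then can they telescope. *)
Lemma weighted_step (F : fieldType) (r r0 L a b : F) : r != 0 -> r0 != 0 ->
  r / r0 * (L + r^-1 * a - r^-1 * b) = r / r0 * L + r0^-1 * (a - b).
Proof. by move=> r_neq0 r0_neq0; field; rewrite ?r_neq0 ?r0_neq0. Qed.

Theorem theorem5p1 (R : realType)
  (x0 : E3 R) (r0 T0 T1 : R) (u : vfield R) (p : spacetime R -> R)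
  (r0_gt0 : 0 < r0)
  (u_suitable : suitable_weak_solution (eball x0 (2 * r0)) T0 T1 u p)
  (u_wcont : weakly_continuous (eball x0 (2 * r0)) T0 T1 u)
  (rho : E3 R -> R) (l : R) (rhoP : mollifier rho) (l_gt0 : 0 < l)
  (N : nat) (theta : R) (tau : nat -> R) (chi : E3 R -> R)
  (thetaP : 0 < theta < 1) (chiP : cutoff chi) :
  let pk := coarse_package rho l u p in
  let region := coarse_region x0 r0 T0 T1 l in
  let r (k : nat) := theta ^+ k * r0 in
  forall
  (tauP : forall k : 'I_N, tau k.+1 - tau k = r k ^+ 2)
  (chain_inside : forall k : 'I_N, compactly_contained
     (closure (eball x0 (r k)) `*` `[tau k, tau k.+1]%classic) region)
  (m : 'I_N -> nat) (psi : forall k, 'I_(m k) -> spacetime R -> R)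
  (B : forall k, 'M[R]_(m k)) (eps : 'I_N -> R)
  (m_gt0 : forall k, (1 <= m k)%N)
  (psiP : forall k j, Cc_infty unit_cyl (psi k j))
  (B_unit : forall k, B k \in unitmx)
  (eps_gt0 : forall k, 0 < eps k)
  (eps_small : forall k, ((eps k)%:E *
     \big[maxe/0]_(al < m k) Linfty (mix (B k) (psi k) al) <= (2^-1)%:E)%E),
  let A (k : 'I_N) (pk' : package R) :=
    active_norm x0 chi (r k) (tau k) pk' (psi k) in
  let phi (k : 'I_N) := weight x0 chi (r k) (tau k) (eps k) (mix (B k) (psi k)) in
  let c (k : 'I_N) := eps k / (2 * Num.sqrt (m k)%:R) * sigma_min (B k) in
  let selected (k : 'I_N) (b : 'I_(m k).+1) :=
    c k * A k pk <= `|calW pk (r k) (tau k) (tau k.+1) (phi k b)| in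
  forall
  (S : {set 'I_N}) (t0 : R)
  (ckn_defined : forall k, k \in S ->
     [/\ cyl x0 t0 (r k) `<=` region,
         ckn u p x0 t0 (r k) \is a fin_num,
         Psi_coarse pk x0 t0 (r k) \is a fin_num &
         Omega u p pk x0 t0 (r k) \is a fin_num])
  (eps0 eta a0 : R) (eps0_gt0 : 0 < eps0) (etaP : 0 < eta < 4^-1)
  (a0_gt0 : 0 < a0),
  let c0 := 4^-1 - eta in
  forall
  (cls : set (package R))
  (clsP : forall pk', cls pk' -> forall k, k \in S ->
     ((c0 * eps0)%:E <= Psi_coarse pk' x0 t0 (r k))%E -> a0 <= A k pk')
  (pk_cls : cls pk),
  (forall k, exists b, selected k b) /\
  forall (beta : forall k, 'I_(m k).+1) (betaP : forall k, selected k (beta k)),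
  let W (k : 'I_N) := calW pk (r k) (tau k) (tau k.+1) (phi k (beta k)) in
  let D (k : 'I_N) := calD pk (r k) (tau k) (tau k.+1) (phi k (beta k)) in
  let L (k : 'I_N) := calL pk (r k) (tau k) (tau k.+1) (phi k (beta k)) in
  let Wp (k : 'I_N) := Num.max (W k) 0 in
  let Wm (k : 'I_N) := Num.max (- W k) 0 in
  let w (k : 'I_N) := r k / r0 in
  (forall k, k \in S ->
     (eps0%:E <= ckn u p x0 t0 (r k))%E ->
     (Omega u p pk x0 t0 (r k) <= (eta * eps0)%:E)%E ->
     c k * a0 <= `|W k| /\ (c k * a0 <= Wp k \/ c k * a0 <= Wm k)) /\
  \sum_(k < N) w k * (Wp k + D k) <=
    initial_energy x0 chi r0 (tau 0%N) pk
    + \sum_(k < N) w k * `|L k| + \sum_(k < N) w k * Wm k.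
Proof.
move=> pk region r tauP chain_inside m psi B eps m_gt0 psiP B_unit eps_gt0 eps_small.
move=> A phi c selected S t0 ckn_defined eps0 eta a0 eps0_gt0 etaP a0_gt0 c0 cls clsP pk_cls.
have [Du [[C uC] [mu _ _ _ _] [mp pL] NS _]] := u_suitable.
(* The uniform bound comes without a sign, while [ns_setting] wants it nonnegative. *)
have st : ns_setting (eball x0 (2 * r0)) T0 T1 `|C| u p.
  split => //; [exact: open_eball|exact: eball_finite|].
  apply: ae_imply uC => t uCt /uCt/le_trans; apply.
  by rewrite lee_fin ler_norm.
have [theta_gt0 theta_lt1] := andP thetaP.
have r_gt0 k : 0 < r k by rewrite /r mulr_gt0// exprn_gt0.
have balance (k : 'I_N) b := chain_balance st l_gt0 rhoP chiP (r_gt0 k) (tauP k) (chain_inside k)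
  (eps k) (B k) (psiP k) b.
split=> [k|beta betaP W D L Wp Wm w].
  exact (chain_selection st l_gt0 rhoP chiP (r_gt0 k) (tauP k) (chain_inside k)
    (B k) (psiP k) (m_gt0 k) (eps_gt0 k)).
have WE k : W k = Wp k - Wm k.
  rewrite /Wp /Wm; have [Wk|Wk] := leP (W k) 0.
    by rewrite max_l ?oppr_ge0// sub0r opprK.
  by rewrite max_r ?subr0// oppr_le0 ltW.
split=> [k kS large small|].
  have [cylR _ PsiF OmF] := ckn_defined k kS.
  have bound := ckn_coarse_bound st l_gt0 rhoP cylR.
  have a0A := clsP pk pk_cls k kS (threshold_arith PsiF OmF bound large small).
  have c_ge0 : 0 <= c k.
    rewrite /c mulr_ge0//; last by have [] := sigma_min_le (B k) (fun=> 0) (m_gt0 k).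
    by rewrite divr_ge0 ?mulr_ge0 ?sqrtr_ge0// ltW.
  have ca0 : c k * a0 <= `|W k| by apply: le_trans (betaP k); exact: ler_wpM2l.
  split => //; move: ca0; rewrite /Wp /Wm; have [Wk|Wk] := leP 0 (W k).
    by rewrite ger0_norm// => ca0; left; rewrite ?le_max ca0.
  by rewrite ltr0_norm// => ca0; right; rewrite ?le_max ca0.
(* [en i j] is the energy at time [tau j] seen through the cutoff of scale [i]; slab [k] leads from
   [en k k] to [en k k.+1], and passing on to the next slab changes the cutoff only. *)
pose en (i j : nat) := chain_energy x0 u p l rho chi (r i) (tau j).
have step (k : 'I_N) : w k * (W k + D k) = w k * L k + r0^-1 * (en k k - en k k.+1).
  rewrite /W /D balance -/(L k) -/(en k k) -/(en k k.+1) /w.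
  exact (weighted_step _ _ _ (lt0r_neq0 (r_gt0 k)) (lt0r_neq0 r0_gt0)).
have tele : \sum_(k < N) (en k k - en k k.+1) <= en 0 0.
  apply: (telescope_le (a := fun i => en i i) (b := fun i => en i i.+1)).
  - exact: chain_energy_ge0.
  - by move=> i _; exact: chain_energy_ge0.
  move=> i iN; have iN' : (i < N)%N := ltnW iN.
  have lt_tau (k : 'I_N) : tau k <= tau k.+1.
    by rewrite -subr_ge0 tauP exprn_ge0// ltW.
  apply: ler_rintegral.
  - apply: (chain_energy_integrable st l_gt0 rhoP chiP (r_gt0 i.+1) (tauP (Ordinal iN))
      (chain_inside (Ordinal iN))).
    by rewrite lexx (lt_tau (Ordinal iN)).
  - apply: (chain_energy_integrable st l_gt0 rhoP chiP (r_gt0 i) (tauP (Ordinal iN'))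
      (chain_inside (Ordinal iN'))).
    by rewrite lexx (lt_tau (Ordinal iN')).
  - move=> x; apply: ler_wpM2l.
      by rewrite mulr_ge0// sumr_ge0// => j _; exact: sqr_ge0.
    apply: (chi_at_le x0 chiP) => //; rewrite /r exprS -mulrA.
    by apply: ler_piMl; [exact (ltW (r_gt0 i))|exact: ltW theta_lt1].
have E0 : initial_energy x0 chi r0 (tau 0) pk = r0^-1 * en 0 0.
  by rewrite /initial_energy /en /chain_energy /r expr0 mul1r.
(* Since [Wp = W + Wm], the negative parts split off and cancel against those on the right. *)
have -> : \sum_(k < N) w k * (Wp k + D k) =
    \sum_(k < N) w k * (W k + D k) + \sum_(k < N) w k * Wm k.
  rewrite -big_split /=; apply: eq_bigr => k _; rewrite -mulrDr WE; congr (_ * _).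
  by rewrite addrAC [_ - _ + _]subrK.
rewrite lerD2r E0; under eq_bigr do rewrite step.
rewrite big_split /= addrC; apply: lerD.
  by rewrite -mulr_sumr ler_wpM2l// invr_ge0 ltW.
apply: ler_sum => k _; rewrite ler_wpM2l ?ler_norm// /w divr_ge0//; exact: ltW.
Qed.
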